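(* Let $\mathfrak g$ be a finite-dimensional complex Lie algebra whose Jordan–Kronecker invariants have Kronecker sizes $2k_1-1,\dots,2k_q-1$, among which there is no $3\times3$ Kronecker block (no $k_j=2$) and at most one $1\times1$ Kronecker block (at most one $k_j=1$). Let $J_{um}$ be the number of unique Jordan tuples with multiple maxima among the Jordan–Kronecker invariants of $\mathfrak g$. Then $J_{um}\le k_1+\dots+k_q$.
   Context: For $x\in\mathfrak g^*$, let $\mathcal A_x$ be the skew form $(\xi,\eta)\mapsto\langle x,[\xi,\eta]\rangle$. By the Jordan–Kronecker theorem, a pair of skew forms on a finite-dimensional complex vector space admits a basis in which both are block-diagonal with Jordan $2n\times2n$ blocks with eigenvalues $\mu\in\mathbb C\cup\{\infty\}$ and Kronecker $(2k-1)\times(2k-1)$ blocks ($k\ge1$); block data grouped by eigenvalue are unique. The JK invariants of $\mathfrak g$ are, for $(x,a)$ in a nonempty Zariski open subset of $\mathfrak g^*\times\mathfrak g^*$ (where they are constant), the Kronecker sizes of $(\mathcal A_x,\mathcal A_a)$ and the Jordan tuples $J_{\lambda_i}(2n_{i1},\dots,2n_{is_i})$, $n_{i1}\ge\dots\ge n_{is_i}$, giving for each distinct eigenvalue $\lambda_i$ the sizes of the Jordan blocks with that eigenvalue; they form a multiset. A Jordan tuple has multiple maxima if $s_i\ge2$ and $n_{i1}=n_{i2}$. A Jordan tuple is unique if its tuple of sizes $(2n_{i1},\dots,2n_{is_i})$ differs from the tuple of sizes of every other Jordan tuple of $\mathfrak g$. *)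

(* Defs.v *)
From HB Require Import structures.
From mathcomp Require Import all_boot all_order all_algebra.
From mathcomp Require Import complex.
From mathcomp Require Import reals.
From mathcomp Require Import mpoly.

Set Implicit Arguments.
Unset Strict Implicit.
Unset Printing Implicit Defensive.
Import GRing.Theory Num.Theory.
Local Open Scope ring_scope.

Section JK.
Variable F : fieldType.

(* A Lie algebra structure on F^n with basis e_0..e_(n-1):
   [e_i, e_j] = \sum_k c i j k e_k; alternating, skew, Jacobi. *)
Definition lie_structure (n : nat) (c : 'I_n -> 'I_n -> 'I_n -> F) : Prop :=
  [/\ (forall i k, c i i k = 0),
      (forall i j k, c i j k = - c j i k) &
      (forall i j l m,
         \sum_(k < n) (c i j k * c k l m + c j l k * c k i m + c l i k * c k j m)
         = 0)].

(* For x in g^* (coordinates in the dual basis, a row vector), the Gram matrix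
   of the skew form A_x(xi, eta) = <x, [xi, eta]> in the basis (e_i). *)
Definition form_of (n : nat) (c : 'I_n -> 'I_n -> 'I_n -> F) (x : 'rV[F]_n)
  : 'M[F]_n :=
  \matrix_(i, j) \sum_(k < n) x 0 k * c i j k.

(* n x n Jordan block with eigenvalue lam (entries outside are irrelevant) *)
Definition jordan_mx (lam : F) (i j : nat) : F :=
  if i == j then lam else if j == i.+1 then 1 else 0.

Definition id_mxf (i j : nat) : F := if i == j then 1 else 0.

Definition kron1 (i j : nat) : F := if i == j then 1 else 0.
Definition kron2 (i j : nat) : F := if i == j.+1 then 1 else 0.

(* the skew (m+m') x (m+m') matrix [[0, M], [-M^T, 0]] *)
Definition skew_of (m m' : nat) (M : nat -> nat -> F) (i j : nat) : F :=
  if ((i < m) && (m <= j < m + m'))%N then M i (j - m)%N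
  else if ((m <= i < m + m') && (j < m))%N then - M j (i - m)%N
  else 0.

(* Jordan block pair of size 2m with eigenvalue mu (None = infinity) *)
Definition jblockA (b : option F * nat) : nat -> nat -> F :=
  match b with
  | (Some lam, m) => skew_of m m (jordan_mx lam)
  | (None, m) => skew_of m m id_mxf
  end.
Definition jblockB (b : option F * nat) : nat -> nat -> F :=
  match b with
  | (Some _, m) => skew_of m m id_mxf
  | (None, m) => skew_of m m (jordan_mx 0)
  end.

Definition kblockA (k : nat) : nat -> nat -> F := skew_of k k.-1 kron1.
Definition kblockB (k : nat) : nat -> nat -> F := skew_of k k.-1 kron2.

Fixpoint bdiag (bs : seq (nat * (nat -> nat -> F))) : nat -> nat -> F :=
  match bs with
  | [::] => fun _ _ => 0
  | (s, M) :: bs' => fun i j =>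
      if (i < s)%N && (j < s)%N then M i j
      else if (s <= i)%N && (s <= j)%N then bdiag bs' (i - s)%N (j - s)%N
      else 0
  end.

Definition blocksA (jb : seq (option F * nat)) (kb : seq nat) :=
  [seq (2 * b.2, jblockA b)%N | b <- jb] ++ [seq ((2 * k).-1, kblockA k) | k <- kb].
Definition blocksB (jb : seq (option F * nat)) (kb : seq nat) :=
  [seq (2 * b.2, jblockB b)%N | b <- jb] ++ [seq ((2 * k).-1, kblockB k) | k <- kb].

(* (A, B) has JK normal form with Jordan blocks jb (eigenvalue, half-size m:
   block of size 2m) and Kronecker blocks kb (k: block of size 2k-1):
   some basis change P makes both Gram matrices block diagonal with these
   canonical blocks. *)
Definition has_JK_form (n : nat) (A B : 'M[F]_n)
    (jb : seq (option F * nat)) (kb : seq nat) : Prop :=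
  [/\ all (fun b => 0 < b.2)%N jb, all (fun k => 0 < k)%N kb,
      n = sumn [seq s.1 | s <- blocksA jb kb] &
      exists P : 'M[F]_n,
        [/\ P \in unitmx,
            P^T *m A *m P = \matrix_(i, j) bdiag (blocksA jb kb) i j &
            P^T *m B *m P = \matrix_(i, j) bdiag (blocksB jb kb) i j]].

Definition jordan_tuples (jb : seq (option F * nat)) : seq (seq nat) :=
  [seq sort geq [seq b.2 | b <- jb & b.1 == mu] | mu <- undup [seq b.1 | b <- jb]].

(* The JK invariants of the Lie algebra (n, c) are (K, T): on the nonempty
   Zariski open set {p != 0} of g^* x g^* (p a nonzero polynomial) the pair
   (A_x, A_a) has Kronecker blocks with parameters K (sizes 2k-1, k in K)
   and Jordan tuples T (as multisets). *)
Definition JK_invariants (n : nat) (c : 'I_n -> 'I_n -> 'I_n -> F)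
    (K : seq nat) (T : seq (seq nat)) : Prop :=
  exists p : {mpoly F[n + n]}, p != 0 /\
    forall x a : 'rV[F]_n,
      p.@[fun i => row_mx x a 0 i] != 0 ->
      exists jb kb, [/\ has_JK_form (form_of c x) (form_of c a) jb kb,
                        perm_eq kb K & perm_eq (jordan_tuples jb) T].

End JK.

Definition multiple_maxima (t : seq nat) : bool :=
  (1 < size t)%N && (nth 0%N t 0 == nth 0%N t 1).

Definition unique_tuple (T : seq (seq nat)) (t : seq nat) : bool :=
  count_mem t T == 1%N.

Definition J_um (T : seq (seq nat)) : nat :=
  count (fun t => multiple_maxima t && unique_tuple T t) T.

(* Main.v *)
(* Fix a generic [a].  A Jordan tuple [t] that occurs only once singles out one
   eigenvalue [lam x] of the pencil [(A_x, A_a)].  All conjugates of [lam] have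
   the same tuple, so [lam] is a rational function of [x]; a rational
   eigenvalue has no poles and grows at most linearly, so [lam x = xi x] for
   some [xi] in the Lie algebra, normalized by [xi a = 1].
   Put [y = x - lam x a] and consider the [u] in [g[e]] killed by
   [A_y - e A_a] modulo [e^m].  As the tuple does not change when [x] moves
   inside a level set of [xi], differentiating these kernels gives
   [[u, v] = const e^(m-1) xi] modulo [e^m], with a nonzero constant for the
   two chains of a Jordan block of size [2m].  Hence [A_y xi = 0], that is,
   [[xi, eta] = chi(eta) xi].  If moreover two blocks have the maximal size
   [2m], the Jacobi identity modulo [e^(2m)] puts [xi] in the sum of the upper
   halves of the Kronecker blocks, of dimension [k_1 + ... + k_q].
   If two of these vectors [xi], [xi'] had the same character [chi], then
   [xi'(z) xi - xi(z) xi'] would lie in [Ker A_z] for all [z], a kernel vector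
   of degree one in the pencil, which needs a 3x3 Kronecker block or two 1x1
   ones.  So the characters are distinct and the [xi] are independent. *)
Require Import Defs.
From HB Require Import structures.
From mathcomp Require Import all_boot all_order all_algebra.
From mathcomp Require Import complex.
From mathcomp Require Import reals.
From mathcomp Require Import boolp zify ring.
From mathcomp Require Import mpoly.

Set Implicit Arguments.
Unset Strict Implicit.
Unset Printing Implicit Defensive.
Import Order.TTheory GRing.Theory Num.Theory.
Local Open Scope ring_scope.


(** Eigenvalues and tuples do not vary polynomially with [(x, a)], but ranks are governed by minors.
    With [C = A_x - lam A_a] and [B = A_a], the operator [C - e B] on vectors modulo [e^l] has
    corank [q l] plus twice the sum of [min(n_i, l)], where [q] is the number of Kronecker blocks
    and the [n_i] are the half-sizes of the Jordan blocks at [lam]. Its ranks for all [l] thus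
    encode the tuple, and prescribing them is a system of polynomial equations and inequations in
    [x], [a], [lam]. The same ranks do the differentiation: no kernel vector is ever chosen as a
    function of [x]. Along a line inside a level set of [xi] the operator is affine in the parameter
    and its rank does not exceed the initial one, so bordered minors annihilate the first-order term
    between left and right kernel vectors. Two maximal blocks are needed because the last Jacobi
    argument tests [xi] against a chain [g] by means of two chains [e], [f] that pair to a nonzero
    constant with each other and to zero with [g]; when [g] itself lies in a maximal block, [e] and
    [f] come from the other one. *)

(** * Points where a polynomial does not vanish *)

Lemma poly_nonroot (F : numDomainType) (p : {poly F}) :
  p != 0 -> exists s, p.[s] != 0.
Proof.
move=> p0; pose rs := [seq (i%:R : F) | i <- iota 0 (size p)].
have [/allP ars|/allPn[s _ ns]] := boolP (all (root p) rs); last by exists s.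
have urs : uniq rs.
  by rewrite map_inj_uniq ?iota_uniq // => i j /eqP; rewrite eqr_nat => /eqP.
have := max_poly_roots p0 (introT allP ars) urs.
by rewrite size_map size_iota ltnn.
Qed.

(** Induction on the number of variables: [muni] reads [p] as a polynomial in the last variable, so
    a point is found for one nonzero coefficient and then a value for the last variable. *)
Lemma mpoly_nonroot (F : numDomainType) (N : nat) (p : {mpoly F[N]}) :
  p != 0 -> exists v : 'I_N -> F, p.@[v] != 0.
Proof.
elim: N p => [|N IH] p p0.
  exists (fun=> 0); rewrite mevalE; apply: contra_neq p0 => p0.
  apply/mpolyP => m; rewrite mcoeff0 (_ : m = 0%MM); last by apply/mnmP => -[].
  have [|] := boolP (0%MM \in msupp p); last by move/memN_msupp_eq0.
  move=> ms; move: p0; rewrite (bigD1_seq 0%MM) ?msupp_uniq //= big_ord0 mulr1.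
  rewrite big1 ?addr0 // => m'; apply: contra_neq_eq => _.
  by apply/mnmP => -[].
have [m0 m0s] : exists m, m \in msupp p.
  case e: (msupp p) => [|m ms]; last by exists m; rewrite mem_head.
  by move/eqP: e; rewrite msupp_eq0 (negPf p0).
pose low (m : 'X_{1..N.+1}) := [multinom (m (widen_ord (leqnSn N) i)) | i < N].
have q0 : (muni p)`_(m0 ord_max) != 0.
  suff : ((muni p)`_(m0 ord_max))@_(low m0) = p@_m0.
    by apply: contra_eq_neq => ->; rewrite mcoeff0 eq_sym -mcoeff_msupp.
  rewrite muniE coef_sum raddf_sum /= (bigD1_seq m0) ?msupp_uniq //=.
  rewrite coefZ coefXn eqxx mulr1 mcoeffZ mcoeffX eqxx mulr1.
  rewrite big1 ?addr0 // => m nm; rewrite coefZ coefXn eq_sym.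
  have [em|_] := eqVneq (m0 ord_max); last by rewrite mulr0 mcoeff0.
  rewrite mulr1 mcoeffZ mcoeffX; have [el|_] := eqVneq; last by rewrite mulr0.
  case/eqP: nm; apply/mnmP => i; have [j ->|->] := unliftP ord_max i; last by [].
  have /mnmP/(_ j) := el; rewrite !mnmE.
  suff -> : lift ord_max j = widen_ord (leqnSn N) j by [].
  by apply: val_inj; exact: lift_max.
have [v pv] := IH _ q0.
pose P := map_poly (meval v) (muni p).
have P0 : P != 0.
  apply: contra_neq pv => P0.
  by rewrite -[LHS](coef_map (meval v)) /= -/P P0 coef0.
have [s Ps] := poly_nonroot P0.
pose w (i : 'I_N.+1) := if unlift ord_max i is Some j then v j else s.
exists w; suff -> : p.@[w] = P.[s] by [].
rewrite /P muniE rmorph_sum /= horner_sum mevalE; apply: eq_bigr => m _.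
rewrite map_polyZ /= map_polyXn hornerZ hornerXn mevalZ mevalX -mulrA.
congr (_ * _); rewrite big_ord_recr /= {2}/w unlift_none; congr (_ * _).
apply: eq_bigr => i _; rewrite mnmE; congr (_ ^+ _).
rewrite /w (_ : widen_ord _ i = lift ord_max i) ?liftK //.
by apply: val_inj; symmetry; exact: lift_max.
Qed.

(** * Eigenvalues as rational functions *)

Section RationalSelection.
Variables (F : numClosedFieldType) (N : nat).
Local Notation A := {mpoly F[N]}.

Definition eval2 (v : 'I_N -> F) (x : F) (P : {poly A}) : F :=
  (map_poly (meval v) P).[x].

Lemma eval2M v x P Q : eval2 v x (P * Q) = eval2 v x P * eval2 v x Q.
Proof. by rewrite /eval2 rmorphM hornerM. Qed.

Lemma eval2D v x P Q : eval2 v x (P + Q) = eval2 v x P + eval2 v x Q.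
Proof. by rewrite /eval2 rmorphD hornerD. Qed.

Lemma eval2Z v x (c : A) P : eval2 v x (c *: P) = c.@[v] * eval2 v x P.
Proof. by rewrite /eval2 map_polyZ /= hornerZ. Qed.

Lemma eval21 v x : eval2 v x 1 = 1.
Proof. by rewrite /eval2 rmorph1 hornerC. Qed.

Lemma eval2C v x (c : A) : eval2 v x c%:P = c.@[v].
Proof. by rewrite /eval2 map_polyC hornerC. Qed.

Variables (p : A) (Lam : ('I_N -> F) -> F -> Prop).
Variables (Zs : seq {poly A}) (NZs : seq (seq {poly A})) (D : {poly A}).
Hypothesis p0 : p != 0.
Hypothesis Lam_ex : forall v, p.@[v] != 0 -> exists x, Lam v x.
Hypothesis Lam_uniq : forall v x y, p.@[v] != 0 -> Lam v x -> Lam v y -> x = y.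
Hypothesis LamP : forall v x, Lam v x <->
  (forall P, P \in Zs -> eval2 v x P = 0) /\
  (forall L, L \in NZs -> exists2 P, P \in L & eval2 v x P != 0).
Hypothesis D0 : D != 0.
Hypothesis LamD : forall v x, p.@[v] != 0 -> Lam v x -> eval2 v x D = 0.

(** The selected value is a root of [E] over a Zariski dense set of parameters; nothing is asked of
    the other roots of [E]. *)
Let dense (E : {poly A}) := forall q : A, q != 0 ->
  exists v x, [/\ q.@[v] != 0, p.@[v] != 0, Lam v x & eval2 v x E = 0].

Let dense_or (E G H : {poly A}) (c : A) : c != 0 ->
  (forall v x, c.@[v] != 0 -> eval2 v x E = 0 ->
     eval2 v x G = 0 \/ eval2 v x H = 0) ->
  dense E -> dense G \/ dense H.
Proof.
move=> c0 EGH dE; apply: contrapT => /not_orP[/existsNP[q1 nG] /existsNP[q2 nH]].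
have [q10 {}nG] := (not_implyP _ _).1 nG; have [q20 {}nH] := (not_implyP _ _).1 nH.
have [|v [x [qv pv Lv Ev]]] := dE (c * (q1 * q2)); first by rewrite !mulf_neq0.
move: qv; rewrite !mevalM !mulf_eq0 !negb_or => /and3P[cv q1v q2v].
by case: (EGH v x cv Ev) => h; [apply: nG|apply: nH]; exists v, x.
Qed.

(* A dense [E] of least degree serves as the minimal polynomial of the
   algebraic function selected by [Lam]. *)
Let min_dense : exists2 E : {poly A}, E != 0 /\ dense E &
  forall G, G != 0 -> dense G -> (size E <= size G)%N.
Proof.
pose S k := `[< exists E : {poly A}, [/\ E != 0, dense E & size E = k] >].
have exS : exists k, S k.
  exists (size D); apply/asboolP; exists D; split => // q q0.
  have [v] := mpoly_nonroot (mulf_neq0 p0 q0).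
  rewrite mevalM mulf_eq0 negb_or => /andP[pv qv].
  by have [x Lx] := Lam_ex pv; exists v, x; split => //; exact: LamD.
case: (ex_minnP exS) => k /asboolP[E [E0 dE <-]] mE; exists E => // G G0 dG.
by apply: mE; apply/asboolP; exists G.
Qed.

Let dvdp_eval2 (E H : {poly A}) : E %| H -> exists2 c : A, c != 0 &
  forall v x, c.@[v] != 0 -> eval2 v x E = 0 -> eval2 v x H = 0.
Proof.
move=> /Pdiv.Idomain.dvdpP[[c Q] /= c0 e]; exists c => // v x cv Ev.
apply: (mulfI cv); rewrite -eval2Z e eval2M Ev !mulr0 //.
Qed.

(** A dense [E] of least degree behaves like an irreducible polynomial: a proper common factor with
    [H] would split it into two factors of smaller degree, one of them dense again. Division and
    Bezout relations over [A] hold only up to a nonzero scalar of [A], which is the origin of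
    [c]. *)
Let dichotomy (E H : {poly A}) : E != 0 -> dense E ->
  (forall G, G != 0 -> dense G -> (size E <= size G)%N) ->
  E %| H \/ exists2 c : A, c != 0 &
    forall v x, c.@[v] != 0 -> eval2 v x E = 0 -> eval2 v x H != 0.
Proof.
move=> E0 dE mE; set G := gcdp H E.
have G0 : G != 0 by rewrite gcdp_eq0 negb_and E0 orbT.
have GE : G %| E by apply: dvdp_gcdr.
have GH : G %| H by apply: dvdp_gcdl.
have sGE := dvdp_leq E0 GE.
have [sG1|sG1] := eqVneq (size G) 1%N.
  right; have [[u1 u2] /= bz] := Pdiv.Idomain.Bezoutp H E.
  have /Pdiv.Idomain.eqpP[[c1 c2] /= /andP[c10 c20] e] :
    u1 * H + u2 * E %= 1.
    apply: (eqp_trans bz); rewrite -/G.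
    by rewrite -size_poly_eq1 sG1.
  exists c2 => // v x cv Ev; apply: contra_neq cv => Hv.
  have := congr1 (eval2 v x) e.
  by rewrite !eval2Z eval2D !eval2M Ev Hv !mulr0 addr0 mulr0 eval21 mulr1.
have [sGE1|sGE1] := eqVneq (size G) (size E).
  left; apply: dvdp_trans GH.
  by have := dvdp_size_eqp GE; rewrite sGE1 eqxx => /esym /andP[].
exfalso; have /Pdiv.Idomain.dvdpP[[c Q] /= c0 e] := GE.
have Q0 : Q != 0.
  apply/negP => /eqP Q0; move/eqP: e.
  by rewrite Q0 mul0r scale_poly_eq0 (negPf c0) (negPf E0).
have sE : size E = (size Q + size G).-1.
  by rewrite -(size_scale E c0) e size_mul.
have G1 : (1 < size G)%N by rewrite ltn_neqAle eq_sym sG1 size_poly_gt0.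
have EQG v x : c.@[v] != 0 -> eval2 v x E = 0 ->
    eval2 v x Q = 0 \/ eval2 v x G = 0.
  move=> cv Ev; have := congr1 (eval2 v x) e.
  rewrite eval2Z Ev mulr0 eval2M => /esym/eqP.
  by rewrite mulf_eq0 => /orP[]/eqP; [left|right].
have [/(mE _ Q0)|/(mE _ G0)] := dense_or c0 EQG dE.
- rewrite sE; case: (size Q) (size G) G1 => [|a] [|[|b]] //= _.
  by rewrite !addnS ltnNge leq_addr.
- by rewrite leqNgt ltn_neqAle sGE1 sGE.
Qed.

(** Over generic parameters every root of the minimal dense [E] satisfies the conditions that define
    [Lam]. By uniqueness there is only one root, and it is simple, so [E] has degree one. *)
Lemma rational_selection : exists q P Q : A, q != 0 /\
  forall v, q.@[v] != 0 -> Q.@[v] != 0 /\ Lam v (P.@[v] / Q.@[v]).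
Proof.
have [E [E0 dE] mE] := min_dense.
have allZ : exists2 c : A, c != 0 & forall v x P, c.@[v] != 0 ->
    eval2 v x E = 0 -> P \in Zs -> eval2 v x P = 0.
  have ZsP P : P \in Zs -> forall v x, Lam v x -> eval2 v x P = 0.
    by move=> ? v x /LamP[+ _]; apply.
  elim: (Zs) ZsP => [|P L IH] ZsP; first by exists 1; rewrite ?oner_neq0.
  have [P' P'L|c1 c10 h1] := IH; first by apply: ZsP; rewrite inE P'L orbT.
  have [/dvdp_eval2[c c0 h]|[c c0 h]] := dichotomy P E0 dE mE.
    exists (c * c1); rewrite ?mulf_neq0 // => v x P'.
    rewrite mevalM mulf_eq0 negb_or => /andP[cv c1v] Ev.
    by rewrite inE => /predU1P[->|]; [exact: h|exact: h1].
  have [v [x [cv _ Lv Ev]]] := dE _ c0.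
  by have := h v x cv Ev; rewrite (ZsP P) ?mem_head ?eqxx.
have allNZ : exists2 c : A, c != 0 & forall v x L, c.@[v] != 0 ->
    eval2 v x E = 0 -> L \in NZs -> exists2 P, P \in L & eval2 v x P != 0.
  have NZsP L : L \in NZs -> forall v x, Lam v x -> exists2 P, P \in L & eval2 v x P != 0.
    by move=> ? v x /LamP[_]; apply.
  elim: (NZs) NZsP => [|L Ls IH] NZsP; first by exists 1; rewrite ?oner_neq0.
  have [L' L'L|c1 c10 h1] := IH; first by apply: NZsP; rewrite inE L'L orbT.
  suff [P PL [c c0 h]] : exists2 P, P \in L & exists2 c : A, c != 0 &
    forall v x, c.@[v] != 0 -> eval2 v x E = 0 -> eval2 v x P != 0.
    exists (c * c1); rewrite ?mulf_neq0 // => v x L'.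
    rewrite mevalM mulf_eq0 negb_or => /andP[cv c1v] Ev.
    by rewrite inE => /predU1P[->|]; [exists P => //; exact: h|exact: h1].
  (* Otherwise [E] divides every polynomial of [L], and all of them vanish at some point where [Lam]
     asks one not to. *)
  apply: contrapT => nP.
  have [c c0 h] : exists2 c : A, c != 0 & forall v x P, c.@[v] != 0 ->
      eval2 v x E = 0 -> P \in L -> eval2 v x P = 0.
    have {}nP P : P \in L -> ~ exists2 c : A, c != 0 &
      forall v x, c.@[v] != 0 -> eval2 v x E = 0 -> eval2 v x P != 0.
      by move=> PL h; apply: nP; exists P.
    elim: (L) nP => [|P L' IHL] nP; first by exists 1; rewrite ?oner_neq0.
    have [P' P'L|c2 c20 h2] := IHL; first by apply: nP; rewrite inE P'L orbT.
    have [/dvdp_eval2[c c0 h]|//] := dichotomy P E0 dE mE; last first.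
      by move/(nP P (mem_head _ _)).
    exists (c * c2); rewrite ?mulf_neq0 // => v x P'.
    rewrite mevalM mulf_eq0 negb_or => /andP[cv c1v] Ev.
    by rewrite inE => /predU1P[->|]; [exact: h|exact: h2].
  have [v [x [cv _ Lv Ev]]] := dE _ c0.
  have [P PL] := NZsP L (mem_head _ _) v x Lv.
  by rewrite (h v x P cv Ev PL) eqxx.
have [c1 c10 h1] := allZ; have [c2 c20 h2] := allNZ.
have sE1 : (1 < size E)%N.
  rewrite ltnNge; apply/negP => /size1_polyC Ee.
  have e0 : E`_0 != 0 by apply: contra_neq E0 => h; rewrite Ee h.
  have [v [x [ev _ _]]] := dE _ e0.
  by rewrite Ee eval2C => e; rewrite e eqxx in ev.
(* Generic simplicity of the roots: in characteristic zero the derivative of [E] is nonzero, and its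
   degree is too small for a multiple of [E]. *)
have [c3 c30 h3] : exists2 c : A, c != 0 &
    forall v x, c.@[v] != 0 -> eval2 v x E = 0 -> eval2 v x E^`() != 0.
  have [EE'|//] := dichotomy E^`() E0 dE mE; exfalso.
  have E'0 : E^`() != 0.
    apply/negP => /eqP/(congr1 (fun P : {poly A} => P`_(size E).-2)).
    rewrite coef_deriv coef0; case: (size E) sE1 (lead_coefE E) => [|[|k]] //= _ lE.
    by move/eqP; rewrite -lE -mulr_natr mulf_eq0 lead_coef_eq0 (negPf E0) /= -mpolyC_nat mpolyC_eq0 pnatr_eq0.
  by have := dvdp_leq E'0 EE'; rewrite leqNgt lt_size_deriv.
pose q := p * (c1 * (c2 * (c3 * lead_coef E))).
have q0 : q != 0 by rewrite !mulf_neq0 ?lead_coef_eq0.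
have LamE v x : q.@[v] != 0 -> eval2 v x E = 0 -> Lam v x.
  rewrite !mevalM !mulf_eq0 !negb_or => /and5P[_ ? ? _ _] Ev; apply/LamP; split.
    by move=> P; apply: h1.
  by move=> L; apply: h2.
have sE v : q.@[v] != 0 -> size (map_poly (meval v) E) = size E.
  rewrite !mevalM !mulf_eq0 !negb_or => /and5P[_ _ _ _ lv].
  exact: size_map_poly_id0.
have sE2 : size E = 2%N.
  have [v qv] := mpoly_nonroot q0; rewrite -(sE _ qv); set Ev := map_poly _ _.
  have /closed_rootP[x rx] : size Ev != 1%N by rewrite (sE _ qv) neq_ltn sE1 orbT.
  have /factor_theorem[Q EQ] := rx.
  have Qx : Q.[x] != 0.
    have := h3 v x; rewrite /eval2 -deriv_map -/Ev EQ derivM derivXsubC !hornerE subrr !mulr0 add0r.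
    by apply => //; move: qv; rewrite !mevalM !mulf_eq0 !negb_or => /and5P[].
  have Q0 : Q != 0 by apply: contra_neq Qx => ->; rewrite horner0.
  rewrite EQ size_mul ?polyXsubC_eq0 // size_XsubC addn2 /=; congr _.+1.
  apply/eqP/negPn/negP => /closed_rootP[y ry].
  suff xy : x = y by move: Qx; rewrite xy; case/negP.
  have pv : p.@[v] != 0 by move: qv; rewrite mevalM mulf_eq0 negb_or => /andP[].
  apply: (Lam_uniq pv); apply: LamE => //; apply/eqP.
    exact: rx.
  by have : root Ev y by rewrite EQ rootM ry.
exists q, (- E`_0), E`_1; split => // v qv.
have E1v : (E`_1).@[v] != 0.
  move: qv; rewrite !mevalM !mulf_eq0 !negb_or => /and5P[_ _ _ _].
  by rewrite lead_coefE sE2.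
split => //; apply: LamE => //.
rewrite /eval2 horner_coef (sE _ qv) sE2 !big_ord_recl big_ord0 addr0 !coef_map /=.
by rewrite expr0 expr1 mulr1 mulrC mevalN -mulrA mulVf // mulr1 subrr.
Qed.

End RationalSelection.

(** * Ranks of Sylvester operators and the Jordan-Kronecker form *)

Section Rank.
Variable F : fieldType.

Lemma eq_mulmx_rV (m n : nat) (A B : 'M[F]_(m, n)) :
  (forall u : 'rV_m, u *m A = u *m B) -> A = B.
Proof. by move=> h; apply/row_matrixP => i; rewrite !rowE. Qed.

Lemma mxrank_mxsub (m n r s : nat) (f : 'I_r -> 'I_m) (g : 'I_s -> 'I_n)
  (M : 'M[F]_(m, n)) : (\rank (mxsub f g M) <= \rank M)%N.
Proof.
rewrite mxsubrc; apply: leq_trans (mxrankS (rowsub_sub _ _)) _.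
by rewrite -mxrank_tr -[leqRHS]mxrank_tr trmx_mxsub; apply/mxrankS/rowsub_sub.
Qed.

Lemma minor_rank (m n r : nat) (f : 'I_r -> 'I_m) (g : 'I_r -> 'I_n)
  (M : 'M[F]_(m, n)) : \det (mxsub f g M) != 0 -> (r <= \rank M)%N.
Proof.
rewrite -unitfE -unitmxE => /mxrank_unit {1}<-; exact: mxrank_mxsub.
Qed.

Lemma rank_minor (m n r : nat) (M : 'M[F]_(m, n)) : (r <= \rank M)%N ->
  exists (f : {ffun 'I_r -> 'I_m}) (g : {ffun 'I_r -> 'I_n}),
    \det (mxsub f g M) != 0.
Proof.
move=> rM; pose N := rowsub (maxrankfun M) M.
pose N' := rowsub (widen_ord rM) N.
have N'r : row_full N'^T.
  rewrite /row_full mxrank_tr /N' rowsubE.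
  rewrite mxrankMfree ?maxrowsub_free //.
  rewrite -[X in _ == X](rank_pid_mx F (leqnn r) rM); apply/eqP; congr (\rank _).
  apply/matrixP => i j; rewrite !mxE; congr (_%:R).
  by rewrite ltn_ord andbT -val_eqE.
exists [ffun i => maxrankfun M (widen_ord rM i)], (fullrankfun N'r).
have := fullrowsub_unit N'r; rewrite unitmxE unitfE -det_tr.
congr (\det _ != 0); apply/matrixP => i j; rewrite !mxE.
by rewrite [in RHS]ffunE.
Qed.

(** The form in which a rank condition becomes polynomial. The index maps may repeat a row or a
    column, which only adds zero minors. *)
Lemma mxrank_minorP (m n r : nat) (M : 'M[F]_(m, n)) :
  \rank M = r <->
  (forall (f : {ffun 'I_r.+1 -> 'I_m}) (g : {ffun 'I_r.+1 -> 'I_n}),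
      \det (mxsub f g M) = 0) /\
  (exists (f : {ffun 'I_r -> 'I_m}) (g : {ffun 'I_r -> 'I_n}),
      \det (mxsub f g M) != 0).
Proof.
split=> [<-|[zM [f [g nzM]]]].
  split; last exact: rank_minor.
  move=> f g; apply/eqP/negPn/negP => /minor_rank.
  by rewrite ltnn.
apply/eqP; rewrite eqn_leq (minor_rank nzM) andbT leqNgt.
by apply/negP => /rank_minor[f' [g']]; rewrite zM eqxx.
Qed.
End Rank.

(* [u |-> C u - B u N] acts on [n x m] matrices; its kernel consists of the
   vectors [u_0 + u_1 e + ...] over [F[e]/(e^m)] killed by [C - e B]. *)
Section Sylvester.
Definition shift_mx (R : pzRingType) (m : nat) : 'M[R]_m :=
  \matrix_(i, j) (j == i.+1 :> nat)%:R.

Definition syl (R : comNzRingType) (p q m : nat) (C B : 'M[R]_(p, q))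
  (U : 'M_(q, m)) : 'M_(p, m) := C *m U - B *m U *m shift_mx R m.

Fact syl_is_linear (R : comNzRingType) (p q m : nat) (C B : 'M[R]_(p, q)) :
  linear (@syl R p q m C B).
Proof.
move=> a u v; rewrite /syl !mulmxDr !mulmxDl -!scalemxAr -scalemxAl.
by rewrite opprD addrACA scalerBr.
Qed.
HB.instance Definition _ (R : comNzRingType) (p q m : nat) (C B : 'M[R]_(p, q)) :=
  GRing.isLinear.Build R 'M_(q, m) 'M_(p, m) _ (@syl R p q m C B)
    (@syl_is_linear R p q m C B).

Definition sylmx (R : comNzRingType) (p q : nat) (C B : 'M[R]_(p, q)) (m : nat) :=
  lin_mx (@syl R p q m C B).

Lemma lin_mxE (R : pzSemiRingType) (m1 n1 m2 n2 : nat) (f : 'M[R]_(m1, n1) -> 'M[R]_(m2, n2))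
  i j k l : lin_mx f (mxvec_index i j) (mxvec_index k l) = f (delta_mx i j) k l.
Proof. by rewrite /lin_mx mxE /= vec_mx_delta mxvecE. Qed.

Lemma map_sylmx (R S : comNzRingType) (f : {rmorphism R -> S}) (p q m : nat)
  (C B : 'M[R]_(p, q)) :
  map_mx f (sylmx C B m) = sylmx (map_mx f C) (map_mx f B) m.
Proof.
apply: map_lin_mx => A; rewrite /syl map_mxB !map_mxM /=; congr (_ - _ *m _).
by apply/matrixP => i j; rewrite !mxE rmorph_nat.
Qed.

Variable F : fieldType.
Definition syl_rank (p q : nat) (C B : 'M[F]_(p, q)) (m : nat) :=
  \rank (sylmx C B m).

Lemma syl_rank_mul_le (p q p' q' : nat) (P : 'M[F]_(p', p)) (Q : 'M[F]_(q, q'))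
  (C B : 'M_(p, q)) m : (syl_rank (P *m C *m Q) (P *m B *m Q) m <= syl_rank C B m)%N.
Proof.
rewrite /syl_rank (_ : sylmx _ _ m = lin_mulmx Q *m sylmx C B m *m lin_mulmx P).
  by apply: leq_trans (mxrankM_maxl _ _) (mxrankM_maxr _ _).
apply: eq_mulmx_rV => u; rewrite !mulmxA -[u]vec_mxK !mul_vec_lin /=.
by congr mxvec; rewrite /syl mulmxBr !mulmxA.
Qed.

Lemma syl_rank_mul (p q : nat) (P : 'M[F]_p) (Q : 'M[F]_q) (C B : 'M_(p, q)) m :
  P \in unitmx -> Q \in unitmx ->
  syl_rank (P *m C *m Q) (P *m B *m Q) m = syl_rank C B m.
Proof.
move=> Pu Qu; apply/eqP; rewrite eqn_leq syl_rank_mul_le /=.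
have e (D : 'M_(p, q)) : D = invmx P *m (P *m D *m Q) *m invmx Q.
  by rewrite !mulmxA mulVmx // mul1mx -mulmxA mulmxV ?mulmx1.
by rewrite {1}[C]e {1}[B]e; exact: syl_rank_mul_le.
Qed.

Lemma syl_rank_block (p1 q1 p2 q2 : nat) (C1 B1 : 'M[F]_(p1, q1))
  (C2 B2 : 'M[F]_(p2, q2)) m :
  syl_rank (block_mx C1 0 0 C2) (block_mx B1 0 0 B2) m =
  (syl_rank C1 B1 m + syl_rank C2 B2 m)%N.
Proof.
pose S r1 r2 : 'M[F]_((r1 + r2) * m, r1 * m + r2 * m) :=
  row_mx (lin_mx usubmx) (lin_mx dsubmx).
pose T r1 r2 : 'M[F]_(r1 * m + r2 * m, (r1 + r2) * m) :=
  col_mx (lin_mulmx (col_mx 1%:M 0)) (lin_mulmx (col_mx 0 1%:M)).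
have vS r1 r2 (u : 'M_(r1 + r2, m)) :
    mxvec u *m S r1 r2 = row_mx (mxvec (usubmx u)) (mxvec (dsubmx u)).
  by rewrite mul_mx_row !mul_vec_lin.
have vT r1 r2 (u : 'M_(r1, m)) (v : 'M_(r2, m)) :
    row_mx (mxvec u) (mxvec v) *m T r1 r2 = mxvec (col_mx u v).
  rewrite mul_row_col !mul_vec_lin /= -linearD !mul_col_mx !mul1mx !mul0mx.
  by rewrite add_col_mx addr0 add0r.
have ST r1 r2 : S r1 r2 *m T r1 r2 = 1%:M.
  apply: eq_mulmx_rV => u; rewrite -[u]vec_mxK mulmxA vS vT vsubmxK mulmx1 //.
have TS r1 r2 : T r1 r2 *m S r1 r2 = 1%:M.
  apply: eq_mulmx_rV => u; rewrite -[u]hsubmxK -[lsubmx u]vec_mxK -[rsubmx u]vec_mxK.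
  by rewrite mulmxA vT vS col_mxKu col_mxKd mulmx1.
rewrite /syl_rank -rank_diag_block_mx.
rewrite -(mxrankMfree _ (B := S p1 p2)); last by apply/row_freeP; exists (T p1 p2).
rewrite -(eqmxMfull _ (A := S q1 q2)); last by apply/row_fullP; exists (T q1 q2).
congr (\rank _); apply: eq_mulmx_rV => u; rewrite -[u]vec_mxK !mulmxA vS mul_vec_lin /= vS.
rewrite mul_row_block !mul_vec_lin !mulmx0 addr0 add0r /= -[vec_mx u]vsubmxK.
rewrite /syl !mul_block_col !mul0mx addr0 add0r mul_col_mx opp_col_mx add_col_mx.
by rewrite !addr0 !add0r !col_mxKu !col_mxKd.
Qed.

Definition rev_mx (m : nat) : 'M[F]_m := \matrix_(i, j) (i == rev_ord j)%:R.

Lemma rev_mxK (m : nat) : rev_mx m *m rev_mx m = 1%:M.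
Proof.
apply/matrixP => i j; rewrite !mxE (bigD1 (rev_ord j)) //= big1 => [|k nk].
  by rewrite !mxE eqxx mulr1 addr0 rev_ordK.
by rewrite !mxE (negPf nk) mulr0.
Qed.

(** Reversing the columns intertwines the shift with its transpose, so the transposed operator is
    the Sylvester operator of the transposed pencil. For a skew pencil this turns kernel vectors
    into kernel vectors of the transpose. *)
Lemma sylmx_tr (p q : nat) (C B : 'M[F]_(p, q)) m :
  (sylmx C B m)^T = lin_mulmxr (rev_mx m) *m sylmx C^T B^T m *m lin_mulmxr (rev_mx m).
Proof.
set W := rev_mx m; have WW := rev_mxK m.
have NW : (shift_mx F m)^T *m W = W *m shift_mx F m.
  apply/matrixP => i j; rewrite !mxE (bigD1 (rev_ord j)) //= big1 => [|k nk].
    rewrite (bigD1 (rev_ord i)) //= big1 => [|k nk].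
      rewrite !mxE rev_ordK !eqxx mulr1 mul1r !addr0; congr (_%:R).
      by have := ltn_ord i; have := ltn_ord j; rewrite /=; lia.
    rewrite !mxE (_ : (i == rev_ord k) = false) ?mul0r //.
    by apply: contra_neqF nk => /eqP ->; rewrite rev_ordK.
  by rewrite !mxE (negPf nk) mulr0.
have -> : (sylmx C B m)^T =
    lin_mx (fun U => C^T *m U - B^T *m U *m (shift_mx F m)^T).
  apply/matrixP => a b.
  case/mxvec_indexP: a => j k; case/mxvec_indexP: b => i l.
  rewrite [LHS]mxE !lin_mxE /syl !mxE.
  congr (_ - _).
    rewrite (bigD1 i) //= big1 ?addr0 => [|x nx]; last first.
      by rewrite !mxE (negPf nx) mulr0.
    rewrite [RHS](bigD1 j) //= big1 ?addr0 => [|x nx]; last first.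
      by rewrite !mxE (negPf nx) mulr0.
    by rewrite !mxE !eqxx /= eq_sym.
  rewrite (bigD1 l) //= big1 ?addr0 => [|x nx]; last first.
    rewrite mxE big1 ?mul0r // => y _.
    by rewrite !mxE (negPf nx) andbF mulr0.
  rewrite [RHS](bigD1 k) //= big1 ?addr0 => [|x nx]; last first.
    rewrite mxE big1 ?mul0r // => y _.
    by rewrite !mxE (negPf nx) andbF mulr0.
  rewrite !mxE; congr (_ * _).
  rewrite (bigD1 i) //= big1 ?addr0 => [|x nx]; last first.
    by rewrite !mxE (negPf nx) mulr0.
  rewrite [RHS](bigD1 j) //= big1 ?addr0 => [|x nx]; last first.
    by rewrite !mxE (negPf nx) mulr0.
  by rewrite !mxE !eqxx.
apply/row_matrixP => a; case/mxvec_indexP: a => j k.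
rewrite [RHS]rowE -mxvec_delta !mulmxA !mul_vec_lin /=.
apply/rowP => b; case/mxvec_indexP: b => i l; rewrite mxE lin_mxE mxvecE.
congr (fun_of_matrix _ i l); rewrite /mulmxr /syl mulmxBl -!mulmxA WW mulmx1.
by rewrite (mulmxA W _ W) -NW -mulmxA WW mulmx1.
Qed.

Lemma syl_rank_tr (p q : nat) (C B : 'M[F]_(p, q)) m :
  syl_rank C^T B^T m = syl_rank C B m.
Proof.
suff le : forall p q (C B : 'M[F]_(p, q)),
    (syl_rank C B m <= syl_rank C^T B^T m)%N.
  by apply/eqP; rewrite eqn_leq le andbT -{2}[C]trmxK -{2}[B]trmxK le.
move=> {}p {}q {}C {}B; rewrite /syl_rank -mxrank_tr sylmx_tr.
by apply: leq_trans (mxrankM_maxl _ _) (mxrankM_maxr _ _).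
Qed.

(** The columns of [U] are the coefficients of the powers of [e]; with [C] injective they vanish one
    after the other, whatever [B] is. *)
Lemma syl_rank_inj (p q : nat) (C B : 'M[F]_(p, q)) m :
  (forall v : 'cV_q, C *m v = 0 -> v = 0) -> syl_rank C B m = (q * m)%N.
Proof.
move=> Cinj; apply/eqP; rewrite -/(row_free _) -kermx_eq0; apply/rowV0P => u.
move=> /sub_kermxP; rewrite -[u]vec_mxK mul_vec_lin; set U := vec_mx u.
move=> /(canRL mxvecK)/eqP; rewrite linear0 subr_eq0 => /eqP CU.
suff -> : U = 0 by rewrite linear0.
suff h k (l : 'I_m) : (l < k)%N -> col l U = 0.
  by apply/matrixP => i l; have /colP/(_ i) := h _ l (ltnSn l); rewrite !mxE.
elim: k l => // k IH l lk; apply: Cinj; rewrite colE mulmxA CU -colE.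
apply/colP => i; rewrite !mxE big1 // => j _; rewrite [shift_mx _ _ _ _]mxE.
have [lj|] := eqVneq; last by rewrite mulr0.
rewrite mxE big1 ?mul0r // => x _.
have jk : (j < k)%N by rewrite -ltnS -lj.
by have /colP/(_ x) := IH j jk; rewrite !mxE => ->; rewrite mulr0.
Qed.

(** [M] is triangular up to reordering: row [h j] gives [v j = 0] once the entries with smaller [r]
    are known to vanish. *)
Lemma mulmx_trig_inj (p q : nat) (M : 'M[F]_(p, q)) (h : 'I_q -> 'I_p) (r : 'I_q -> nat) :
  (forall j, M (h j) j != 0) ->
  (forall j k, k != j -> (r j <= r k)%N -> M (h j) k = 0) ->
  forall v : 'cV_q, M *m v = 0 -> v = 0.
Proof.
move=> Md Mt v Mv; apply/colP => j; rewrite mxE.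
move: {2}(r j).+1 (ltnSn (r j)) => k; elim: k j => // k IH j rj.
have /colP/(_ (h j)) := Mv; rewrite !mxE (bigD1 j) //= big1 => [|x xj].
  by rewrite addr0 => /eqP; rewrite mulf_eq0 (negPf (Md j)) => /eqP.
have [/(Mt _ _ xj) ->|rx] := leqP (r j) (r x); first by rewrite mul0r.
by rewrite IH ?mulr0 // (leq_trans rx).
Qed.

(** Reading zero outside the matrix allows [i.+1] and offsets of blocks as indices without carrying
    bounds. *)
Definition mxext (n m : nat) (U : 'M[F]_(n, m)) (i l : nat) : F :=
  if insub i is Some i' then if insub l is Some l' then U i' l' else 0 else 0.

Lemma mxextE (n m : nat) (U : 'M[F]_(n, m)) i l : mxext U (i : 'I_n) (l : 'I_m) = U i l.
Proof. by rewrite /mxext !valK. Qed.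

Lemma mxext_row (n m : nat) (U : 'M[F]_(n, m)) l : mxext U n l = 0.
Proof. by rewrite /mxext insubF ?ltnn. Qed.

Lemma mxext_mul_shiftl (n m : nat) (U : 'M[F]_(n, m)) i (l : 'I_m) :
  (shift_mx F n *m U) i l = mxext U i.+1 l.
Proof.
rewrite mxE; have [lt_i|le_i] := ltnP i.+1 n; last first.
  rewrite big1 => [|j _]; first by rewrite /mxext insubF // ltnNge le_i.
  by rewrite mxE (_ : _ == _ = false) ?mul0r //; have := ltn_ord j; lia.
rewrite (bigD1 (Ordinal lt_i)) //= big1 => [|j nj]; last first.
  rewrite mxE (_ : _ == _ = false) ?mul0r //; apply: contra_neqF nj => /eqP e.
  exact: val_inj.
by rewrite mxE eqxx mul1r addr0 -mxextE.
Qed.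

Lemma mxext_mul_shiftr (n m : nat) (U : 'M[F]_(n, m)) (i : 'I_n) (l : 'I_m) :
  (U *m shift_mx F m) i l = if (l : nat) is l'.+1 then mxext U i l' else 0.
Proof.
rewrite mxE; case: l => [[|l] lm] /=.
  by rewrite big1 // => j _; rewrite mxE /= mulr0.
rewrite (bigD1 (Ordinal (ltnW lm))) //= big1 => [|j nj]; last first.
  rewrite mxE (_ : _ == _ = false) ?mulr0 //=; apply: contra_neqF nj => /eqP[e].
  exact/val_inj.
by rewrite mxE /= eqxx mulr1 addr0 -mxextE.
Qed.

(** The kernel consists of matrices constant along diagonals and zero below the main one; the last
    row, which has no successor, kills further diagonals when [n < m]. What remains are the
    [minn n m] diagonals nearest the upper right corner, and [E k] is the indicator of
    [l - i = m - 1 - k]. *)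
Lemma syl_rank_shift (n m : nat) :
  syl_rank (shift_mx F n) 1%:M m = (n * m - minn n m)%N.
Proof.
set d := minn n m.
pose E k : 'M[F]_(n, m) := \matrix_(i, l) (m + i == l + k + 1)%N%:R.
pose Phi : 'M[F]_(d, n * m) := \matrix_(k < d) mxvec (E k).
have PhiE (g : 'rV_d) : g *m Phi = mxvec (\sum_k g 0 k *: E k).
  rewrite mulmx_sum_row linear_sum; apply: eq_bigr => k _.
  by rewrite rowK linearZ.
have Phi_free : row_free Phi.
  rewrite -kermx_eq0; apply/rowV0P => g /sub_kermxP; rewrite PhiE.
  move=> /(canRL mxvecK); rewrite linear0 => /matrixP gE.
  apply/rowP => k; have kd := ltn_ord k; rewrite mxE.
  have n0 : (0 < n)%N by move: kd; rewrite /d; lia.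
  have km : (m - 1 - k < m)%N by move: kd; rewrite /d; lia.
  have := gE (Ordinal n0) (Ordinal km); rewrite summxE mxE (bigD1 k) //= big1 => [|k' nk].
    rewrite !mxE addr0 (_ : (_ == _) = true) ?mulr1 //=.
    by move: kd; rewrite /d; lia.
  rewrite !mxE (_ : (_ == _) = false) ?mulr0 //=; apply: contra_neqF nk => /eqP e.
  by apply: val_inj => /=; move: kd e; rewrite /d; lia.
have ker_eq (U : 'M[F]_(n, m)) : syl (shift_mx F n) 1%:M U = 0 <->
    forall (i : 'I_n) (l : 'I_m),
    mxext U i.+1 l = if (l : nat) is l'.+1 then mxext U i l' else 0.
  rewrite /syl mul1mx; split=> [/eqP|h].
    rewrite subr_eq0 => /eqP/matrixP h i l; have := h i l.
    by rewrite mxext_mul_shiftl mxext_mul_shiftr.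
  apply/eqP; rewrite subr_eq0; apply/eqP/matrixP => i l.
  by rewrite mxext_mul_shiftl mxext_mul_shiftr.
suff kerPhi : (kermx (sylmx (shift_mx F n) 1%:M m) == Phi)%MS.
  have := mxrank_ker (sylmx (shift_mx F n) 1%:M m).
  rewrite (eqmxP kerPhi) (eqP Phi_free) -/(syl_rank _ _ _) => ->.
  by rewrite subKn // rank_leq_row.
apply/andP; split; last first.
  apply/row_subP => k; rewrite rowK; apply/sub_kermxP; rewrite mul_vec_lin /=.
  rewrite (ker_eq (E k)).2 ?linear0 // => i l; have kd := ltn_ord k.
  have xE a b : (a < n)%N -> (b < m)%N -> mxext (E k) a b = (m + a == b + k + 1)%N%:R.
    by move=> an bm; rewrite (mxextE (E k) (Ordinal an) (Ordinal bm)) mxE.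
  have := ltn_ord i; have := ltn_ord l; move: (nat_of_ord l) (nat_of_ord i) => b a bm an.
  case: b bm => [|b] bm.
    have [an1|an1] := ltnP a.+1 n; last first.
      by rewrite (_ : a.+1 = n) ?mxext_row //; lia.
    by rewrite xE // (_ : _ == _ = false) //; move: kd; rewrite /d; lia.
  have [an1|an1] := ltnP a.+1 n.
    by rewrite !xE ?(ltnW bm) //; congr (_%:R); lia.
  rewrite (_ : a.+1 = n) ?mxext_row ?xE ?(ltnW bm) //; last by lia.
  by rewrite (_ : _ == _ = false) //; move: kd; rewrite /d; lia.
apply/rV_subP => u /sub_kermxP; rewrite -[u]vec_mxK mul_vec_lin.
move: (vec_mx u) => {u} U /(canRL mxvecK); rewrite linear0 => /ker_eq kU.
pose x := mxext U.
have x0 i : x i.+1 0%N = 0.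
  have [im|im] := ltnP i.+1 n; last by rewrite /x /mxext insubF // ltnNge im.
  case: (posnP m) => [m0|m0]; first by rewrite /x /mxext; case: insubP => //= ? _ _; rewrite insubF // m0.
  by have := kU (Ordinal (ltnW im)) (Ordinal m0).
have xS i l : (i < n)%N -> (l.+1 < m)%N -> x i.+1 l.+1 = x i l.
  by move=> im lm; have := kU (Ordinal im) (Ordinal lm).
have xd j l : (j <= n)%N -> (l + j < m)%N -> x j (l + j)%N = x 0%N l.
  elim: j => [|j IH] jn lm; first by rewrite addn0.
  by rewrite addnS xS ?IH //; lia.
have xl j l : (l < m)%N -> (l + j.+1 < n)%N -> x (l + j.+1)%N l = 0.
  elim: l => [|l IH] lm ln; first by rewrite add0n.
  by rewrite addSn xS ?IH //; lia.
apply/submxP; exists (\row_(k < d) x 0%N (m - 1 - k)%N); rewrite PhiE.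
congr mxvec; apply/matrixP => i l; rewrite summxE.
have im := ltn_ord i; have lm := ltn_ord l.
rewrite -mxextE -/(x _ _); have [il|il] := leqP i l; last first.
  rewrite (_ : nat_of_ord i = (l + (i - l.+1).+1)%N) ?xl //; try lia.
  rewrite big1 // => k _; have kd := ltn_ord k.
  by rewrite !mxE (_ : _ == _ = false) ?mulr0 //; move: kd; rewrite /d; lia.
have xil : x i l = x 0%N (l - i)%N by rewrite -(xd i) ?subnK // ltnW.
have [kd|kd] := ltnP (m - 1 - l + i)%N d.
  rewrite (bigD1 (Ordinal kd)) //= big1 ?addr0 => [|k nk].
    rewrite !mxE (_ : _ == _ = true) ?mulr1 /= ?xil; last by lia.
    by congr (x _ _); lia.
  rewrite !mxE (_ : _ == _ = false) ?mulr0 //.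
  by apply: contra_neqF nk => /eqP e; apply: val_inj => /=; lia.
rewrite big1 => [|k _]; last first.
  by have kd' := ltn_ord k; rewrite !mxE (_ : _ == _ = false) ?mulr0 //; lia.
rewrite xil -(xd n) //; last by move: kd; rewrite /d; lia.
exact: mxext_row.
Qed.
End Sylvester.

(** * Sylvester ranks of the canonical blocks *)

Section Blocks.
Variable F : fieldType.
Implicit Types (M : nat -> nat -> F) (lam : F).

Definition mxf (p q : nat) M : 'M[F]_(p, q) := \matrix_(i, j) M i j.

Lemma bdiag_block (s n : nat) M (bs : seq (nat * (nat -> nat -> F))) :
  mxf (s + n) (s + n) (bdiag ((s, M) :: bs)) =
  block_mx (mxf s s M) 0 0 (mxf n n (bdiag bs)).
Proof.
apply/matrixP => i j; case: (split_ordP i) => i' ->; case: (split_ordP j) => j' ->.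
- by rewrite block_mxEul !mxE /= !ltn_ord.
- by rewrite block_mxEur !mxE /= ltn_ord ltnNge leq_addr /= leqNgt ltn_ord.
- by rewrite block_mxEdl !mxE /= ltn_ord ltnNge leq_addr /= leqNgt ltn_ord.
- by rewrite block_mxEdr !mxE /= ltnNge leq_addr /= leq_addr !addKn.
Qed.

Definition blk := ((option F * nat) + nat)%type.
Definition blk_size (d : blk) : nat :=
  match d with inl b => 2 * b.2 | inr k => (2 * k).-1 end.
Definition blkA (d : blk) := match d with inl b => jblockA b | inr k => kblockA F k end.
Definition blkB (d : blk) := match d with inl b => jblockB b | inr k => kblockB F k end.
Definition blks (jb : seq (option F * nat)) (kb : seq nat) : seq blk :=
  map inl jb ++ map inr kb.
Definition bdiagf (f : blk -> nat -> nat -> F) (ds : seq blk) :=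
  bdiag [seq (blk_size d, f d) | d <- ds].
Definition blks_size (ds : seq blk) := sumn (map blk_size ds).

Lemma blocksAE jb kb : bdiag (blocksA jb kb) = bdiagf blkA (blks jb kb).
Proof. by rewrite /bdiagf /blks map_cat -!map_comp. Qed.

Lemma blocksBE jb kb : bdiag (blocksB jb kb) = bdiagf blkB (blks jb kb).
Proof. by rewrite /bdiagf /blks map_cat -!map_comp. Qed.

Lemma blocksA_size jb kb :
  sumn [seq s.1 | s <- blocksA jb kb] = blks_size (blks jb kb).
Proof. by rewrite /blks_size /blks /blocksA !map_cat -!map_comp. Qed.

Lemma bdiagfB (f g : blk -> nat -> nat -> F) lam ds i j :
  bdiagf f ds i j - lam * bdiagf g ds i j =
  bdiagf (fun d i j => f d i j - lam * g d i j) ds i j.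
Proof.
elim: ds i j => [|d ds IH] i j; rewrite /bdiagf /=; first by rewrite mulr0 subr0.
by case: ifP => // _; case: ifP => // _; rewrite ?mulr0 ?subr0 // IH.
Qed.

Lemma syl_rank_bdiagf (f g : blk -> nat -> nat -> F) ds m :
  let n := blks_size ds in
  syl_rank (mxf n n (bdiagf f ds)) (mxf n n (bdiagf g ds)) m =
  (\sum_(d <- ds) syl_rank (mxf (blk_size d) (blk_size d) (f d))
                           (mxf (blk_size d) (blk_size d) (g d)) m)%N.
Proof.
elim: ds => [|d ds IH] /=.
  rewrite big_nil /syl_rank; apply/eqP; rewrite -leqn0.
  by apply: leq_trans (rank_leq_row _) _; rewrite mul0n.
by rewrite big_cons -IH -syl_rank_block -!bdiag_block.
Qed.

Lemma skew_of_block (m m' : nat) M :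
  mxf (m + m') (m + m') (skew_of m m' M) =
  block_mx 0 (mxf m m' M) (- (mxf m m' M)^T) 0.
Proof.
apply/matrixP => i j; rewrite /skew_of.
case: (split_ordP i) => i' ->; case: (split_ordP j) => j' ->.
- by rewrite block_mxEul !mxE /= ltn_ord leqNgt ltn_ord /= leqNgt ltn_ord.
- by rewrite block_mxEur !mxE /= ltn_ord leq_addr ltn_add2l ltn_ord addKn.
- by rewrite block_mxEdl !mxE /= ltn_ord leq_addr ltn_add2l ltn_ord addKn ltnNge leq_addr.
- by rewrite block_mxEdr !mxE /= !(ltnNge (m + _)) !leq_addr /= andbF.
Qed.

(** Exchanging the two column blocks and changing one sign turns the skew matrix into a block
    diagonal one with blocks [M] and its transpose, which have equal Sylvester ranks. *)
Lemma syl_rank_skew (s m m' : nat) M M' l : s = (m + m')%N ->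
  syl_rank (mxf s s (skew_of m m' M)) (mxf s s (skew_of m m' M')) l =
  (2 * syl_rank (mxf m m' M) (mxf m m' M') l)%N.
Proof.
move=> ->; rewrite !skew_of_block mul2n -addnn -{2}(syl_rank_tr (mxf m m' M)) -syl_rank_block.
set C := mxf m m' M; set B := mxf m m' M'.
pose P : 'M[F]_(m + m') := block_mx 1%:M 0 0 (- 1%:M).
pose Q : 'M[F]_(m + m', m' + m) := block_mx 0 1%:M 1%:M 0.
pose Q' : 'M[F]_(m' + m, m + m') := block_mx 0 1%:M 1%:M 0.
have e1 D : P *m block_mx 0 D (- D^T) 0 *m Q = block_mx D 0 0 D^T.
  by rewrite !mulmx_block !(mul0mx, mulmx0, mul1mx, mulmx1, mulNmx, addr0, add0r, oppr0, opprK).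
have e2 D : P *m block_mx D 0 0 D^T *m Q' = block_mx 0 D (- D^T) 0.
  by rewrite !mulmx_block !(mul0mx, mulmx0, mul1mx, mulmx1, mulNmx, addr0, add0r, oppr0, opprK).
by apply/eqP; rewrite eqn_leq -{1}(e2 C) -{1}(e2 B) -{3}(e1 C) -{3}(e1 B) !syl_rank_mul_le.
Qed.

Lemma skew_ofB (m m' : nat) M M' lam i j :
  skew_of m m' M i j - lam * skew_of m m' M' i j =
  skew_of m m' (fun i j => M i j - lam * M' i j) i j.
Proof. by rewrite /skew_of; do 2?case: ifP => _; ring. Qed.

(** The corank contributed by one block. Jordan blocks with another eigenvalue, infinity included,
    are invertible; a Kronecker block of size [2 k - 1] has rank [2 (k - 1)] at every [lam]. *)
Definition blk_drop lam (d : blk) (l : nat) : nat :=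
  match d with
  | inl (mu, n) => if mu == Some lam then 2 * minn n l else 0
  | inr _ => l
  end.

Lemma eq_mxf {p q : nat} M M' : M =2 M' -> mxf p q M = mxf p q M'.
Proof. by move=> e; apply/matrixP => i j; rewrite !mxE. Qed.

Lemma jordan_mx_shift n : mxf n n (jordan_mx 0) = shift_mx F n.
Proof.
apply/matrixP => i j; rewrite !mxE /jordan_mx.
have [->|_] := eqVneq (nat_of_ord i) j; last by case: ifP.
by rewrite (_ : _ == _ = false) //; lia.
Qed.

Lemma id_mxf_1 n : mxf n n (@id_mxf F) = 1%:M.
Proof. by apply/matrixP => i j; rewrite !mxE /id_mxf -val_eqE; case: eqP. Qed.

Lemma blk_syl_rank lam (d : blk) l :
  (if d is inr k then (0 < k)%N else true) ->
  let s := blk_size d in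
  (syl_rank (mxf s s (fun i j => blkA d i j - lam * blkB d i j)%R)
     (mxf s s (blkB d)) l + blk_drop lam d l = s * l)%N.
Proof.
case: d => [[[mu|] n]|k] hk s /=.
- rewrite (eq_mxf (skew_ofB _ _ _ _ lam)) syl_rank_skew; last by rewrite /s /=; lia.
  rewrite /s /= -mulnA; have [[->]|nm] := eqVneq.
    rewrite (eq_mxf (M' := jordan_mx 0)) => [|i j]; last first.
      by rewrite /jordan_mx /id_mxf; case: (i == j); rewrite ?mulr1 ?subrr ?mulr0 ?subr0.
    rewrite jordan_mx_shift id_mxf_1 syl_rank_shift -mulnDr subnK //.
    by rewrite geq_min; have [->|l0] := posnP l; rewrite ?leqn0 ?orbT // leq_pmulr.
  rewrite addn0; congr (2 * _)%N; apply: syl_rank_inj.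
  apply: (mulmx_trig_inj (h := id) (r := fun j : 'I_n => (n - j)%N)) => [j|j k kj rjk].
    rewrite !mxE /jordan_mx /id_mxf eqxx mulr1 subr_eq0.
    by apply: contra_neq nm => ->.
  rewrite !mxE /jordan_mx /id_mxf; have := ltn_ord j; have := ltn_ord k.
  move: kj; rewrite -val_eqE /= => kj kn jn; rewrite eq_sym (negPf kj).
  by rewrite (_ : _ == _ = false) ?mulr0 ?subr0 //; lia.
- rewrite (eq_mxf (skew_ofB _ _ _ _ lam)) syl_rank_skew; last by rewrite /s /=; lia.
  rewrite /s /= -mulnA addn0; congr (2 * _)%N; apply: syl_rank_inj.
  apply: (mulmx_trig_inj (h := id) (r := fun j : 'I_n => (n - j)%N)) => [j|j k kj rjk].
    by rewrite !mxE /jordan_mx /id_mxf eqxx mulr0 subr0 oner_eq0.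
  rewrite !mxE /jordan_mx /id_mxf; have := ltn_ord j; have := ltn_ord k.
  move: kj; rewrite -val_eqE /= => kj kn jn; rewrite eq_sym (negPf kj).
  by rewrite (_ : _ == _ = false) ?mulr0 ?subr0 //; lia.
- rewrite (eq_mxf (skew_ofB _ _ _ _ lam)) syl_rank_skew; last by rewrite /s /=; lia.
  rewrite syl_rank_inj.
    have e : (2 * k).-1 = (2 * k.-1).+1 by lia.
    by rewrite /s /= e [RHS]mulSn mulnA addnC.
  apply: (mulmx_trig_inj (h := widen_ord (leq_pred k)) (r := fun j : 'I_k.-1 => j : nat)) => [j|j x xj jx].
    by rewrite !mxE /kron1 /kron2 /= eqxx (ltn_eqF (ltnSn _)) mulr0 subr0 oner_eq0.
  rewrite !mxE /kron1 /kron2 /=; move: xj; rewrite -val_eqE /= => xj.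
  rewrite eq_sym (negPf xj).
  by rewrite (_ : _ == _ = false) ?mulr0 ?subr0 //; lia.
Qed.

(** Kronecker blocks enter only through their number, so the ranks at [lam] see nothing else than
    the tuple of [lam]. *)
Lemma JK_syl_rank (n : nat) (A B : 'M[F]_n) jb kb lam l :
  has_JK_form A B jb kb ->
  (syl_rank (A - lam *: B)%R B l +
   2 * (\sum_(b <- jb | b.1 == Some lam) minn b.2 l) + size kb * l = n * l)%N.
Proof.
case=> jb0 kb0; rewrite blocksA_size blocksAE blocksBE => en [P [Pu PA PB]].
subst n; rewrite -(syl_rank_mul (P := P^T) (Q := P)) ?unitmx_tr //.
rewrite mulmxBr mulmxBl -scalemxAr -scalemxAl PA PB.
set ds := blks jb kb; set n := blks_size ds.
rewrite (_ : _ - _ = mxf n n (bdiagf (fun d i j => blkA d i j - lam * blkB d i j) ds)); last first.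
  by apply/matrixP => i j; rewrite !mxE bdiagfB.
rewrite syl_rank_bdiagf -addnA.
have -> : (2 * (\sum_(b <- jb | b.1 == Some lam) minn b.2 l) + size kb * l =
   \sum_(d <- ds) blk_drop lam d l)%N.
  rewrite /ds big_cat /= !big_map; congr (_ + _)%N.
    rewrite big_distrr big_mkcond /=; apply: eq_bigr => -[mu k] _ //=.
  by rewrite /= big_const_seq count_predT iter_addn_0 mulnC.
rewrite -big_split /= big_seq (eq_bigr (fun d => blk_size d * l)%N) => [|d dds].
  by rewrite -big_seq -big_distrl /= /n /blks_size sumnE big_map.
apply: blk_syl_rank; case: d dds => // k; rewrite mem_cat => /orP[/mapP[]//|/mapP[k' k'kb [->]]].
by move/allP: kb0; apply.
Qed.
End Blocks.

(** From [l] to [l.+1] the sum grows by the number of entries exceeding [l], and these numbers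
    determine the multiset. The bound [L] reduces the hypothesis to finitely many [l]. *)
Lemma sum_minn_perm (L : nat) (s t : seq nat) :
  all (fun k => 0 < k <= L)%N s -> all (fun k => 0 < k <= L)%N t ->
  (forall l, (l <= L)%N ->
     \sum_(k <- s) minn k l = \sum_(k <- t) minn k l)%N ->
  perm_eq s t.
Proof.
move=> sL tL eL.
have sat (u : seq nat) l : all (fun k => 0 < k <= L)%N u -> (L <= l)%N ->
    (\sum_(k <- u) minn k l = \sum_(k <- u) minn k L)%N.
  move=> /allP uL Ll; rewrite !big_seq; apply: eq_bigr => k /uL /andP[_ kL].
  by rewrite (minn_idPl kL) (minn_idPl (leq_trans kL Ll)).
have {eL} el l : (\sum_(k <- s) minn k l = \sum_(k <- t) minn k l)%N.
  by have [/eL//|/ltnW Ll] := leqP l L; rewrite !(sat _ l) // eL.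
have step (u : seq nat) l : (\sum_(k <- u) minn k l.+1 =
    \sum_(k <- u) minn k l + count (fun k => l < k)%N u)%N.
  rewrite -sum1_count [X in (_ + X)%N]big_mkcond -big_split /=.
  by apply: eq_bigr => k _; case: leqP; lia.
have cnt l : count (fun k => l < k)%N s = count (fun k => l < k)%N t.
  by have := step s l; rewrite !el step => /addnI.
apply/allP => v _; apply/eqP; case: v => [|v].
  have z (u : seq nat) : all (fun k => 0 < k <= L)%N u -> count_mem 0%N u = 0%N.
    by move=> /allP uL; apply/count_memPn/negP => /uL.
  by rewrite !z.
have split (u : seq nat) : (count (fun k => v < k)%N u =
    count_mem v.+1 u + count (fun k => v.+1 < k)%N u)%N.
  rewrite -count_predUI [X in (_ + X)%N](eq_count (a2 := pred0)) ?count_pred0 ?addn0.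
    by apply: eq_count => k /=; lia.
  by move=> k /=; lia.
by have := cnt v; rewrite !split cnt => /addIn.
Qed.

(** * Tuples as rank profiles *)

Section Profile.
Variable F : fieldType.

Lemma syl_rank1 (p q : nat) (C B : 'M[F]_(p, q)) : syl_rank C B 1 = \rank C.
Proof.
rewrite /syl_rank -(mxrank_tr C); apply/eqP; rewrite eqn_leq.
have e i j k l : sylmx C B 1 (mxvec_index i j) (mxvec_index k l) = C k i.
  rewrite lin_mxE /syl !mxE (bigD1 i) //= big1 => [|x nx]; last first.
    by rewrite mxE (negPf nx) mulr0.
  rewrite [X in _ - X]big1 => [|x _]; last by rewrite !mxE !ord1 mulr0.
  by rewrite !mxE !ord1 !eqxx mulr1 addr0 subr0.
pose g r (k : 'I_(r * 1)) := (pair_of_mxvec_index (mxvec_indexP k)).1.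
apply/andP; split.
  rewrite (_ : sylmx C B 1 = mxsub (@g q) (@g p) C^T) ?mxrank_mxsub //.
  apply/matrixP => a b; rewrite [RHS]mxE [RHS]mxE /g.
  by case: (mxvec_indexP a) => i j; case: (mxvec_indexP b) => k l; rewrite e.
rewrite (_ : C^T = mxsub (fun i => mxvec_index i 0) (fun j => mxvec_index j 0) (sylmx C B 1)) ?mxrank_mxsub //.
by apply/matrixP => i j; rewrite mxE; symmetry; rewrite mxE e.
Qed.

Variables (n : nat) (A B : 'M[F]_n) (jb : seq (option F * nat)) (kb : seq nat).
Hypothesis JK : has_JK_form A B jb kb.

Lemma JK_jordan_size (b : option F * nat) : b \in jb -> (0 < b.2 <= n)%N.
Proof.
case: JK => /allP jb0 _ en _ bjb; rewrite en blocksA_size.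
rewrite jb0 //= /blks_size /blks map_cat sumn_cat -map_comp.
rewrite (perm_sumn (perm_map _ (perm_to_rem bjb))) /=; lia.
Qed.

(** Every Kronecker block and every Jordan block at infinity lowers the rank of [B] by at least one,
    which [dr] records. Consequently infinity is no eigenvalue once [B] has the generic rank. *)
Lemma JK_infty_rank : None \in map fst jb -> (\rank B + size kb < n)%N.
Proof.
case: JK => jb0 kb0; rewrite blocksA_size blocksBE => en [P [Pu _ PB]] infj.
have -> : \rank B = \rank (P^T *m B *m P).
  have := @syl_rank_mul F n n P^T P B 0 1.
  by rewrite mulmx0 mul0mx !syl_rank1 => -> //; rewrite unitmx_tr.
move: PB; subst n => ->; set ds := blks jb kb; set n := blks_size ds.
have -> : \matrix_(i, j) bdiagf (@blkB F) ds i j = mxf n n (bdiagf (@blkB F) ds) by [].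
rewrite -(syl_rank1 _ (mxf n n (bdiagf (fun _ _ _ => 0) ds))) syl_rank_bdiagf.
pose dr (d : blk F) : nat := match d with inl (None, _) | inr _ => 1 | _ => 0 end.
have rk_le d : d \in ds ->
    (syl_rank (mxf (blk_size d) (blk_size d) (blkB d))
       (mxf (blk_size d) (blk_size d) (fun _ _ => 0%R)) 1 + dr d <= blk_size d)%N.
  rewrite mem_cat => /orP[/mapP[[[mu|] m] bjb ->]|/mapP[k kkb ->]].
  - by rewrite addn0 syl_rank1 rank_leq_row.
  - have /= m0 := allP jb0 _ bjb.
    rewrite syl_rank1 -(syl_rank1 _ (mxf (2 * m) (2 * m) (skew_of m m (jordan_mx (0:F))))).
    rewrite syl_rank_skew ?syl_rank1; last lia.
    rewrite jordan_mx_shift /=.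
    suff : (\rank (shift_mx F m) < m)%N by lia.
    rewrite ltn_neqAle rank_leq_row andbT -/(row_free _) -kermx_eq0.
    apply/negP => /eqP ker0; have m1 : (m.-1 < m)%N by rewrite ltn_predL.
    have : (delta_mx 0 (Ordinal m1) : 'rV[F]_m) *m shift_mx F m = 0.
      apply/rowP => j; rewrite -rowE !mxE /= (_ : _ == _ = false) //.
      by have := ltn_ord j; lia.
    move/sub_kermxP; rewrite ker0 submx0 => /eqP/matrixP/(_ 0 (Ordinal m1))/eqP.
    by rewrite !mxE !eqxx oner_eq0.
  - have k0 := allP kb0 _ kkb.
    rewrite syl_rank1 -(syl_rank1 _ (mxf (2 * k).-1 (2 * k).-1 (skew_of k k.-1 (@kron1 F)))).
    rewrite syl_rank_skew ?syl_rank1 /=; last lia.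
    have := rank_leq_col (mxf k k.-1 (@kron2 F)); lia.
have : (0 < \sum_(d <- ds) (dr d - (if d is inr _ then 1 else 0)))%N.
  have /mapP[[[//|] m] mjb _] := infj.
  rewrite /ds big_cat /= big_map (perm_big _ (perm_to_rem mjb)) big_cons /=.
  by [].
have : (\sum_(d <- ds) (if d is inr _ then 1 else 0) = size kb)%N.
  rewrite /ds big_cat /= !big_map big1 ?add0n //= sum1_size //.
have : (\sum_(d <- ds) (syl_rank (mxf (blk_size d) (blk_size d) (blkB d))
   (mxf (blk_size d) (blk_size d) (fun _ _ => 0%R)) 1 + dr d) <= n)%N.
  rewrite /n /blks_size sumnE big_map big_seq [leqRHS]big_seq.
  exact: leq_sum.
rewrite big_split /=.
have : (\sum_(d <- ds) dr d = \sum_(d <- ds) (dr d - (if d is inr _ then 1 else 0)) +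
   \sum_(d <- ds) (if d is inr _ then 1 else 0))%N.
  by rewrite -big_split; apply: eq_bigr => -[[[?|] ?]|?].
by lia.
Qed.

(* By [JK_syl_rank], this holds at the eigenvalues whose tuple is [t], when
   [q] is the number of Kronecker blocks. *)
Definition has_profile (q : nat) (t : seq nat) (C D : 'M[F]_n) (lam : F) :=
  forall l, (l <= n)%N ->
  (syl_rank (C - lam *: D)%R D l + 2 * (\sum_(k <- t) minn k l) + q * l = n * l)%N.

Lemma tuple_profile lam t :
  sort geq [seq b.2 | b <- jb & b.1 == Some lam] = t -> has_profile (size kb) t A B lam.
Proof.
move=> <- l _; have := JK_syl_rank lam l JK.
rewrite -(big_filter _ (fun b => _ == _)) -(big_map snd xpredT (minn^~ l)).
by rewrite (perm_big (sort geq [seq b.2 | b <- jb & b.1 == Some lam])) // perm_sym perm_sort.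
Qed.

Lemma profile_tuple lam t : sorted geq t -> all (fun k => 0 < k <= n)%N t ->
  has_profile (size kb) t A B lam ->
  sort geq [seq b.2 | b <- jb & b.1 == Some lam] = t.
Proof.
move=> st tn prof; rewrite -[RHS](sorted_sort (leT := geq)) //; last first.
  by move=> x y z /= xy yz; apply: leq_trans xy.
have geq_total : total geq by move=> x y /=; exact: leq_total.
have geq_trans : transitive geq by move=> y x z /= yx zy; exact: leq_trans zy yx.
have geq_anti : antisymmetric geq by move=> x y /= /anti_leq.
apply/perm_sortP => //; apply: (@sum_minn_perm n) => // [|l ln].
  apply/allP => k /mapP[b]; rewrite mem_filter => /andP[_ bjb] ->.
  exact: JK_jordan_size.
have := JK_syl_rank lam l JK; rewrite -(prof l ln).
rewrite -(big_filter _ (fun b => _ == _)) -(big_map snd xpredT (minn^~ l)).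
by move/addIn/addnI/eqP; rewrite eqn_pmul2l // => /eqP.
Qed.
End Profile.

(** * Rank conditions as polynomial conditions *)

Section Selection.
Variables (F : numClosedFieldType) (N : nat).
Local Notation A := {mpoly F[N]}.

Definition eval2_morph (v : 'I_N -> F) (x : F) : {rmorphism {poly A} -> F} :=
  horner_eval x \o map_poly (meval v).

Lemma eval2_det_mxsub v x (a b r : nat) (M : 'M[{poly A}]_(a, b))
  (f : 'I_r -> 'I_a) (g : 'I_r -> 'I_b) :
  eval2 v x (\det (mxsub f g M)) = \det (mxsub f g (map_mx (eval2_morph v x) M)).
Proof. by rewrite -map_mxsub det_map_mx. Qed.

(** The minors of size [rho l + 1] form the equations [Zs]; those of size [rho l] form, for each
    [l], a list in [NZs] of which one member must survive. *)
Lemma rank_selection (p : A) (L : nat) (a b : nat -> nat)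
    (S : forall l, 'M[{poly A}]_(a l, b l)) (rho : nat -> nat) (D : {poly A}) :
  let Lam v x := forall l, (l <= L)%N -> \rank (map_mx (eval2_morph v x) (S l)) = rho l in
  p != 0 ->
  (forall v, p.@[v] != 0 -> exists x, Lam v x) ->
  (forall v x y, p.@[v] != 0 -> Lam v x -> Lam v y -> x = y) ->
  D != 0 -> (forall v x, p.@[v] != 0 -> Lam v x -> eval2 v x D = 0) ->
  exists q P Q : A, q != 0 /\
    forall v, q.@[v] != 0 -> Q.@[v] != 0 /\ Lam v (P.@[v] / Q.@[v]).
Proof.
move=> Lam p0 Lex Luniq D0 LD.
pose minors l r := [seq \det (mxsub (f : {ffun 'I_r -> 'I_(a l)}) (g : {ffun 'I_r -> 'I_(b l)}) (S l))
  | f <- enum {ffun 'I_r -> 'I_(a l)}, g <- enum {ffun 'I_r -> 'I_(b l)}].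
pose Zs := flatten [seq minors l (rho l).+1 | l <- iota 0 L.+1].
pose NZs := [seq minors l (rho l) | l <- iota 0 L.+1].
apply: (@rational_selection F N p Lam Zs NZs D) => // v x; split=> [Lv|[Z NZ] l lL].
  split=> [P /flattenP[s /mapP[l]]|s /mapP[l]]; rewrite mem_iota => lL ->;
    have /mxrank_minorP[z [f [g nz]]] := Lv l lL.
    by case/allpairsP => -[f' g'] /= [_ _ ->]; rewrite eval2_det_mxsub.
  exists (\det (mxsub f g (S l))); last by rewrite eval2_det_mxsub.
  by apply/allpairsP; exists (f, g); rewrite !mem_enum.
apply/mxrank_minorP; split.
  move=> f g; rewrite -eval2_det_mxsub; apply: Z; apply/flattenP.
  exists (minors l (rho l).+1); first by apply/mapP; exists l; rewrite ?mem_iota.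
  by apply/allpairsP; exists (f, g); rewrite !mem_enum.
have [|P /allpairsP[[f g] /= [_ _ ->]]] := NZ (minors l (rho l)).
  by apply/mapP; exists l; rewrite ?mem_iota.
by rewrite eval2_det_mxsub; exists f, g.
Qed.
End Selection.

(** * Rationality of the eigenvalue of a unique tuple *)

Section Generic.
Variables (F : numClosedFieldType) (n : nat) (c : 'I_n -> 'I_n -> 'I_n -> F).
Variables (K : seq nat) (T : seq (seq nat)) (p : {mpoly F[n + n]}).
Local Notation A := {mpoly F[n + n]}.

Definition pt (x a : 'rV[F]_n) : 'I_(n + n) -> F := fun i => row_mx x a 0 i.

Hypothesis p0 : p != 0.
Hypothesis JKp : forall x a : 'rV[F]_n, p.@[pt x a] != 0 ->
  exists jb kb, [/\ has_JK_form (form_of c x) (form_of c a) jb kb,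
                    perm_eq kb K & perm_eq (jordan_tuples jb) T].

Lemma jordan_tuplesP (jb : seq (option F * nat)) t : t \in jordan_tuples jb ->
  exists2 mu, mu \in map fst jb & sort geq [seq b.2 | b <- jb & b.1 == mu] = t.
Proof. by case/mapP => mu; rewrite mem_undup => mj ->; exists mu. Qed.

(** The empty tuple has to be excluded: it belongs to every [mu] that is not an eigenvalue. *)
Lemma jordan_tuples_uniq (jb : seq (option F * nat)) t mu nu :
  (count_mem t (jordan_tuples jb) <= 1)%N -> t != [::] ->
  sort geq [seq b.2 | b <- jb & b.1 == mu] = t ->
  sort geq [seq b.2 | b <- jb & b.1 == nu] = t -> mu = nu.
Proof.
move=> c1 t0 emu enu.
have mem ka : sort geq [seq b.2 | b <- jb & b.1 == ka] = t -> ka \in undup (map fst jb).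
  move=> e; rewrite mem_undup; apply: contraNT t0 => nk.
  rewrite -e (_ : [seq b <- jb | b.1 == ka] = [::]) //; apply/eqP.
  rewrite -(negbK (_ == _)) -has_filter; apply: contra nk => /hasP[b bjb /eqP <-].
  exact: map_f.
move: c1; rewrite /jordan_tuples count_map -size_filter.
set s := [seq _ <- _ | _]; have us : uniq s by rewrite filter_uniq ?undup_uniq.
have mus : mu \in s by rewrite mem_filter /= emu eqxx mem.
have nus : nu \in s by rewrite mem_filter /= enu eqxx mem.
case: s us mus nus => [|s1 [|//]] _; rewrite ?inE // => /eqP -> /eqP -> //.
Qed.

Lemma jordan_tuples_sorted (C D : 'M[F]_n) jb kb t : has_JK_form C D jb kb ->
  t \in jordan_tuples jb -> sorted geq t /\ all (fun k => 0 < k <= n)%N t.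
Proof.
move=> JK /jordan_tuplesP[mu _ <-]; split.
  by apply: sort_sorted => x y /=; apply: leq_total.
rewrite all_sort; apply/allP => k /mapP[b]; rewrite mem_filter => /andP[_ bjb] ->.
exact: (JK_jordan_size JK).
Qed.

Definition lin_mpoly (s : 'I_n -> 'I_(n + n)) : 'M[A]_n :=
  \matrix_(i, j) \sum_k 'X_(s k) * (c i j k)%:MP.

Definition pencil_syl (l : nat) : 'M[{poly A}]_(n * l, n * l) :=
  sylmx (map_mx polyC (lin_mpoly (lshift n)) - 'X *: map_mx polyC (lin_mpoly (@rshift n n)))
    (map_mx polyC (lin_mpoly (@rshift n n))) l.

Lemma map_pencil_syl x a lam l :
  map_mx (eval2_morph (pt x a) lam) (pencil_syl l) =
  sylmx (form_of c x - lam *: form_of c a) (form_of c a) l.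
Proof.
rewrite map_sylmx.
have e s (z : 'rV[F]_n) : (forall k, pt x a (s k) = z 0 k) ->
    map_mx (eval2_morph (pt x a) lam) (map_mx polyC (lin_mpoly s)) = form_of c z.
  move=> sz; apply/matrixP => i j; rewrite !mxE /= map_polyC /= /horner_eval hornerC.
  rewrite rmorph_sum; apply: eq_bigr => k _.
  by rewrite /= mevalM mevalC mevalXU sz.
have ex : map_mx (eval2_morph (pt x a) lam) (map_mx polyC (lin_mpoly (lshift n))) = form_of c x.
  by apply: e => k; rewrite /pt row_mxEl.
have ea : map_mx (eval2_morph (pt x a) lam) (map_mx polyC (lin_mpoly (@rshift n n))) = form_of c a.
  by apply: e => k; rewrite /pt row_mxEr.
rewrite map_mxB map_mxZ ex ea.
suff -> : eval2_morph (pt x a) lam 'X = lam by [].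
by rewrite /= map_polyX /horner_eval hornerX.
Qed.

Lemma pt_surj (v : 'I_(n + n) -> F) : exists x a, pt x a = v.
Proof.
exists (\row_k v (lshift n k)), (\row_k v (rshift n k)); apply/funext => i.
by rewrite /pt; case: (split_ordP i) => k ->; rewrite ?row_mxEl ?row_mxEr mxE.
Qed.

Lemma regular_value (C D : 'M[F]_n) jb kb : has_JK_form C D jb kb ->
  exists lam, (\rank (C - lam *: D)%R + size kb = n)%N.
Proof.
move=> JK; pose P := \prod_(mu <- pmap id (map fst jb)) ('X - mu%:P) : {poly F}.
have P0 : P != 0 by rewrite monic_neq0 // monic_prod_XsubC.
have [lam nl] := poly_nonroot P0; exists lam.
have := JK_syl_rank lam 1 JK; rewrite syl_rank1 !muln1 big_seq_cond big1 ?muln0 ?addn0 //.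
move=> b /andP[bjb /eqP b1]; case/negP: nl; rewrite -/(root _ _) root_prod_XsubC.
by rewrite mem_pmap map_id -b1 map_f.
Qed.

Lemma JK_tuple t x a : p.@[pt x a] != 0 -> t \in T -> count_mem t T = 1%N ->
  exists jb kb,
    [/\ has_JK_form (form_of c x) (form_of c a) jb kb, perm_eq kb K,
        t \in jordan_tuples jb & count_mem t (jordan_tuples jb) = 1%N].
Proof.
move=> /JKp[jb [kb [JK kK jT]]] tT t1; exists jb, kb; split => //.
- by rewrite (perm_mem jT).
- by rewrite (seq.permP jT).
Qed.

Lemma profile_uniq t x a lam mu : p.@[pt x a] != 0 ->
  t \in T -> t != [::] -> count_mem t T = 1%N ->
  has_profile (size K) t (form_of c x) (form_of c a) lam ->
  has_profile (size K) t (form_of c x) (form_of c a) mu -> lam = mu.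
Proof.
move=> pv tT t0 t1; have [jb [kb [JK /perm_size skb tj c1]]] := JK_tuple pv tT t1.
have [st tn] := jordan_tuples_sorted JK tj; rewrite -skb.
move=> /(profile_tuple JK st tn) el /(profile_tuple JK st tn) em.
by have [] := jordan_tuples_uniq (eq_leq c1) t0 el em.
Qed.

Lemma form_ofD (x y : 'rV[F]_n) : form_of c (x + y) = form_of c x + form_of c y.
Proof.
apply/matrixP => i j; rewrite !mxE -big_split; apply: eq_bigr => k _.
by rewrite mxE mulrDl.
Qed.

Lemma form_ofZ (s : F) (x : 'rV[F]_n) : form_of c (s *: x) = s *: form_of c x.
Proof.
apply/matrixP => i j; rewrite !mxE mulr_sumr; apply: eq_bigr => k _.
by rewrite mxE mulrA.
Qed.

Lemma form_ofB (x y : 'rV[F]_n) : form_of c (x - y) = form_of c x - form_of c y.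
Proof. by rewrite form_ofD -scaleN1r form_ofZ scaleN1r. Qed.

Lemma unique_tuple_rational t : t \in T -> t != [::] -> count_mem t T = 1%N ->
  exists q P Q : A, q != 0 /\ forall x a, q.@[pt x a] != 0 ->
    [/\ Q.@[pt x a] != 0, p.@[pt x a] != 0, (n - size K <= \rank (form_of c a))%N &
    has_profile (size K) t (form_of c x) (form_of c a) (P.@[pt x a] / Q.@[pt x a])].
Proof.
move=> tT t0 t1.
(* The subtractions are truncated, but no truncation occurs: [prof1] below exhibits a point where
   the profile holds. *)
pose rho l := (n * l - size K * l - 2 * (\sum_(k <- t) minn k l))%N.
have tup x a (pv : p.@[pt x a] != 0) := JK_tuple pv tT t1.
have [v0 pv0] := mpoly_nonroot p0; have [x0 [a0 v0E]] := pt_surj v0.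
move: pv0; rewrite -v0E => pxa0; have [jb0 [kb0 [JK0 /perm_size skb0 tj0 _]]] := tup x0 a0 pxa0.
have [st tn] := jordan_tuples_sorted JK0 tj0.
have [mu0 nmu0] := regular_value JK0.
(* At the regular value [mu0] the form of [z] has rank at least [r]. Hence some [r]-minor [delta] of
   [A_a], a polynomial in [a] alone, is nonzero at [a = z]; where it does not vanish, infinity is
   not an eigenvalue. *)
pose r := (n - size K)%N; pose z := x0 - mu0 *: a0.
have rz : (r <= \rank (form_of c z))%N by rewrite form_ofB form_ofZ leq_subLR -skb0 addnC nmu0.
have [f [g dz]] := rank_minor rz.
pose delta : A := \det (mxsub f g (lin_mpoly (@rshift n n))).
have deltaE x a : delta.@[pt x a] = \det (mxsub f g (form_of c a)).
  rewrite /delta -det_map_mx map_mxsub; congr (\det (mxsub _ _ _)).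
  apply/matrixP => i j; rewrite !mxE rmorph_sum; apply: eq_bigr => k _.
  by rewrite /= mevalM mevalC mevalXU /pt row_mxEr.
have delta0 : delta != 0.
  by apply: contra_neq dz => d0; rewrite -(deltaE z) d0 meval0.
pose p' := p * delta.
have p'0 : p' != 0 by rewrite mulf_neq0.
pose Lam v x := forall l, (l <= n)%N ->
  \rank (map_mx (eval2_morph v x) (pencil_syl l)) = rho l.
have LamE x a lam : Lam (pt x a) lam <->
    forall l, (l <= n)%N ->
    syl_rank (form_of c x - lam *: form_of c a) (form_of c a) l = rho l.
  by split=> h l ln; have := h l ln; rewrite map_pencil_syl.
have p'P x a : p'.@[pt x a] != 0 -> p.@[pt x a] != 0 /\ (r <= \rank (form_of c a))%N.
  rewrite mevalM mulf_eq0 negb_or => /andP[-> da]; split => //.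
  by rewrite deltaE in da; exact: minor_rank da.
have prof_ex x a : p'.@[pt x a] != 0 ->
    exists lam, has_profile (size K) t (form_of c x) (form_of c a) lam.
  move=> /p'P[pv ra]; have [jb [kb [JK /perm_size skb tj _]]] := tup x a pv.
  have [[lam|] muj emu] := jordan_tuplesP tj.
    by exists lam; rewrite -skb; exact: (tuple_profile JK emu).
  by have := JK_infty_rank JK muj; rewrite skb addnC -ltn_subRL ltnNge ra.
have prof_uniq x a lam mu : p'.@[pt x a] != 0 ->
    has_profile (size K) t (form_of c x) (form_of c a) lam ->
    has_profile (size K) t (form_of c x) (form_of c a) mu -> lam = mu.
  by move=> /p'P[pv _]; exact: profile_uniq.
have [v1 pv1] := mpoly_nonroot p'0; have [x1 [a1 v1E]] := pt_surj v1.
move: pv1; rewrite -v1E => pxa1; have [lam1 prof1] := prof_ex _ _ pxa1.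
have profE x a lam : Lam (pt x a) lam <->
    has_profile (size K) t (form_of c x) (form_of c a) lam.
  rewrite LamE; split=> h l ln; have := h l ln; rewrite /rho.
    by rewrite -(prof1 l ln) !addnK => ->.
  by move=> <-; rewrite !addnK.
have n0 : (0 < n)%N.
  by case: t t0 tn {tT t1 tup st tj0 rho Lam LamE prof_ex prof_uniq prof1 profE} => // k t _ /= /andP[]; lia.
(* The eigenvalue is algebraic: an [r]-minor of the pencil that is nonzero at the regular value
   vanishes at every eigenvalue with tuple [t], where the rank falls below [r]. *)
have [D D0 LamD] : exists2 D : {poly A}, D != 0 &
    forall v x, Lam v x -> eval2 v x D = 0.
  have : (r <= \rank (map_mx (eval2_morph (pt x0 a0) mu0) (pencil_syl 1)))%N.
    by rewrite map_pencil_syl -/(syl_rank _ _ _) syl_rank1 -form_ofZ -form_ofB.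
  move=> /rank_minor[f1 [g1 d1]]; exists (\det (mxsub f1 g1 (pencil_syl 1))).
    by apply: contra_neq d1 => d1; rewrite -eval2_det_mxsub d1 /eval2 rmorph0 horner0.
  move=> v x Lv; rewrite eval2_det_mxsub; apply/eqP/negPn/negP => /minor_rank.
  rewrite Lv // /rho /r.
  have : (0 < \sum_(k <- t) minn k 1)%N.
    case: t t0 tn {tT t1 tup st tj0 rho Lam LamE prof_ex prof_uniq prof1 profE Lv} => // k t _ /= /andP[].
    by rewrite big_cons; lia.
  have := prof1 1%N n0; rewrite !muln1.
  by move: (syl_rank _ _ _) (\sum_(_ <- _) _)%N => a b; lia.
have [|||q [P [Q [q0 qP]]]] := rank_selection p'0 _ _ D0 _ (L := n) (rho := rho) (S := pencil_syl).
- by move=> v; have [x [a <-]] := pt_surj v => /prof_ex[lam /profE]; exists lam.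
- move=> v x y; have [x' [a <-]] := pt_surj v => pv /profE Lx /profE Ly.
  exact: prof_uniq Lx Ly.
- by move=> v x _; apply: LamD.
exists (p' * q), P, Q; split=> [|x a]; first by rewrite mulf_neq0.
rewrite mevalM mulf_eq0 negb_or => /andP[/p'P[pv ra] /qP[Q0 /profE prof]].
by split.
Qed.
End Generic.

Lemma poly_eq0_nonroot (F : numDomainType) (m g : {poly F}) : g != 0 ->
  (forall s, g.[s] != 0 -> m.[s] = 0) -> m = 0.
Proof.
move=> g0 h; apply/eqP/negPn/negP => m0.
have [s] := poly_nonroot (mulf_neq0 m0 g0); rewrite hornerM mulf_eq0 negb_or.
by move=> /andP[ms gs]; rewrite h ?eqxx in ms.
Qed.

(** * Linearity of the selected eigenvalue *)

Section Affine.
Variable F : numClosedFieldType.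

Lemma map_horner_det (n r : nat) (f g : 'I_r -> 'I_n) (M : 'M[{poly F}]_n) s :
  (\det (mxsub f g M)).[s] = \det (mxsub f g (map_mx (horner_eval s) M)).
Proof. by rewrite -map_mxsub det_map_mx. Qed.

(* A rational eigenvalue [P / Q] of the affine family [A0 + s A1] relative to
   [B] is finite where [Q] vanishes and grows at most linearly at infinity. *)
Lemma rational_eigenvalue_affine (n r : nat) (A0 A1 B : 'M[F]_n) (P Q g : {poly F}) :
  (r <= \rank B)%N -> Q != 0 -> g != 0 ->
  (forall s, g.[s] != 0 ->
     (\rank (P.[s] *: B - Q.[s] *: (A0 + s *: A1))%R < r)%N) ->
  exists al be, P = Q * (al%:P + be *: 'X).
Proof.
move=> rB Q0 g0 rk; set G := gcdp P Q.
have G0 : G != 0 by rewrite gcdp_eq0 negb_and Q0 orbT.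
have [/dvdpP[P1 eP] /dvdpP[Q1 eQ]] := (dvdp_gcdl P Q, dvdp_gcdr P Q).
rewrite -/G in eP eQ.
have cop : coprimep P1 Q1.
  have := coprimep_div_gcd (p := P) (q := Q); rewrite Q0 orbT => /(_ isT).
  by rewrite -/G {1}eP {1}eQ !mulpK.
have [f [h dB]] := rank_minor rB.
pose Mp : 'M[{poly F}]_n := P1 *: map_mx polyC B -
  Q1 *: (map_mx polyC A0 + 'X *: map_mx polyC A1).
have MpE s : map_mx (horner_eval s) Mp = P1.[s] *: B - Q1.[s] *: (A0 + s *: A1).
  by apply/matrixP => i j; rewrite !mxE /horner_eval !hornerE.
(* The rank bound off the zeros of [g] becomes an identity for the reduced fraction [P1 / Q1], valid
   at every [s]. *)
have det0 s : \det (mxsub f h (P1.[s] *: B - Q1.[s] *: (A0 + s *: A1))) = 0.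
  rewrite -MpE -map_horner_det; suff -> : \det (mxsub f h Mp) = 0 by rewrite horner0.
  apply: (poly_eq0_nonroot (mulf_neq0 g0 G0)) => {}s.
  rewrite hornerM mulf_eq0 negb_or => /andP[gs Gs]; rewrite map_horner_det MpE.
  apply/eqP/negPn/negP => /minor_rank; have := rk s gs.
  rewrite eP eQ !hornerM (mulrC P1.[s]) (mulrC Q1.[s]) -!scalerA -scalerBr.
  by rewrite mxrank_scale_nz // ltnNge => /negP.
(* At a root of [Q1] only [P1.[s] *: B] is left, with [P1.[s]] nonzero by coprimality, and its minor
   cannot vanish. *)
have sQ1 : size Q1 == 1%N.
  apply/negPn/negP => /closed_rootP[s rs].
  have := det0 s; rewrite (rootP rs) scale0r subr0.
  have -> : mxsub f h (P1.[s] *: B) = P1.[s] *: mxsub f h B by apply/matrixP => i j; rewrite !mxE.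
  move/eqP; rewrite detZ mulf_eq0 (negPf dB) orbF expf_eq0 => /andP[_].
  by apply/negP; apply: coprimep_root rs; rewrite coprimep_sym.
have /size_poly1P[k k0 Q1k] := sQ1.
have sP1 : (size P1 <= 2)%N.
  rewrite leqNgt; apply/negP => sP.
  have [d eN] : exists d, size P1 = d.+1 by exists (size P1).-1; rewrite prednK // ltnW // ltnW.
  (* [R] is [P1] with reversed coefficients. The matrix at [1 / s], multiplied by [s ^+ d], is
     polynomial in [s]; since [d] is at least 2, its value at [0] is [lead_coef P1 *: B]. *)
  rewrite eN ltnS in sP; pose R := \poly_(i < d.+1) P1`_(d - i).
  have RE s : s != 0 -> R.[s] = s ^+ d * P1.[s^-1].
    move=> s0; rewrite horner_poly (horner_coef_wide (n := d.+1)) ?eN // mulr_sumr.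
    rewrite (reindex_inj rev_ord_inj) /=; apply: eq_bigr => i _.
    have id : (i <= d)%N by rewrite -ltnS.
    rewrite subSS subKn //.
    by rewrite mulrCA; congr (_ * _); rewrite expfB_cond ?(negPf s0) // exprVn.
  pose Np : 'M[{poly F}]_n := R *: map_mx polyC B -
    k%:P *: ('X^d *: map_mx polyC A0 + 'X^(d.-1) *: map_mx polyC A1).
  have NpE s : map_mx (horner_eval s) Np = R.[s] *: B - k *: (s ^+ d *: A0 + s ^+ d.-1 *: A1).
    by apply/matrixP => i j; rewrite !mxE /horner_eval !hornerE ?hornerXn.
  have N0 : \det (mxsub f h Np) = 0.
    apply: (poly_eq0_nonroot (g := 'X)) => [|s]; first by rewrite polyX_eq0.
    rewrite hornerX => s0; rewrite map_horner_det NpE.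
    have := det0 s^-1; rewrite Q1k hornerC RE // => e.
    have -> : mxsub f h ((s ^+ d * P1.[s^-1]) *: B - k *: (s ^+ d *: A0 + s ^+ d.-1 *: A1)) =
       s ^+ d *: mxsub f h (P1.[s^-1] *: B - k *: (A0 + s^-1 *: A1)).
      apply/matrixP => i j; rewrite !mxE.
      have -> : s ^+ d.-1 = s ^+ d * s^-1.
        by rewrite -{2}(prednK (n := d)) ?exprSr ?mulfK //; lia.
      by ring.
    by rewrite detZ e mulr0.
  have := NpE 0; have := map_horner_det f h Np 0; rewrite N0 horner0 => + e.
  have [d0 d1] : (d == 0%N) = false /\ (d.-1 == 0%N) = false by lia.
  rewrite e (expr0n _ d) (expr0n _ d.-1) d0 d1.
  rewrite !scale0r addr0 scaler0 subr0.
  have -> : mxsub f h (R.[0] *: B) = R.[0] *: mxsub f h B by apply/matrixP => i j; rewrite !mxE.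
  move/esym/eqP; rewrite detZ mulf_eq0 (negPf dB) orbF expf_eq0 => /andP[_].
  rewrite horner_coef0 coef_poly subn0 /=.
  have -> : P1`_d = lead_coef P1 by rewrite lead_coefE eN.
  by rewrite lead_coef_eq0 -size_poly_eq0 eN.
exists (k^-1 * P1`_0), (k^-1 * P1`_1).
rewrite {1}eP eQ Q1k mulrAC; congr (_ * _).
apply/polyP => i; rewrite coefCM coefD coefC coefZ coefX.
case: i => [|[|i]] /=; rewrite ?mulr0 ?mulr1 ?addr0 ?add0r ?mulVKf //.
by rewrite mulr0 nth_default // (leq_trans sP1).
Qed.
End Affine.

Section LinearForm.
Variables (F : numClosedFieldType) (n : nat).
Local Notation A := {mpoly F[n + n]}.
Implicit Types (x y a : 'rV[F]_n) (G : A).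

Definition line_mpoly x y a : A -> {poly F} :=
  mmap polyC (fun i => (row_mx x a 0 i)%:P + row_mx y 0 0 i *: 'X).

Lemma line_mpolyE x y a G s : (line_mpoly x y a G).[s] = G.@[pt (x + s *: y) a].
Proof.
rewrite /line_mpoly /mmap mevalE horner_sum; apply: eq_bigr => m _.
rewrite hornerM hornerC /mmap1 horner_prod; congr (_ * _); apply: eq_bigr => i _.
rewrite horner_exp !hornerE; congr (_ ^+ _); rewrite /pt.
by case: (split_ordP i) => k ->; rewrite ?row_mxEl ?row_mxEr !mxE ?mul0r ?addr0 // mulrC.
Qed.

(** [l] is the gradient of [G] in the first group of variables; linearity in [y] passes from the
    variables to products by the Leibniz rule. *)
Lemma line_mpoly_deriv x a G :
  exists l : 'cV_n, forall y, (line_mpoly x y a G)^`().[0] = (y *m l) 0 0.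
Proof.
pose D H := exists l : 'cV_n, forall y, (line_mpoly x y a H)^`().[0] = (y *m l) 0 0.
rewrite -/(D G).
have v0 y H : (line_mpoly x y a H).[0] = H.@[pt x a] by rewrite line_mpolyE scale0r addr0.
have Dmul H1 H2 : D H1 -> D H2 -> D (H1 * H2).
  move=> [l1 e1] [l2 e2]; exists (H2.@[pt x a] *: l1 + H1.@[pt x a] *: l2) => y.
  rewrite /line_mpoly rmorphM /= -!/(line_mpoly _ _ _ _) derivM !hornerE e1 e2 !v0.
  by rewrite mulmxDr -!scalemxAr !mxE mulrC [X in _ + X]mulrC.
have D1 : D 1 by exists 0 => y; rewrite /line_mpoly rmorph1 derivC horner0 mulmx0 mxE.
have DX i : D 'X_i.
  rewrite /D; case: (split_ordP i) => k ->; [exists (delta_mx k 0)|exists 0] => y;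
    rewrite /line_mpoly mmapX mmap1U derivD derivC derivZ derivX add0r !hornerE.
    by rewrite row_mxEl -colE mxE.
  by rewrite row_mxEr mulmx0 !mxE.
elim/mpolyind: G => [|c m H _ _ [l e]].
  by exists 0 => y; rewrite /line_mpoly rmorph0 deriv0 horner0 mulmx0 mxE.
have [l' e'] : D 'X_[m].
  rewrite mpolyXE_id; elim/big_rec: _ => [|i P _ DP]; first exact: D1. apply: (Dmul) => //.
  elim: (m i) => [|k IH]; first by rewrite expr0.
  by rewrite exprS; apply: Dmul.
exists (c *: l' + l) => y; rewrite /line_mpoly raddfD /= mmapZ /= -!/(line_mpoly _ _ _ _).
rewrite derivD mul_polyC derivZ !hornerE e e' mulmxDr -scalemxAr !mxE //.
Qed.

(** Rescaling [e], that is conjugating the shift by a diagonal matrix of powers, absorbs the factor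
    [u]. This makes the eigenvalue homogeneous in [x]. *)
Lemma syl_rankZ (C B : 'M[F]_n) (u : F) m : u != 0 -> syl_rank (u *: C) B m = syl_rank C B m.
Proof.
suff le C' v : v != 0 -> (syl_rank (v *: C') B m <= syl_rank C' B m)%N.
  move=> u0; apply/eqP; rewrite eqn_leq le //=.
  by rewrite -{1}[C](scalerK u0) le ?invr_eq0.
move=> v0; pose Dm : 'M[F]_m := diag_mx (\row_i v^-1 ^+ i).
have vDN : v *: (shift_mx F m *m Dm) = Dm *m shift_mx F m.
  apply/matrixP => i j; rewrite mxE mul_mx_diag mul_diag_mx !mxE.
  have [->|_] := eqVneq; last by rewrite mulr0 mul0r mulr0.
  by rewrite exprS mul1r mulr1 mulVKf.
have Dinv : Dm \in unitmx.
  by rewrite unitmxE det_diag unitfE prodf_seq_neq0; apply/allP => i _; rewrite mxE expf_neq0 ?invr_eq0.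
rewrite /syl_rank.
have -> : sylmx (v *: C') B m = lin_mulmxr (invmx Dm) *m (sylmx C' B m) *m (v *: lin_mulmxr Dm).
  apply: eq_mulmx_rV => U; rewrite -[U]vec_mxK !mulmxA -scalemxAr !mul_vec_lin /=.
  rewrite -linearZ /=; congr mxvec; rewrite /mulmxr /syl mulmxBl scalerBr.
  rewrite -scalemxAl -!mulmxA mulVmx // mulmx1; congr (_ - _).
  by rewrite -[in LHS](mulKmx Dinv (shift_mx F m)) -vDN -!scalemxAr.
by apply: leq_trans (mxrankM_maxl _ _) (mxrankM_maxr _ _).
Qed.
End LinearForm.

Section Linear.
Variables (F : numClosedFieldType) (n : nat) (c : 'I_n -> 'I_n -> 'I_n -> F).
Variables (K : seq nat) (T : seq (seq nat)) (p : {mpoly F[n + n]}).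
Local Notation A := {mpoly F[n + n]}.
Hypothesis p0 : p != 0.
Hypothesis JKp : forall x a : 'rV[F]_n, p.@[pt x a] != 0 ->
  exists jb kb, [/\ has_JK_form (form_of c x) (form_of c a) jb kb,
                    perm_eq kb K & perm_eq (jordan_tuples jb) T].

Lemma has_profile_rank (C B : 'M[F]_n) t lam : t != [::] -> all (fun k => 0 < k <= n)%N t ->
  has_profile (size K) t C B lam -> (\rank (C - lam *: B)%R < n - size K)%N.
Proof.
move=> t0 tn prof.
have [n0 S0] : (0 < n)%N /\ (0 < \sum_(k <- t) minn k 1)%N.
  by case: t t0 tn {prof} => // k t _ /= /andP[kn _]; rewrite big_cons; lia.
have := prof 1%N n0; rewrite syl_rank1 !muln1.
by move: (\rank _) (\sum_(_ <- _) _)%N S0 => r s; lia.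
Qed.

Lemma has_profileZ (C B : 'M[F]_n) t lam u : u != 0 ->
  has_profile (size K) t C B lam -> has_profile (size K) t (u *: C) B (u * lam).
Proof.
move=> u0 prof l ln; rewrite -scalerA -scalerBr syl_rankZ //; exact: prof.
Qed.

Lemma unique_tuple_linear t : t \in T -> t != [::] -> count_mem t T = 1%N ->
  exists2 q : A, q != 0 & forall a x0, q.@[pt x0 a] != 0 ->
  exists2 xi : 'cV[F]_n, (a *m xi) 0 0 = 1 &
    forall x, q.@[pt x a] != 0 -> p.@[pt x a] != 0 /\
      has_profile (size K) t (form_of c x) (form_of c a) ((x *m xi) 0 0).
Proof.
move=> tT t0 t1; have [q [P [Q [q0 qP]]]] := unique_tuple_rational p0 JKp tT t0 t1.
exists q => // a x0 qx0; have [Q0 px0 ra _] := qP x0 a qx0.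
have tn : all (fun k => 0 < k <= n)%N t.
  have [jb [kb [JK _ tj _]]] := JK_tuple JKp px0 tT t1.
  by have [] := jordan_tuples_sorted JK tj.
have Qline y : line_mpoly x0 y a Q != 0.
  apply: contra_neq Q0 => e; have := line_mpolyE x0 y a Q 0.
  by rewrite e horner0 scale0r addr0.
have qline y : line_mpoly x0 y a q != 0.
  apply: contra_neq qx0 => e; have := line_mpolyE x0 y a q 0.
  by rewrite e horner0 scale0r addr0.
have aff y : exists al be, line_mpoly x0 y a P = line_mpoly x0 y a Q * (al%:P + be *: 'X).
  apply: (@rational_eigenvalue_affine F n _ (form_of c x0) (form_of c y) (form_of c a) _ _ _ ra (Qline y) (qline y)).
  move=> s; rewrite !line_mpolyE -(form_ofZ c s y) -form_ofD => qs.
  have [Qs _ _ prof] := qP _ _ qs.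
  have := has_profile_rank t0 tn prof; set z := form_of c _.
  suff -> : \rank (P.@[pt (x0 + s *: y) a] *: form_of c a - Q.@[pt (x0 + s *: y) a] *: z) =
            \rank (z - (P.@[pt (x0 + s *: y) a] / Q.@[pt (x0 + s *: y) a]) *: form_of c a) by [].
  rewrite -[RHS](mxrank_scale_nz _ (a := - Q.@[pt (x0 + s *: y) a])) ?oppr_eq0 //.
  rewrite scalerBr scalerA mulNr mulrCA mulfV // mulr1 !scaleNr opprK addrC //.
have [lP dP] := line_mpoly_deriv x0 a P; have [lQ dQ] := line_mpoly_deriv x0 a Q.
pose al := P.@[pt x0 a] / Q.@[pt x0 a].
(* The gradient of [P / Q] in [x] at [x0]. On each line through [x0] the eigenvalue is affine with
   slope its derivative at [x0], so one vector serves all directions. *)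
pose xi : 'cV[F]_n := (Q.@[pt x0 a])^-1 *: (lP - al *: lQ).
have PQ x : P.@[pt x a] = Q.@[pt x a] * (al + ((x - x0) *m xi) 0 0).
  have [al' [be e]] := aff (x - x0).
  have al'E : al' = al.
    have := congr1 (horner^~ 0) e; rewrite hornerM !line_mpolyE !hornerE scale0r addr0 => e0.
    by rewrite /al e0 mulrAC mulfV // mul1r.
  have beE : be = ((x - x0) *m xi) 0 0.
    have xiE : ((x - x0) *m xi) 0 0 = (Q.@[pt x0 a])^-1 *
        (((x - x0) *m lP) 0 0 - al * ((x - x0) *m lQ) 0 0).
      rewrite -scalemxAr mulmxBr -scalemxAr; move: (_ *m lP) (_ *m lQ) => M1 M2.
      by rewrite !mxE.
    have := congr1 (fun R : {poly F} => R^`().[0]) e.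
    rewrite derivM derivD derivC add0r derivZ derivX hornerD !hornerM !hornerD !hornerZ.
    rewrite hornerX !hornerC dP dQ line_mpolyE scale0r addr0 al'E xiE => ->.
    by field.
  have := congr1 (horner^~ 1) e; rewrite hornerM !line_mpolyE scale1r addrC subrK !hornerE.
  by rewrite al'E beE.
have prof x : q.@[pt x a] != 0 ->
    has_profile (size K) t (form_of c x) (form_of c a) (al + ((x - x0) *m xi) 0 0).
  move=> qx; have [Qx _ _] := qP x a qx.
  by rewrite PQ mulrAC mulfV // mul1r.
have uniq x lam mu (px : p.@[pt x a] != 0) := @profile_uniq _ _ _ _ _ _ JKp t x a lam mu px tT t0 t1.
have prof0 := prof _ qx0; rewrite subrr mul0mx mxE addr0 in prof0.
pose x0xi := (x0 *m xi) 0 0.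
(* No constant term: by homogeneity the eigenvalue at [(1 + s) x0] is [(1 + s) al], while the affine
   formula gives [al + s x0xi]. *)
have alE : al = x0xi.
  have : line_mpoly x0 x0 a q * ('X * ('X + 1%:P)) != 0.
    rewrite mulf_neq0 ?qline // mulf_neq0 ?polyX_eq0 // -(opprK 1%:P) -polyCN.
    by rewrite polyXsubC_eq0.
  case/poly_nonroot => s; rewrite !hornerM !mulf_eq0 !negb_or line_mpolyE ?(hornerD, hornerX, hornerC).
  move=> /and3P[qs s0 s1].
  have [_ ps _ _] := qP _ _ qs.
  have := uniq _ _ _ ps (prof _ qs).
  move/(_ ((1 + s) * al)); rewrite addrAC subrr add0r -scalemxAl mxE -/x0xi.
  rewrite -{1}[x0]scale1r -scalerDl form_ofZ => /(_ (has_profileZ _ prof0)).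
  rewrite addrC s1 => /(_ isT) e.
  apply: (mulfI s0); have -> : s * al = (s + 1) * al - al by ring.
  by rewrite -e; ring.
(* Moving [x0] by [s a] shifts the pencil, and hence the eigenvalue, by [s]. *)
have aE : (a *m xi) 0 0 = 1.
  have : line_mpoly x0 a a q * 'X != 0 by rewrite mulf_neq0 ?qline ?polyX_eq0.
  case/poly_nonroot => s; rewrite !hornerM !mulf_eq0 !negb_or line_mpolyE ?(hornerD, hornerX, hornerC).
  move=> /andP[qs s0]; have [_ ps _ _] := qP _ _ qs.
  have h := uniq _ _ (al + s) ps (prof _ qs).
  apply: (mulfI s0); rewrite mulr1; apply: (addrI al).
  rewrite -h; first by rewrite addrAC subrr add0r -scalemxAl [in RHS]mxE.
  move=> l ln; have := prof0 l ln.
  by rewrite form_ofD form_ofZ scalerDl opprD addrACA subrr addr0.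
exists xi => // x qx; have [_ px _ _] := qP _ _ qx; split=> //.
have := prof _ qx; rewrite mulmxBl mxE [X in _ + (_ + X)]mxE -/x0xi alE.
by rewrite addrC subrK.
Qed.
End Linear.

(** * Lie brackets of kernel vectors *)

Section FirstOrder.
Variable F : numClosedFieldType.

Lemma horner_map_polyC (p q : nat) (M : 'M[F]_(p, q)) s :
  map_mx (horner_eval s) (map_mx polyC M) = M.
Proof. by apply/matrixP => i j; rewrite !mxE /horner_eval hornerC. Qed.

(* Bordering a maximal minor of [M] by [u] and [v] yields an [(r + 1)]-minor
   of [M + s N] whose term of first order in [s] is [u N v]. *)
Lemma rank_const_first_order (p q : nat) (M N : 'M[F]_(p, q)) (g : {poly F})
  (u : 'rV_p) (v : 'cV_q) : g != 0 ->
  (forall s, g.[s] != 0 -> (\rank (M + s *: N)%R <= \rank M)%N) ->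
  u *m M = 0 -> M *m v = 0 -> u *m N *m v = 0.
Proof.
move=> g0 rk uM Mv; have [f [h dM]] := rank_minor (leqnn (\rank M)).
set r := \rank M in rk f h dM *.
pose S : 'M[F]_(r, p) := rowsub f 1%:M; pose G : 'M[F]_(q, r) := colsub h 1%:M.
have SG D : S *m D *m G = mxsub f h D.
  rewrite /S /G mul_rowsub_mx mul1mx mulmx_colsub mulmx1.
  by apply/matrixP => i j; rewrite !mxE.
(* The bordered minor with its last row divided by [s], so that [u N v] survives at [s = 0]. *)
pose H s : 'M[F]_(r + 1) := block_mx (S *m (M + s *: N) *m G) (s *: (S *m N *m v))
  (u *m N *m G) (u *m N *m v).
have H0 s : g.[s] != 0 -> s != 0 -> \det (H s) = 0.
  move=> gs s0; apply: (mulfI s0); rewrite mulr0.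
  have <- : \det (block_mx (1%:M : 'M[F]_r) 0 0 (s%:M : 'M_1) *m H s) = s * \det (H s).
    by rewrite det_mulmx det_ublock det1 mul1r det_scalar expr1.
  rewrite mulmx_block !mul1mx !mul0mx !addr0 !add0r !mul_scalar_mx.
  have -> : block_mx (S *m (M + s *: N) *m G) (s *: (S *m N *m v))
      (s *: (u *m N *m G)) (s *: (u *m N *m v)) =
      col_mx S u *m (M + s *: N) *m row_mx G v.
    rewrite mul_col_mx mul_col_row; congr block_mx.
    - by rewrite mulmxDr mulmxDl -(mulmxA S M) Mv mulmx0 add0r -scalemxAr -scalemxAl.
    - by rewrite mulmxDr uM add0r -scalemxAr -scalemxAl.
    - by rewrite mulmxDr uM add0r -scalemxAr -scalemxAl.
  apply/eqP/negPn/negP; rewrite -unitfE -unitmxE => /mxrank_unit e.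
  have : (\rank (col_mx S u *m (M + s *: N) *m row_mx G v)%R <= r)%N.
    by apply: leq_trans (mxrankM_maxl _ _) _; apply: leq_trans (mxrankM_maxr _ _) (rk s gs).
  by rewrite e addn1 ltnn.
pose HP : 'M[{poly F}]_(r + 1) :=
  block_mx (map_mx polyC (S *m M *m G) + 'X *: map_mx polyC (S *m N *m G))
    ('X *: map_mx polyC (S *m N *m v))
    (map_mx polyC (u *m N *m G)) (map_mx polyC (u *m N *m v)).
have HPE s : (\det HP).[s] = \det (H s).
  rewrite -[LHS]/(horner_eval s (\det HP)) -det_map_mx /HP map_block_mx; congr (\det (block_mx _ _ _ _)).
  - rewrite map_mxD map_mxZ !horner_map_polyC /= /horner_eval hornerX.
    by rewrite mulmxDr mulmxDl -scalemxAr -scalemxAl.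
  - by rewrite map_mxZ !horner_map_polyC /= /horner_eval hornerX.
  - by rewrite horner_map_polyC.
  - by rewrite horner_map_polyC.
have HP0 : \det HP = 0.
  apply: (poly_eq0_nonroot (g := g * 'X)) => [|s]; first by rewrite mulf_neq0 ?polyX_eq0.
  by rewrite hornerM hornerX mulf_eq0 negb_or HPE => /andP[gs s0]; apply: H0.
have := HPE 0; rewrite HP0 horner0 /H !scale0r addr0 det_lblock SG => /esym/eqP.
rewrite mulf_eq0 (negPf dM) /= det_mx11 => /eqP e.
by apply/matrixP => i j; rewrite !ord1 e mxE.
Qed.
End FirstOrder.

(** * The bracket on polynomial vectors *)

Section LiePoly.
Variables (F : numClosedFieldType) (n : nat) (c : 'I_n -> 'I_n -> 'I_n -> F).
Hypothesis Lie : lie_structure c.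
Local Notation V := 'cV[{poly F}]_n.

Definition lbr (u v : V) : V :=
  \col_k \sum_i \sum_j u i 0 * v j 0 * (c i j k)%:P.

Lemma lbrDl u v w : lbr (u + v) w = lbr u w + lbr v w.
Proof.
apply/colP => k; rewrite !mxE -big_split; apply: eq_bigr => i _.
by rewrite -big_split; apply: eq_bigr => j _; rewrite mxE !mulrDl.
Qed.

Lemma lbrZl s u v : lbr (s *: u) v = s *: lbr u v.
Proof.
apply/colP => k; rewrite !mxE mulr_sumr; apply: eq_bigr => i _.
by rewrite mulr_sumr; apply: eq_bigr => j _; rewrite mxE !mulrA.
Qed.

Lemma lbrC u v : lbr u v = - lbr v u.
Proof.
apply/colP => k; rewrite !mxE exchange_big -sumrN; apply: eq_bigr => i _.
rewrite -sumrN; apply: eq_bigr => j _.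
by case: Lie => _ /(_ j i k) -> _; rewrite polyCN mulrN [v i 0 * _]mulrC.
Qed.

Lemma lbrZr s u v : lbr u (s *: v) = s *: lbr u v.
Proof. by rewrite lbrC lbrZl -scalerN -lbrC. Qed.

Lemma lbr_jacobi u v w : lbr (lbr u v) w + lbr (lbr v w) u + lbr (lbr w u) v = 0.
Proof.
have lbr2 x y z m : lbr (lbr x y) z m 0 = \sum_i \sum_j \sum_l
    x i 0 * y j 0 * z l 0 * (\sum_k c i j k * c k l m)%:P.
  rewrite mxE; under eq_bigr do under eq_bigr do rewrite mxE !mulr_suml.
  transitivity (\sum_k \sum_l \sum_i \sum_j
     x i 0 * y j 0 * z l 0 * (c i j k * c k l m)%:P).
    apply: eq_bigr => k _; apply: eq_bigr => l _; apply: eq_bigr => i _.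
    by rewrite !mulr_suml; apply: eq_bigr => j _; rewrite polyCM; ring.
  transitivity (\sum_k \sum_i \sum_j \sum_l
     x i 0 * y j 0 * z l 0 * (c i j k * c k l m)%:P).
    apply: eq_bigr => k _; rewrite exchange_big; apply: eq_bigr => i _.
    exact: exchange_big.
  rewrite exchange_big; apply: eq_bigr => i _; rewrite exchange_big.
  apply: eq_bigr => j _; rewrite exchange_big; apply: eq_bigr => l _.
  by rewrite rmorph_sum mulr_sumr.
apply/colP => m; rewrite [LHS]mxE [X in X + _]mxE !lbr2 [RHS]mxE.
have -> : \sum_i \sum_j \sum_l v i 0 * w j 0 * u l 0 * (\sum_k c i j k * c k l m)%:P =
   \sum_i \sum_j \sum_l u i 0 * v j 0 * w l 0 * (\sum_k c j l k * c k i m)%:P.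
  under eq_bigr do rewrite exchange_big; rewrite exchange_big; apply: eq_bigr => i _.
  by apply: eq_bigr => j _; apply: eq_bigr => l _; congr (_ * _); ring.
have -> : \sum_i \sum_j \sum_l w i 0 * u j 0 * v l 0 * (\sum_k c i j k * c k l m)%:P =
   \sum_i \sum_j \sum_l u i 0 * v j 0 * w l 0 * (\sum_k c l i k * c k j m)%:P.
  rewrite exchange_big; apply: eq_bigr => i _; rewrite exchange_big.
  by apply: eq_bigr => j _; apply: eq_bigr => l _; congr (_ * _); ring.
rewrite -!big_split big1 //= => i _; rewrite -!big_split big1 //= => j _.
rewrite -!big_split big1 //= => l _; rewrite -!mulrDr -!polyCD -!big_split /=.
by case: Lie => _ _ ->; rewrite mulr0.
Qed.

Definition pform (z : 'rV[{poly F}]_n) : 'M[{poly F}]_n :=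
  \matrix_(i, j) \sum_k z 0 k * (c i j k)%:P.

Lemma pformE z u v : (u^T *m pform z *m v) 0 0 = (z *m lbr u v) 0 0.
Proof.
rewrite -mulmxA !mxE.
transitivity (\sum_i \sum_j \sum_k z 0 k * (u i 0 * v j 0 * (c i j k)%:P)).
  apply: eq_bigr => i _; rewrite !mxE mulr_sumr; apply: eq_bigr => j _.
  by rewrite mxE mulr_suml mulr_sumr; apply: eq_bigr => k _; ring.
under eq_bigr do rewrite exchange_big; rewrite exchange_big; apply: eq_bigr => k _.
rewrite mxE mulr_sumr; apply: eq_bigr => i _; rewrite mulr_sumr //.
Qed.

Lemma pform_polyC (z : 'rV[F]_n) : pform (map_mx polyC z) = map_mx polyC (form_of c z).
Proof.
apply/matrixP => i j; rewrite !mxE rmorph_sum; apply: eq_bigr => k _.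
by rewrite mxE rmorphM.
Qed.

Lemma pform_tr z : (pform z)^T = - pform z.
Proof.
apply/matrixP => i j; rewrite !mxE -sumrN; apply: eq_bigr => k _.
by case: Lie => _ /(_ j i k) -> _; rewrite polyCN mulrN.
Qed.
End LiePoly.

Section Chains.
Variables (F : numClosedFieldType) (n : nat) (c : 'I_n -> 'I_n -> 'I_n -> F).
Hypothesis Lie : lie_structure c.
Local Notation V := 'cV[{poly F}]_n.
Local Notation "M ^%P" := (map_mx polyC M) (at level 2, format "M ^%P").

Definition divXn (m : nat) (u : V) := exists r : V, u = 'X^m *: r.

Lemma divXn_coef m (u : V) : (forall i l, (l < m)%N -> (u i 0)`_l = 0) -> divXn m u.
Proof.
move=> h; exists (map_mx (drop_poly m) u); apply/colP => i; rewrite !mxE mulrC.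
rewrite -[LHS](poly_take_drop m) (_ : take_poly m _ = 0) ?add0r //.
by apply/polyP => l; rewrite coef_take_poly coef0; case: ifP => // /h.
Qed.

Lemma coef_divXn m (u : V) i l : divXn m u -> (l < m)%N -> (u i 0)`_l = 0.
Proof. by move=> [r ->] lm; rewrite mxE coefXnM lm. Qed.

Variables (y a : 'rV[F]_n) (xi : 'cV[F]_n) (m' : nat).
Let m := m'.+1.
Let C := form_of c y.
Let B := form_of c a.
Hypothesis axi : (a *m xi) 0 0 = 1.
Hypothesis rank_const : forall w : 'rV[F]_n, (w *m xi) 0 0 = 0 ->
  exists2 g : {poly F}, g != 0 & forall s, g.[s] != 0 ->
    (syl_rank (C + s *: form_of c w)%R B m <= syl_rank C B m)%N.

Definition pencil : 'M[{poly F}]_n := C^%P - 'X *: B^%P.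

(** Polynomial vectors are kept instead of classes modulo [X^m], because the Jacobi identity is
    later read to a higher order. *)
Definition chain (u : V) := divXn m (pencil *m u).

Let z : 'rV[{poly F}]_n := y^%P - 'X *: a^%P.

Lemma pencilE : pencil = pform c z.
Proof.
rewrite /pencil /C /B -!pform_polyC; apply/matrixP => i j; rewrite !mxE mulr_sumr -sumrB.
by apply: eq_bigr => k _; rewrite !mxE mulrBl mulrA.
Qed.

Lemma pencil_tr : pencil^T = - pencil.
Proof. by rewrite pencilE pform_tr. Qed.

Lemma form_of_tr x : (form_of c x)^T = - form_of c x.
Proof.
apply/matrixP => i j; rewrite !mxE -sumrN; apply: eq_bigr => k _.
by case: Lie => _ /(_ j i k) -> _; rewrite mulrN.
Qed.

Lemma chain_coef u i l : chain u -> (l < m)%N ->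
  \sum_j C i j * (u j 0)`_l = if l is l'.+1 then \sum_j B i j * (u j 0)`_l' else 0.
Proof.
move=> /(coef_divXn i) h /h; rewrite /pencil mulmxBl -scalemxAl !mxE coefB => /eqP.
rewrite subr_eq0 coef_sum => /eqP.
under eq_bigr do rewrite mxE coefCM; move=> ->.
rewrite coefXM; case: l => //= l'; rewrite coef_sum.
by apply: eq_bigr => j _; rewrite mxE coefCM.
Qed.

Definition coef_mx (u : V) : 'M[F]_(n, m) := \matrix_(i, l) (u i 0)`_l.

Lemma syl_chain u : chain u -> syl C B (coef_mx u) = 0.
Proof.
move=> hu; apply/eqP; rewrite subr_eq0; apply/eqP/matrixP => i l.
rewrite mxext_mul_shiftr mxE; under eq_bigr do rewrite [X in _ * X]mxE.
rewrite (chain_coef i hu (ltn_ord l)); case: l => -[|l'] lm //=.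
rewrite (mxextE (B *m coef_mx u) i (Ordinal (ltnW lm))) mxE.
by apply: eq_bigr => j _; rewrite [X in _ = _ * X]mxE.
Qed.

Lemma chainX u k : chain u -> chain ('X^k *: u).
Proof. by move=> [r e]; exists ('X^k *: r); rewrite -scalemxAr e !scalerA mulrC. Qed.

(** [u] is a kernel vector of the Sylvester operator, and [v] with reversed coefficients is one of
    its transpose, the pencil being skew. Constancy of the rank in direction [w] makes the
    first-order term pair them to zero; this pairing is a convolution, the coefficient of degree
    [m']. *)
Lemma chain_last_orth (u v : V) (w : 'rV[F]_n) : chain u -> chain v -> (w *m xi) 0 0 = 0 ->
  ((v^T *m (form_of c w)^%P *m u) 0 0)`_m' = 0.
Proof.
move=> cu cv wxi; have [g g0 rk] := rank_const wxi; set W := form_of c w.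
have sylD s : sylmx (C + s *: W) B m = sylmx C B m + s *: sylmx W 0 m.
  apply: eq_mulmx_rV => U; rewrite -[U]vec_mxK mulmxDr -scalemxAr !mul_vec_lin /=.
  rewrite -linearZ -linearD /=; congr mxvec; rewrite /syl mulmxDl -scalemxAl !mul0mx subr0.
  by rewrite addrAC.
pose Vr := coef_mx v *m rev_mx F m.
have rk' s : g.[s] != 0 ->
    (\rank (sylmx C B m + s *: sylmx W 0 m)%R <= \rank (sylmx C B m))%N.
  by move=> gs; rewrite -sylD; exact: rk.
have uM : mxvec (coef_mx u) *m sylmx C B m = 0.
  by rewrite mul_vec_lin /= syl_chain // linear0.
have Mv : sylmx C B m *m (mxvec Vr)^T = 0.
  rewrite -[sylmx C B m]trmxK -trmx_mul sylmx_tr !mulmxA mul_vec_lin /=.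
  rewrite /mulmxr /Vr -(mulmxA (coef_mx v)) rev_mxK mulmx1 !form_of_tr mul_vec_lin /=.
  suff -> : syl (- C) (- B) (coef_mx v) = - syl C B (coef_mx v).
    by rewrite syl_chain // oppr0 linear0 mul0mx trmx0.
  by rewrite /syl !mulNmx opprD opprK.
have := rank_const_first_order g0 rk' uM Mv.
rewrite mul_vec_lin /= /syl !mul0mx subr0 => /matrixP/(_ 0 0); rewrite mxE [RHS]mxE => e.
rewrite -[RHS]e; transitivity (\sum_i \sum_(l < m) (W *m coef_mx u) i l * Vr i l).
  rewrite -mulmxA mxE coef_sum; apply: eq_bigr => i _.
  rewrite coefMr; apply: eq_bigr => l _; rewrite mulrC !mxE; congr (_ * _).
    by rewrite coef_sum; apply: eq_bigr => j _; rewrite !mxE coefCM.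
  rewrite (bigD1 (rev_ord l)) //= big1 ?addr0 => [|k nk]; last first.
    by rewrite !mxE (negPf nk) mulr0.
  by rewrite !mxE eqxx mulr1 /= subSS.
rewrite pair_big /= [RHS](reindex (uncurry (@mxvec_index n m))); last exact: curry_mxvec_bij.
by apply: eq_bigr => -[i l] _ /=; rewrite [X in _ = _ * X]mxE !mxvecE.
Qed.

(** Multiplying a chain by a power of [X] gives a chain and moves a lower coefficient to the last
    place. *)
Lemma chain_orth (u v : V) (w : 'rV[F]_n) : chain u -> chain v -> (w *m xi) 0 0 = 0 ->
  forall l, (l < m)%N -> ((w^%P *m lbr c v u) 0 0)`_l = 0.
Proof.
move=> cu cv wxi l lm; rewrite -pformE pform_polyC.
have := chain_last_orth (chainX (m' - l) cu) cv wxi.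
rewrite -scalemxAr mxE coefXnM ltnNge leq_subr /= subKn //.
Qed.

Lemma deriv_mulmx (p q r : nat) (M : 'M[{poly F}]_(p, q)) (N : 'M_(q, r)) :
  map_mx (@deriv F) (M *m N) = map_mx (@deriv F) M *m N + M *m map_mx (@deriv F) N.
Proof.
apply/matrixP => i j; rewrite !mxE raddf_sum -big_split; apply: eq_bigr => k _.
by rewrite /= derivM !mxE.
Qed.

(* Differentiate [pencil *m v = 'X^m *: be] with respect to ['X]. *)
Lemma chain_form_coef (u v : V) : chain u -> chain v ->
  forall l, (l < m')%N -> ((a^%P *m lbr c u v) 0 0)`_l = 0.
Proof.
move=> [al eu] [be ev] l lm; rewrite -pformE pform_polyC -/B.
have e := deriv_mulmx pencil v; rewrite ev in e.
have dP : map_mx (@deriv F) pencil = - B^%P.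
  by apply/matrixP => i j; rewrite !mxE derivB derivC derivM derivX derivC mulr0 addr0 mul1r sub0r.
have dX : map_mx (@deriv F) ('X^m *: be) = 'X^m' *: (m%:R *: be + 'X *: map_mx (@deriv F) be).
  apply/matrixP => i j; rewrite !mxE derivM derivXn /= -[_ *+ _]mulr_natl.
  have -> : 'X^m = 'X^m' * 'X :> {poly F} by rewrite exprSr.
  move: (be i j)^`() (be i j) ('X^m' : {poly F}) (m%:R : {poly F}) => b' b x k.
  by ring.
have uP : u^T *m pencil = - ('X^m *: al^T).
  by rewrite -[pencil]trmxK -trmx_mul pencil_tr mulNmx eu linearN /= linearZ.
have -> : u^T *m B^%P *m v = u^T *m (pencil *m map_mx (@deriv F) v) - u^T *m map_mx (@deriv F) ('X^m *: be).
  by rewrite e dP mulNmx mulmxDr mulmxN opprD opprK addrCA addrN addr0 mulmxA.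
rewrite mulmxA uP dX exprSr -scalerA mulNmx -!scalemxAl -scalemxAr -scalerN -scalerBr.
by rewrite mxE coefXnM lm.
Qed.

(** Since [a] takes the value 1 on [xi], each coordinate covector is a multiple of [a] plus a
    covector [w] that kills [xi]. The bracket pairs to zero with [w] modulo [X^m], and with [a]
    modulo [X^m']. *)
Lemma lbr_chain (u v : V) : chain u -> chain v -> exists r : V,
  lbr c u v = 'X^m' *: ((((a^%P *m lbr c u v) 0 0)`_m')%:P *: xi^%P) + 'X^m *: r.
Proof.
move=> cu cv; set k := _`_m'.
suff [r e] : divXn m (lbr c u v - 'X^m' *: (k%:P *: xi^%P)).
  by exists r; rewrite -e addrCA subrr addr0.
apply: divXn_coef => i l lm.
have -> : (lbr c u v - 'X^m' *: (k%:P *: xi^%P)) i 0 =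
    lbr c u v i 0 - 'X^m' * (k%:P * (xi i 0)%:P).
  by move: (lbr c u v) => L; rewrite !mxE.
pose w : 'rV[F]_n := delta_mx 0 i - xi i 0 *: a.
have wxi : (w *m xi) 0 0 = 0.
  rewrite mulmxBl -scalemxAl -rowE mxE [X in _ + X]mxE [X in _ - X]mxE axi.
  by rewrite mxE mulr1 subrr.
have wE (L : V) : (w^%P *m L) 0 0 = L i 0 - (xi i 0)%:P * (a^%P *m L) 0 0.
  rewrite map_mxB map_mxZ map_delta_mx mulmxBl -scalemxAl -rowE.
  by move: (a^%P *m L) => M; rewrite !mxE.
have := chain_orth cv cu wxi lm; rewrite wE coefB coefCM => /eqP.
rewrite subr_eq0 => /eqP e.
rewrite coefB e -polyCM coefXnM; have [lm'|ml] := ltnP l m'.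
  by rewrite chain_form_coef // mulr0 subr0.
have -> : l = m' by apply/eqP; rewrite eqn_leq ml andbT -ltnS.
by rewrite subnn coefC eqxx -/k mulrC subrr.
Qed.

Definition chain_pairing u v := ((a^%P *m lbr c u v) 0 0)`_m'.

Definition pencil_form (u v : V) : {poly F} := (u^T *m pencil *m v) 0 0.

Lemma pencil_formE u v : pencil_form u v = (z *m lbr c u v) 0 0.
Proof. by rewrite /pencil_form pencilE pformE. Qed.

Lemma pencil_form_jacobi e f g : pencil_form (lbr c e f) g =
  pencil_form e (lbr c f g) - pencil_form f (lbr c e g).
Proof.
have : lbr c (lbr c e f) g = lbr c e (lbr c f g) - lbr c f (lbr c e g).
  have /eqP := lbr_jacobi Lie e f g; rewrite -addrA addr_eq0 => /eqP ->.
  rewrite opprD (lbrC Lie (lbr c f g)) opprK; congr (_ + _).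
  by rewrite (lbrC Lie (lbr c g e)) opprK (lbrC Lie g) -scaleN1r lbrZr // scaleN1r.
by rewrite !pencil_formE => ->; rewrite mulmxBr !mxE.
Qed.

Lemma pencil_form_chainl e v : chain e -> exists s, pencil_form e v = 'X^m * s.
Proof.
move=> [al ee]; exists (- (al^T *m v) 0 0).
rewrite /pencil_form -[pencil]trmxK -trmx_mul pencil_tr mulNmx ee.
by rewrite linearN /= linearZ /= mulNmx -scalemxAl; move: (_ *m v) => M; rewrite !mxE mulrN.
Qed.

Lemma pencil_form_chainr e v : chain e -> exists s, pencil_form v e = 'X^m * s.
Proof.
move=> [al ee]; exists ((v^T *m al) 0 0).
by rewrite /pencil_form -mulmxA ee -scalemxAr; move: (_ *m al) => M; rewrite !mxE.
Qed.

Lemma pencil_formDl u v w : pencil_form (u + v) w = pencil_form u w + pencil_form v w.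
Proof. by rewrite /pencil_form [(u + v)^T]linearD /= (mulmxDl u^T) (mulmxDl (u^T *m _)) mxE. Qed.

Lemma pencil_formZl s u w : pencil_form (s *: u) w = s * pencil_form u w.
Proof. by rewrite /pencil_form [(s *: u)^T]linearZ /= -!scalemxAl [LHS]mxE. Qed.

Lemma pencil_formZr s u w : pencil_form u (s *: w) = s * pencil_form u w.
Proof. by rewrite /pencil_form -scalemxAr [LHS]mxE. Qed.

Lemma pencil_form_const (v : V) :
  pencil_form xi^%P v = ((xi^T *m C)^%P *m v) 0 0 - 'X * ((xi^%P)^T *m B^%P *m v) 0 0.
Proof.
rewrite /pencil_form mulmxBr mulmxBl -scalemxAr -scalemxAl map_mxM map_trmx.
by move: (_ *m _ *m v) (_ *m _ *m v) => M N; rewrite !mxE.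
Qed.

(** In the Jacobi identity for [e], [f] and a constant vector [eta], the terms where [e] or [f]
    stands alone are divisible by [X^m]. In the remaining one the coefficient of degree [m'] is the
    pairing of [e] and [f] times the value of [C] on [xi] and [eta]. *)
Lemma chain_pairing_kernel e f : chain e -> chain f -> chain_pairing e f != 0 ->
  C *m xi = 0.
Proof.
move=> ce cf ef0; have [r er] := lbr_chain ce cf.
suff h : xi^T *m C = 0.
  by rewrite -[C]trmxK -[xi]trmxK -trmx_mul form_of_tr mulmxN h oppr0 trmx0.
apply/rowP => i; rewrite [RHS]mxE; pose eta : V := delta_mx i 0.
have := pencil_form_jacobi e f eta.
have [s1 ->] := pencil_form_chainl (lbr c f eta) ce.
have [s2 ->] := pencil_form_chainl (lbr c e eta) cf.
rewrite er pencil_formDl !pencil_formZl pencil_form_const -/(chain_pairing e f).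
have -> : ((xi^T *m C)^%P *m eta) 0 0 = ((xi^T *m C) 0 i)%:P.
  by rewrite -colE [LHS]mxE [LHS]mxE.
move: (_ 0 i) (_ 0 0) (pencil_form r eta) (chain_pairing e f) ef0 => k P Q k0 k00 h.
have {}h : k0%:P * (k%:P - 'X * P) = 'X * (s1 - s2 - Q).
  apply: (mulfI (_ : 'X^m' != 0)); first by rewrite -size_poly_eq0 size_polyXn.
  have Xm : 'X^m = 'X^m' * 'X :> {poly F} by rewrite exprSr.
  by rewrite -[LHS](addrK ('X^m * Q)) h Xm; ring.
have := congr1 (horner^~ 0) h; rewrite !hornerM hornerX mul0r hornerD hornerN hornerM hornerX mul0r subr0 !hornerC.
by move/eqP; rewrite mulf_eq0 (negPf k00) => /eqP.
Qed.

(* The Jacobi identity for [e], [f], [g] read modulo ['X^(2 * m)]. *)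
Lemma chain_pairing_orth e f g : chain e -> chain f -> chain g ->
  chain_pairing e f != 0 -> chain_pairing e g = 0 -> chain_pairing f g = 0 ->
  (((xi^%P)^T *m B^%P *m g) 0 0)`_m' = 0.
Proof.
move=> ce cf cg ef0 eg fg; have [r er] := lbr_chain ce cf.
have Cxi := chain_pairing_kernel ce cf ef0.
have xiC : xi^T *m C = 0 by rewrite -[C]trmxK -trmx_mul form_of_tr mulNmx Cxi oppr0 trmx0.
(* Zero pairings make [[f, g]] and [[e, g]] divisible by [X^m]; paired with a further chain they
   gain another [X^m]. *)
have [r1 e1] := lbr_chain cf cg; rewrite -/(chain_pairing f g) fg polyC0 scale0r scaler0 add0r in e1.
have [r2 e2] := lbr_chain ce cg; rewrite -/(chain_pairing e g) eg polyC0 scale0r scaler0 add0r in e2.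
have := pencil_form_jacobi e f g; rewrite e1 e2 er pencil_formDl !pencil_formZl !pencil_formZr.
have [s1 ->] := pencil_form_chainl r1 ce; have [s2 ->] := pencil_form_chainl r2 cf.
have [s3 ->] := pencil_form_chainr r cg.
have e0 : (0 : 'M[{poly F}]_1) 0 0 = 0 by rewrite mxE.
rewrite pencil_form_const xiC map_mx0 mul0mx e0 sub0r -/(chain_pairing e f).
move: (_ 0 0) (chain_pairing e f) ef0 => P k k0 h.
have {}h : k%:P * P = 'X^m * (s2 + s3 - s1).
  apply: (mulfI (_ : 'X^m != 0)); first by rewrite -size_poly_eq0 size_polyXn.
  have Xm : 'X^m = 'X^m' * 'X :> {poly F} by rewrite exprSr.
  rewrite -[LHS]opprK -[- (_ * _)](addrK ('X^m * ('X^m * s3))).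
  rewrite (_ : - ('X^m * (k%:P * P)) = 'X^m' * (k%:P * - ('X * P))); last by rewrite Xm; ring.
  by rewrite h; ring.
apply: (mulfI k0); rewrite mulr0 -coefCM h coefXnM ltnSn //.
Qed.

End Chains.

(** * Coordinates in a Jordan-Kronecker basis *)

Section BlockLocation.
Variable F : fieldType.
Implicit Types (d : blk F) (ds : seq (blk F)).

(** Equal blocks may occur several times; the offset [o] tells the occurrences apart. *)
Definition blk_at ds d (o : nat) := exists d1 d2 : seq (blk F), ds = d1 ++ d :: d2 /\ o = blks_size d1.

Lemma blks_size_cat (d1 d2 : seq (blk F)) :
  blks_size (d1 ++ d2) = (blks_size d1 + blks_size d2)%N.
Proof. by rewrite /blks_size map_cat sumn_cat. Qed.

Lemma blk_at_size ds d o : blk_at ds d o -> (o + blk_size d <= blks_size ds)%N.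
Proof.
by move=> [d1 [d2 [-> ->]]]; rewrite blks_size_cat leq_add2l /blks_size /= leq_addr.
Qed.

Lemma blk_at_cover ds i : (i < blks_size ds)%N ->
  exists d o, blk_at ds d o /\ (o <= i < o + blk_size d)%N.
Proof.
elim: ds i => // d ds IH i; rewrite /blks_size /= => id.
have [lt_i|le_i] := ltnP i (blk_size d).
  by exists d, 0%N; split=> //; exists [::], ds.
have [|d' [o [[d1 [d2 [-> ->]]] io]]] := IH (i - blk_size d)%N.
  by rewrite ltn_subLR.
exists d', (blk_size d + blks_size d1)%N; split; last by move: io; lia.
by exists (d :: d1), d2.
Qed.

Lemma blk_at_disjoint ds d d' o o' : blk_at ds d o -> blk_at ds d' o' -> o != o' ->
  (o + blk_size d <= o')%N \/ (o' + blk_size d' <= o)%N.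
Proof.
move=> [d1 [d2 [-> ->]]] [d1' [d2' [e ->]]].
elim: d1 d1' e => [|c1 d1 IH] [|c1' d1'] //=.
- by move=> [<- _] _; left; rewrite /blks_size /=; lia.
- by move=> [-> _] _; right; rewrite /blks_size /=; lia.
- move=> [<- /IH h] ne; have : blks_size d1 != blks_size d1'.
    by apply: contra_neq ne; rewrite /blks_size /= => ->.
  by move=> /h; rewrite /blks_size /=; lia.
Qed.

Lemma bdiagf_at (f : blk F -> nat -> nat -> F) ds d o i j : blk_at ds d o ->
  (i < blk_size d)%N -> (j < blk_size d)%N ->
  bdiagf f ds (o + i) (o + j) = f d i j.
Proof.
move=> [d1 [d2 [-> ->]]] id jd; elim: d1 => [|c1 d1 IH].
  by rewrite /bdiagf /= id jd.
by rewrite /bdiagf /= /blks_size /= -!addnA !ltnNge !leq_addr /= !addKn -[RHS]IH.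
Qed.

Lemma bdiagf_off (f : blk F -> nat -> nat -> F) ds d o i j : blk_at ds d o ->
  (o <= i < o + blk_size d)%N -> ~~ (o <= j < o + blk_size d)%N ->
  bdiagf f ds i j = 0 /\ bdiagf f ds j i = 0.
Proof.
move=> [d1 [d2 [-> ->]]]; elim: d1 i j => [|c1 d1 IH] i j.
  rewrite /blks_size /= !add0n => id; rewrite -leqNgt => jd.
  by rewrite /bdiagf /= id !(leqNgt (blk_size d)) id /= (leq_gtF jd) /= ?andbF.
rewrite /bdiagf /blks_size /= => id jd.
have ci : (i < blk_size c1)%N = false by lia.
rewrite ci !(leqNgt (blk_size c1)) ci /= ?andbF.
have [jc|jc] := ltnP j (blk_size c1); first by [].
by apply: IH; rewrite -/(blks_size _); move: id jd; rewrite /blks_size; lia.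
Qed.

Lemma sum_window (R : nmodType) (n o s : nat) (G : nat -> R) : (o + s <= n)%N ->
  (forall j, ~~ (o <= j < o + s)%N -> G j = 0) ->
  \sum_(j < n) G j = \sum_(j < s) G (o + j)%N.
Proof.
move=> on G0; rewrite -(big_mkord xpredT) -(big_mkord xpredT (fun j => G (o + j)%N)).
rewrite (big_cat_nat (leq0n o)) ?(leq_trans (leq_addr s o)) //=.
rewrite (big_cat_nat (leq_addr s o) on) /= big_nat big1 ?add0r => [|j jo]; last first.
  by apply: G0; lia.
rewrite [X in _ + X]big_nat [X in _ + X]big1 ?addr0 => [|j jo]; last first.
  by apply: G0; lia.
rewrite -{1}[o]add0n big_addn addKn.
by apply: eq_bigr => j _; rewrite addnC.
Qed.

Lemma bdiagf_row_sum (R : nzRingType) (phi : {additive F -> R}) (f : blk F -> nat -> nat -> F)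
  ds d o i (v : nat -> R) : blk_at ds d o -> (i < blk_size d)%N ->
  \sum_(j < blks_size ds) phi (bdiagf f ds (o + i)%N j) * v j =
  \sum_(j < blk_size d) phi (f d i j) * v (o + j)%N.
Proof.
move=> dso id; pose G j := phi (bdiagf f ds (o + i)%N j) * v j.
transitivity (\sum_(j < blk_size d) G (o + j)%N); last first.
  by apply: eq_bigr => j _; rewrite /G (bdiagf_at f dso).
apply: (sum_window (G := G)); first exact: blk_at_size.
move=> j jd; rewrite /G; have [|-> _] := bdiagf_off f (i := (o + i)%N) dso _ jd.
  by rewrite leq_addr ltn_add2l.
by rewrite raddf0 mul0r.
Qed.

Lemma mulmx_bdiagf (f : blk F -> nat -> nat -> F) ds d o
    (z : 'cV[F]_(blks_size ds)) (i : 'I_(blks_size ds)) :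
  blk_at ds d o -> (o <= i < o + blk_size d)%N ->
  (mxf (blks_size ds) (blks_size ds) (bdiagf f ds) *m z) i 0 =
  \sum_(j < blk_size d) f d (i - o)%N j * mxext z (o + j) 0.
Proof.
move=> dso /andP[oi io]; have id : (i - o < blk_size d)%N by rewrite ltn_subLR.
rewrite mxE -(bdiagf_row_sum idfun f (fun j => mxext z j 0) dso id) /=.
by apply: eq_bigr => j _; rewrite mxE subnKC // -(mxextE z j 0).
Qed.

Lemma count_mem_split2 (T : eqType) (v : T) (s : seq T) : (2 <= count_mem v s)%N ->
  exists l1 l2 l3, s = l1 ++ v :: l2 ++ v :: l3.
Proof.
elim: s => // x s IH /=; have [->|_] /= := eqVneq x v; last first.
  by rewrite add0n => /IH[l1 [l2 [l3 ->]]]; exists (x :: l1), l2, l3.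
rewrite add1n ltnS -has_count has_pred1 => /splitPr[l2 l3].
by exists [::], l2, l3.
Qed.
End BlockLocation.

Section SkewEntries.
Variable F : fieldType.
Variables (m m' : nat) (M : nat -> nat -> F).

Lemma skew_of_ul i j : (i < m)%N -> (j < m)%N -> skew_of m m' M i j = 0.
Proof. by move=> im jm; rewrite /skew_of im jm !(leqNgt m) im jm. Qed.

Lemma skew_of_ur i j : (i < m)%N -> (j < m')%N -> skew_of m m' M i (m + j) = M i j.
Proof. by move=> im jm; rewrite /skew_of im leq_addr ltn_add2l jm addKn. Qed.

Lemma skew_of_dl i j : (i < m')%N -> (j < m)%N -> skew_of m m' M (m + i) j = - M j i.
Proof.
by move=> im jm; rewrite /skew_of ltnNge leq_addr /= ltn_add2l im jm addKn.
Qed.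

Lemma skew_of_dr i j : skew_of m m' M (m + i) (m + j) = 0.
Proof. by rewrite /skew_of !(ltnNge (m + _)) !leq_addr /= andbF. Qed.
End SkewEntries.

Lemma sum_pick (R : nmodType) (k i : nat) (g : nat -> R) :
  \sum_(j < k) (if j == i :> nat then g j else 0) = if (i < k)%N then g i else 0.
Proof.
rewrite -big_mkcond; case: ltnP => [ik|ki]; first by rewrite (big_pred1 (Ordinal ik)).
by rewrite big_pred0 // => j; apply/eqP => e; move: (ltn_ord j); rewrite e ltnNge ki.
Qed.

Lemma blk_at_eq (F : fieldType) (ds : seq (blk F)) d d' o : blk_at ds d o -> blk_at ds d' o ->
  (0 < blk_size d)%N -> (0 < blk_size d')%N -> d = d'.
Proof.
move=> [d1 [d2 [-> ->]]] [d1' [d2' [e +]]] sd sd'.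
elim: d1 d1' e => [|c1 d1 IH] [|c1' d1'] //=.
- by move=> [].
- by move=> [e _]; move: sd; rewrite e /blks_size /=; lia.
- by move=> [e _]; move: sd'; rewrite -e /blks_size /=; lia.
- by move=> [<- /IH h]; rewrite /blks_size /= => /addnI/h.
Qed.

Section SkewSums.
Variables (F : fieldType) (m m' : nat) (M : nat -> nat -> F) (w : nat -> F).

Lemma skew_of_sum_u i : (i < m)%N ->
  \sum_(j < m + m') skew_of m m' M i j * w j = \sum_(j < m') M i j * w (m + j)%N.
Proof.
move=> im; rewrite big_split_ord /= big1 ?add0r => [|j _]; last by rewrite skew_of_ul ?mul0r.
by apply: eq_bigr => j _; rewrite skew_of_ur.
Qed.

Lemma skew_of_sum_d i : (i < m')%N ->
  \sum_(j < m + m') skew_of m m' M (m + i) j * w j = - \sum_(j < m) M j i * w j.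
Proof.
move=> im; rewrite big_split_ord /= [X in _ + X]big1 ?addr0 => [|j _]; last first.
  by rewrite skew_of_dr mul0r.
by rewrite -sumrN; apply: eq_bigr => j _; rewrite skew_of_dl // mulNr.
Qed.
End SkewSums.

Section CanonicalSums.
Variables (F : fieldType) (k : nat) (w : nat -> F).

Lemma id_mxf_sum i : (i < k)%N -> \sum_(j < k) id_mxf F i j * w j = w i.
Proof.
move=> ik; transitivity (if (i < k)%N then w i else 0); last by rewrite ik.
rewrite -sum_pick.
by apply: eq_bigr => j _; rewrite /id_mxf eq_sym; case: ifP; rewrite ?mul1r ?mul0r.
Qed.

Lemma id_mxf_sumT i : (i < k)%N -> \sum_(j < k) id_mxf F j i * w j = w i.
Proof.
by move=> ik; rewrite -[RHS]id_mxf_sum //; apply: eq_bigr => j _; rewrite /id_mxf eq_sym.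
Qed.

Lemma jordan_mx0_sum i : \sum_(j < k) jordan_mx (0 : F) i j * w j =
  if (i.+1 < k)%N then w i.+1 else 0.
Proof.
rewrite -sum_pick; apply: eq_bigr => j _; rewrite /jordan_mx.
have [->|_] := eqVneq i (j : nat); first by rewrite mul0r ifF //; lia.
by case: ifP; rewrite ?mul1r ?mul0r.
Qed.

Lemma jordan_mx0_sumT i : (i < k)%N -> \sum_(j < k) jordan_mx (0 : F) j i.+1 * w j = w i.
Proof.
move=> ik; transitivity (if (i < k)%N then w i else 0); last by rewrite ik.
rewrite -sum_pick.
apply: eq_bigr => j _; rewrite /jordan_mx eqSS eq_sym.
have [->|_] := eqVneq i (j : nat); first by rewrite ifF ?mul1r //; lia.
by case: ifP; rewrite mul0r.
Qed.
End CanonicalSums.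

Lemma count_mem_blk_at (F : fieldType) (ds : seq (blk F)) d o o' :
  (count_mem d ds <= 1)%N -> blk_at ds d o -> blk_at ds d o' -> o = o'.
Proof.
move=> cd [d1 [d2 [e ->]]] [d1' [d2' [e' ->]]]; subst ds.
elim: d1 d1' cd e' => [|c1 d1 IH] [|c1' d1'] //= cd.
- by move=> [_ e]; move: cd; rewrite e count_cat /= !eqxx; lia.
- by move=> [e _]; move: cd; rewrite e count_cat /= !eqxx; lia.
- move=> [<- e]; rewrite /blks_size /= -!/(blks_size _) (IH d1') //.
  exact: leq_trans (leq_addl _ _) cd.
Qed.

Lemma blk_pos (F : fieldType) (jb : seq (option F * nat)) (kb : seq nat) d o :
  all (fun b => 0 < b.2)%N jb -> all (fun k => 0 < k)%N kb ->
  blk_at (blks jb kb) d o -> (0 < blk_size d)%N.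
Proof.
move=> jb0 kb0 [d1 [d2 [e _]]]; have : d \in blks jb kb by rewrite e mem_cat mem_head orbT.
by rewrite mem_cat => /orP[/mapP[b /(allP jb0) b0 ->]|/mapP[k /(allP kb0) k0 ->]] /=; lia.
Qed.

(** * Chains of Jordan blocks and the support of [xi] *)

Section Coordinates.
Variables (F : numClosedFieldType) (jb : seq (option F * nat)) (kb : seq nat).
Let ds := blks jb kb.
Let n := blks_size ds.
Variables (c : 'I_n -> 'I_n -> 'I_n -> F) (x a : 'rV[F]_n) (P : 'M[F]_n) (lam : F).
Hypothesis Lie : lie_structure c.
Hypothesis jb0 : all (fun b => 0 < b.2)%N jb.
Hypothesis kb0 : all (fun k => 0 < k)%N kb.
Hypothesis Pu : P \in unitmx.
Hypothesis PA : P^T *m form_of c x *m P = mxf n n (bdiagf (@blkA F) ds).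
Hypothesis PB : P^T *m form_of c a *m P = mxf n n (bdiagf (@blkB F) ds).
Local Notation V := 'cV[{poly F}]_n.
Local Notation "M ^%P" := (map_mx polyC M) (at level 2, format "M ^%P").
Let y := x - lam *: a.
Let blkC (d : blk F) i j := blkA d i j - lam * blkB d i j.
Let C' : 'M[F]_n := mxf n n (bdiagf blkC ds).
Let B' : 'M[F]_n := mxf n n (bdiagf (@blkB F) ds).

Let PC : P^T *m form_of c y *m P = C'.
Proof.
rewrite /y form_ofB form_ofZ mulmxBr mulmxBl -scalemxAr -scalemxAl PA PB.
by apply/matrixP => i j; rewrite !mxE bdiagfB.
Qed.

Let pen' : 'M[{poly F}]_n := C'^%P - 'X *: B'^%P.

Lemma chain_coord m' (u : V) : divXn m'.+1 (pen' *m u) -> chain c y a m' (P^%P *m u).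
Proof.
move=> [r e]; exists ((invmx P^T)^%P *m r); rewrite scalemxAr -e /pen' -PC /B' -PB.
have h (M : 'M[F]_n) : (invmx P^T)^%P *m (P^T *m M *m P)^%P = M^%P *m P^%P.
  by rewrite -map_mxM !mulmxA mulVmx ?unitmx_tr // mul1mx map_mxM.
rewrite (mulmxA (invmx P^T)^%P) mulmxBr -scalemxAr !h.
by rewrite /pencil !mulmxBl -!scalemxAl !mulmxA.
Qed.

Lemma pairing_coord (u v : V) : (a^%P *m lbr c (P^%P *m u) (P^%P *m v)) 0 0 =
  (u^T *m B'^%P *m v) 0 0.
Proof. by rewrite -pformE pform_polyC trmx_mul /B' -PB !map_mxM map_trmx !mulmxA. Qed.

Definition colf (v : nat -> {poly F}) : V := \col_(i < n) v i.

Definition blk_supp (d : blk F) (o : nat) (v : nat -> {poly F}) :=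
  forall i, ~~ (o <= i < o + blk_size d)%N -> v i = 0.

Lemma bdiagf_colf (f : blk F -> nat -> nat -> F) d o (v : nat -> {poly F}) (i : 'I_n) :
  blk_at ds d o -> blk_supp d o v ->
  ((mxf n n (bdiagf f ds))^%P *m colf v) i 0 =
  if (o <= i < o + blk_size d)%N then
    \sum_(j < blk_size d) (f d (i - o)%N j)%:P * v (o + j)%N
  else 0.
Proof.
move=> dso sv; rewrite mxE.
have [d' [o' [dso' /andP[oi io]]]] := blk_at_cover (ltn_ord i).
have sub_i : (i - o' < blk_size d')%N by rewrite ltn_subLR.
transitivity (\sum_(j < blk_size d') (f d' (i - o')%N j)%:P * v (o' + j)%N).
  rewrite -(bdiagf_row_sum polyC f v dso' sub_i); apply: eq_bigr => j _.
  by rewrite !mxE subnKC.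
have [eo|no] := eqVneq o' o.
  move: eo oi io dso' => -> oi io dso'.
  by rewrite -(blk_at_eq dso dso' (blk_pos jb0 kb0 dso) (blk_pos jb0 kb0 dso')) in io *; rewrite oi io.
have dj := blk_at_disjoint dso' dso no.
rewrite ifF ?big1 // => [j _|]; last by move: dj oi io; lia.
by rewrite sv ?mulr0 //; move: dj oi io (ltn_ord j); lia.
Qed.

Lemma form_coord_disjoint d o d' o' (u v : nat -> {poly F}) : blk_at ds d o ->
  blk_at ds d' o' -> o != o' -> blk_supp d o u -> blk_supp d' o' v ->
  ((colf u)^T *m B'^%P *m colf v) 0 0 = 0.
Proof.
move=> dso dso' no su sv; rewrite -mulmxA mxE big1 // => i _.
rewrite (bdiagf_colf (@blkB F) i dso' sv); case: ifP => [io'|_]; last by rewrite mulr0.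
rewrite !mxE su ?mul0r //; apply/negP => io.
by have := blk_at_disjoint dso dso' no; move: io io'; lia.
Qed.

(* The two Jordan chains of the block of size [2 * k] at position [o], starting
   from the eigenvectors at the positions [o + k - 1] and [o + k]. *)
Definition echain (o k i : nat) : {poly F} :=
  if (o <= i < o + k)%N then 'X^(o + k - i.+1) else 0.
Definition fchain (o k i : nat) : {poly F} :=
  if (o + k <= i < o + k + k)%N then 'X^(i - (o + k)) else 0.

Section JordanBlock.
Variables (k o : nat).
Let d : blk F := inl (Some lam, k).
Hypothesis dso : blk_at ds d o.

Lemma echain_supp : blk_supp d o (echain o k).
Proof. by move=> i h; rewrite /echain ifF //; move: h; rewrite /=; lia. Qed.

Lemma fchain_supp : blk_supp d o (fchain o k).
Proof. by move=> i h; rewrite /fchain ifF //; move: h; rewrite /=; lia. Qed.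

Let blkCE i j : blkC d i j = skew_of k k (jordan_mx 0) i j.
Proof.
rewrite /blkC /= skew_ofB /skew_of /jordan_mx /id_mxf.
have e r s : (if r == s then lam else if s == r.+1 then 1 else 0) - lam * (if r == s then 1 else 0)
   = (if r == s then 0 else if s == r.+1 then 1 else 0).
  by case: eqP => _; rewrite ?mulr1 ?subrr ?mulr0 ?subr0.
by rewrite !e.
Qed.

Lemma fchain_hi j : (j < k)%N -> fchain o k (o + (k + j)) = 'X^j.
Proof.
by move=> jk; rewrite /fchain ifT; [congr ('X^_); lia|lia].
Qed.

Lemma echain_lo j : (j < k)%N -> echain o k (o + j) = 'X^(k - j.+1).
Proof. by move=> jk; rewrite /echain ifT; [congr ('X^_); lia|lia]. Qed.

Lemma sum_fchain (phi : nat -> {poly F}) :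
  \sum_(j < 2 * k) phi j * fchain o k (o + j) = \sum_(j < k) phi (k + j)%N * 'X^j.
Proof.
pose G j := phi j * fchain o k (o + j).
transitivity (\sum_(j < k) G (k + j)%N); last first.
  by apply: eq_bigr => j _; rewrite /G fchain_hi.
apply: (sum_window (G := G)) => [|j jk]; first by lia.
rewrite /G /fchain ifF ?mulr0 //; lia.
Qed.

Lemma sum_echain (phi : nat -> {poly F}) :
  \sum_(j < 2 * k) phi j * echain o k (o + j) = \sum_(j < k) phi j * 'X^(k - j.+1).
Proof.
pose G j := phi j * echain o k (o + j).
transitivity (\sum_(j < k) G (0 + j)%N); last first.
  by apply: eq_bigr => j _; rewrite /G add0n echain_lo.
apply: (sum_window (G := G)) => [|j jk]; first by lia.
rewrite /G /echain ifF ?mulr0 //; lia.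
Qed.

Lemma B_fchain (i : 'I_n) : (B'^%P *m colf (fchain o k)) i 0 =
  if (o <= i < o + k)%N then 'X^(i - o) else 0.
Proof.
rewrite (bdiagf_colf (@blkB F) i dso fchain_supp) /=.
rewrite (sum_fchain (fun j => (skew_of k k (@id_mxf F) (i - o)%N j)%:P)).
have [io|io] := boolP (o <= i < o + 2 * k)%N; last by rewrite ifF //; move: io; lia.
case: ifP => ik.
  have ik' : (i - o < k)%N by move: ik; lia.
  transitivity (\sum_(j < k) (if j == (i - o)%N :> nat then 'X^j else 0 : {poly F})).
    apply: eq_bigr => j _; rewrite skew_of_ur // /id_mxf eq_sym.
    by case: ifP; rewrite ?mul1r ?mul0r.
  by rewrite (sum_pick k (i - o) (fun j => 'X^j : {poly F})) ik'.
rewrite big1 // => j _; rewrite (_ : (i - o = k + (i - o - k))%N); last by move: io ik; lia.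
by rewrite skew_of_dr mul0r.
Qed.

Lemma C_fchain (i : 'I_n) : (C'^%P *m colf (fchain o k)) i 0 =
  if (o <= i < o + k.-1)%N then 'X^((i - o).+1) else 0.
Proof.
rewrite (bdiagf_colf blkC i dso fchain_supp) [blk_size d]/=.
rewrite (sum_fchain (fun j => (blkC d (i - o)%N j)%:P)).
have [io|io] := boolP (o <= i < o + 2 * k)%N; last by rewrite ifF //; move: io; lia.
have [ik|ki] := ltnP (i - o) k.
  transitivity (\sum_(j < k) (if j == (i - o).+1 :> nat then 'X^j else 0 : {poly F})).
    apply: eq_bigr => j _; rewrite blkCE skew_of_ur // /jordan_mx.
    have [->|_] := eqVneq (i - o)%N j; first by rewrite mul0r ifF //; lia.
    by case: ifP; rewrite ?mul1r ?mul0r.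
  rewrite (sum_pick k (i - o).+1 (fun j => 'X^j : {poly F})).
  by congr (if _ then _ else _); move: io ik; lia.
rewrite ifF; last by move: io ki; lia.
rewrite big1 // => j _; rewrite blkCE (_ : (i - o = k + (i - o - k))%N); last by lia.
by rewrite skew_of_dr mul0r.
Qed.

Lemma B_echain (i : 'I_n) : (B'^%P *m colf (echain o k)) i 0 =
  if (o + k <= i < o + k + k)%N then - 'X^(o + k + k - i.+1) else 0.
Proof.
rewrite (bdiagf_colf (@blkB F) i dso echain_supp) /=.
rewrite (sum_echain (fun j => (skew_of k k (@id_mxf F) (i - o)%N j)%:P)).
have [io|io] := boolP (o <= i < o + 2 * k)%N; last by rewrite ifF //; move: io; lia.
have [ik|ki] := ltnP (i - o) k.
  rewrite ifF; last by move: io ik; lia.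
  by rewrite big1 // => j _; rewrite skew_of_ul ?mul0r.
rewrite ifT; last by move: io ki; lia.
pose i' := (i - o - k)%N; have ei : (i - o = k + i')%N by rewrite /i'; lia.
have ik' : (i' < k)%N by rewrite /i'; lia.
transitivity (\sum_(j < k) (if j == i' :> nat then - 'X^(k - j.+1) else 0 : {poly F})).
  apply: eq_bigr => j _; rewrite ei skew_of_dl // /id_mxf.
  by case: ifP; rewrite ?oppr0 ?mul0r // polyCN mulN1r.
rewrite (sum_pick k i' (fun j => - 'X^(k - j.+1) : {poly F})) ik'.
by congr (- 'X^_); rewrite /i'; lia.
Qed.

Lemma C_echain (i : 'I_n) : (C'^%P *m colf (echain o k)) i 0 =
  if (o + k < i < o + k + k)%N then - 'X^(o + k + k - i) else 0.
Proof.
rewrite (bdiagf_colf blkC i dso echain_supp) [blk_size d]/=.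
rewrite (sum_echain (fun j => (blkC d (i - o)%N j)%:P)).
have [io|io] := boolP (o <= i < o + 2 * k)%N; last by rewrite ifF //; move: io; lia.
have [ik|ki] := ltnP (i - o) k.
  rewrite ifF; last by move: io ik; lia.
  by rewrite big1 // => j _; rewrite blkCE skew_of_ul ?mul0r.
pose i' := (i - o - k)%N; have ei : (i - o = k + i')%N by rewrite /i'; lia.
have ik' : (i' < k)%N by rewrite /i'; lia.
have [i0|i0] := posnP i'.
  rewrite ifF; last by move: i0; rewrite /i'; lia.
  have k0 : (0 < k)%N by lia.
  rewrite big1 // => j _; rewrite blkCE ei i0 skew_of_dl // /jordan_mx.
  by case: ifP; rewrite ?if_same ?oppr0 ?mul0r.
rewrite ifT; last by move: i0; rewrite /i'; lia.
transitivity (\sum_(j < k) (if j == i'.-1 :> nat then - 'X^(k - j.+1) else 0 : {poly F})).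
  apply: eq_bigr => j _; rewrite blkCE ei skew_of_dl // /jordan_mx.
  have -> : (i' == j.+1) = (j == i'.-1 :> nat) by move: i0; lia.
  have [->|_] := eqVneq (nat_of_ord j) i'; first by rewrite oppr0 mul0r ifF //; lia.
  by case: ifP; rewrite ?oppr0 ?mul0r // polyCN mulN1r.
rewrite (sum_pick k i'.-1 (fun j => - 'X^(k - j.+1) : {poly F})) ifT; last by lia.
by congr (- 'X^_); move: i0; rewrite /i'; lia.
Qed.

Lemma divXnP m (w : V) : (forall i, exists r, w i 0 = 'X^m * r) -> divXn m w.
Proof.
move=> h; apply: divXn_coef => i l lm; have [r ->] := h i.
by rewrite coefXnM lm.
Qed.

(** The chain of a block with [k] below [m = m'.+1] is killed only modulo [X^k]; the factor
    [X^(m - k)] makes up the difference. *)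
Lemma chain_fchain m' : (k <= m'.+1)%N ->
  chain c y a m' (P^%P *m ('X^(m'.+1 - k) *: colf (fchain o k))).
Proof.
move=> km; apply: chain_coord; rewrite -scalemxAr; apply: divXnP => i.
rewrite mxE {1}/pen' mulmxBl -scalemxAl mxE [X in _ * (_ + X)]mxE [X in _ * (_ - X)]mxE.
rewrite B_fchain C_fchain.
suff [r ->] : exists r : {poly F},
    (if (o <= i < o + k.-1)%N then 'X^((i - o).+1) else 0) -
    'X * (if (o <= i < o + k)%N then 'X^(i - o) else 0) = 'X^k * r.
  by exists r; rewrite mulrA -exprD subnK.
case: ifP => h1; case: ifP => h2.
- by exists 0; rewrite mulr0 exprS subrr.
- by move: h1 h2; lia.
- exists (- 1); rewrite sub0r mulrN1 -exprS; congr (- 'X^_).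
  by move: h1 h2; lia.
- by exists 0; rewrite !mulr0 subr0.
Qed.

Lemma chain_echain m' : (k <= m'.+1)%N ->
  chain c y a m' (P^%P *m ('X^(m'.+1 - k) *: colf (echain o k))).
Proof.
move=> km; apply: chain_coord; rewrite -scalemxAr; apply: divXnP => i.
rewrite mxE {1}/pen' mulmxBl -scalemxAl mxE [X in _ * (_ + X)]mxE [X in _ * (_ - X)]mxE.
rewrite B_echain C_echain.
suff [r ->] : exists r : {poly F},
    (if (o + k < i < o + k + k)%N then - 'X^(o + k + k - i) else 0) -
    'X * (if (o + k <= i < o + k + k)%N then - 'X^(o + k + k - i.+1) else 0) = 'X^k * r.
  by exists r; rewrite mulrA -exprD subnK.
case: ifP => h1; case: ifP => h2.
- exists 0; rewrite mulr0 mulrN opprK -exprS (_ : (o + k + k - i.+1).+1 = o + k + k - i)%N ?addNr //.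
  by move: h1 h2; lia.
- by move: h1 h2; lia.
- exists 1; rewrite sub0r mulrN opprK mulr1 -exprS; congr ('X^_).
  by move: h1 h2; lia.
- by exists 0; rewrite !mulr0 subr0.
Qed.

(** Each of the [k] positions contributes [X^(k - 1)]. In characteristic zero the factor [k] does
    not vanish, so the two chains of a maximal block have a nonzero pairing. *)
Lemma pairing_echain_fchain :
  ((colf (echain o k))^T *m B'^%P *m colf (fchain o k)) 0 0 = k%:R *: 'X^(k.-1).
Proof.
rewrite -mulmxA mxE.
pose G j : {poly F} := (if (o <= j < o + k)%N then 'X^(k.-1) else 0).
transitivity (\sum_(j < n) G j).
  apply: eq_bigr => i _; rewrite B_fchain mxE mxE /echain /G.
  case: ifP => io; last by rewrite mul0r.
  by rewrite -exprD; congr ('X^_); move: io; lia.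
rewrite (sum_window (o := o) (s := k)) => [||j jo]; last by rewrite /G (negPf jo).
  rewrite (eq_bigr (fun=> 'X^(k.-1))) => [|j _].
    by rewrite sumr_const card_ord scaler_nat.
  by rewrite /G ifT //; have := ltn_ord j; lia.
by apply: leq_trans (blk_at_size dso); rewrite /=; lia.
Qed.
End JordanBlock.
Lemma bdiagf_mulz (f : blk F -> nat -> nat -> F) d o i (z : 'cV[F]_n) :
  blk_at ds d o -> mxf n n (bdiagf f ds) *m z = 0 -> (i < blk_size d)%N ->
  \sum_(j < blk_size d) f d i j * mxext z (o + j) 0 = 0.
Proof.
move=> dso fz id; have oin : (o + i < n)%N.
  by apply: leq_trans (blk_at_size dso); rewrite ltn_add2l.
have /matrixP/(_ (Ordinal oin) 0) := fz.
by rewrite (mulmx_bdiagf f z dso) /= ?leq_addr ?ltn_add2l // addKn mxE.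
Qed.

Section Core.
Variables (xi : 'cV[F]_n) (m' : nat).
Let m := m'.+1.
Let z := invmx P *m xi.
Hypothesis axi : (a *m xi) 0 0 = 1.
Hypothesis rank_const : forall w : 'rV[F]_n, (w *m xi) 0 0 = 0 ->
  exists2 g : {poly F}, g != 0 & forall s, g.[s] != 0 ->
    (syl_rank (form_of c y + s *: form_of c w)%R (form_of c a) m <=
     syl_rank (form_of c y) (form_of c a) m)%N.
Hypothesis jb_max : forall b, b \in jb -> b.1 = Some lam -> (b.2 <= m)%N.
Hypothesis jb_two : (2 <= count_mem (Some lam, m) jb)%N.

(** Multiple maxima enter here: whichever block is tested, a maximal block at another position
    supplies two chains that pair to zero with it. *)
Let other o : exists2 o', o' != o & blk_at ds (inl (Some lam, m)) o'.
Proof.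
have [l1 [l2 [l3 e]]] := count_mem_split2 jb_two.
have at1 : blk_at ds (inl (Some lam, m)) (blks_size (map inl l1 : seq (blk F))).
  exists (map inl l1), (map inl (l2 ++ (Some lam, m) :: l3) ++ map inr kb); split=> //.
  by rewrite /ds /blks e !map_cat /= !map_cat /= -!catA /= -?catA.
have at2 : blk_at ds (inl (Some lam, m)) (blks_size (map inl (l1 ++ (Some lam, m) :: l2) : seq (blk F))).
  exists (map inl (l1 ++ (Some lam, m) :: l2)), (map inl l3 ++ map inr kb); split=> //.
  by rewrite /ds /blks e !map_cat /= !map_cat /= -!catA /= -?catA.
have [->|] := eqVneq o (blks_size (map inl l1 : seq (blk F))); last first.
  by rewrite eq_sym => no; exists (blks_size (map inl l1 : seq (blk F))).
exists (blks_size (map inl (l1 ++ (Some lam, m) :: l2) : seq (blk F))) => //.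
by rewrite map_cat blks_size_cat /blks_size /=; lia.
Qed.

Let ech o : V := P^%P *m ('X^(m'.+1 - m) *: colf (echain o m)).
Let fch o : V := P^%P *m ('X^(m'.+1 - m) *: colf (fchain o m)).

Let ef_pairing o : blk_at ds (inl (Some lam, m)) o ->
  chain_pairing c a m' (ech o) (fch o) != 0.
Proof.
move=> dso; rewrite /chain_pairing /ech /fch pairing_coord subnn expr0 !scale1r.
by rewrite (pairing_echain_fchain dso) coefZ coefXn eqxx mulr1 pnatr_eq0.
Qed.

Lemma core_kernel : form_of c y *m xi = 0.
Proof.
have [o _ dso] := other 0.
exact: (chain_pairing_kernel Lie axi rank_const (chain_echain dso (leqnn m))
  (chain_fchain dso (leqnn m)) (ef_pairing dso)).
Qed.

Let Cz : C' *m z = 0.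
Proof. by rewrite /z -PC mulmxA mulmxK // -mulmxA core_kernel mulmx0. Qed.

(** [chain_pairing_orth] is applied with [e], [f] taken from another maximal block. The coefficient
    of degree [m'] of the tested chain is the basis vector at [j0], which isolates one coordinate of
    [B' z]. *)
Let chain_coord_orth k o (v : nat -> {poly F}) (j0 : nat) :
  blk_at ds (inl (Some lam, k)) o -> blk_supp (inl (Some lam, k)) o v ->
  chain c y a m' (P^%P *m ('X^(m'.+1 - k) *: colf v)) ->
  (forall j : 'I_n, ('X^(m'.+1 - k) * v j)`_m' = (j == j0 :> nat)%:R) ->
  forall j : 'I_n, j = j0 :> nat -> (B' *m z) j 0 = 0.
Proof.
move=> dso sv cg vj j jj0; have [o' no dso'] := other o.
have pair0 (u : nat -> {poly F}) : blk_supp (inl (Some lam, m)) o' u ->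
    chain_pairing c a m' (P^%P *m ('X^(m'.+1 - m) *: colf u))
      (P^%P *m ('X^(m'.+1 - k) *: colf v)) = 0.
  move=> su; rewrite /chain_pairing pairing_coord [('X^_ *: colf u)^T]linearZ /= -scalemxAr -!scalemxAl.
  have e := form_coord_disjoint dso' dso no su sv.
  by move: e; move: (_ *m _ *m _) => M e; rewrite !mxE e !mulr0 coef0.
have := chain_pairing_orth Lie axi rank_const (chain_echain dso' (leqnn m))
  (chain_fchain dso' (leqnn m)) cg (ef_pairing dso')
  (pair0 _ (echain_supp (k := m) (o := o'))) (pair0 _ (fchain_supp (k := m) (o := o'))).
have -> : (xi^%P)^T *m (form_of c a)^%P *m (P^%P *m ('X^(m'.+1 - k) *: colf v)) =
    (z^T *m B')^%P *m ('X^(m'.+1 - k) *: colf v).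
  have zB : z^T *m B' = xi^T *m form_of c a *m P.
    rewrite /B' -PB /z trmx_mul trmx_inv -!mulmxA; congr (_ *m _).
    by rewrite mulKmx ?unitmx_tr.
  by rewrite zB !map_mxM map_trmx !mulmxA.
have BT : z^T *m B' = - (B' *m z)^T.
  rewrite (trmx_mul B' z) (_ : B'^T = - B') ?mulmxN ?opprK //.
  by rewrite /B' -PB !trmx_mul trmxK form_of_tr // mulNmx mulmxN mulmxA.
have key (y' : 'rV[F]_n) : ((y'^%P *m ('X^(m'.+1 - k) *: colf v)) 0 0)`_m' = y' 0 j.
  rewrite mxE coef_sum (bigD1 j) //= big1 => [|i ni].
    by rewrite !mxE coefCM vj jj0 eqxx mulr1 addr0.
  rewrite !mxE coefCM vj -jj0 (_ : (_ == _) = false) ?mulr0 //.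
  by apply: contra_neqF ni => /eqP/val_inj.
rewrite key BT; move: (B' *m z) => M; rewrite !mxE => /eqP.
by rewrite oppr_eq0 => /eqP.
Qed.

(** [C' z = 0] kills [z] on Jordan blocks with other eigenvalues and on the lower halves of
    Kronecker blocks, and leaves on a block at [lam] only the two middle positions [k - 1] and [k].
    The chain conditions on [B' z] kill these. *)
Lemma core_support (i : 'I_n) : z i 0 != 0 ->
  exists k o, blk_at ds (inr k) o /\ (o <= i < o + k)%N.
Proof.
move=> zi; have [d [o [dso io]]] := blk_at_cover (ltn_ord i).
pose w j := mxext z (o + j) 0.
have wi : w (i - o)%N != 0 by rewrite /w subnKC ?(mxextE z i 0) //; case/andP: io.
have lio : (i - o < blk_size d)%N by move: io; lia.
have eqC r : (r < blk_size d)%N -> \sum_(j < blk_size d) blkC d r j * w j = 0.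
  exact: (bdiagf_mulz dso Cz).
case: d dso io lio eqC => [[mu k]|k] dso io lio eqC; last first.
  exists k, o; split=> //; case/andP: io => oi io; rewrite oi /=.
  rewrite ltnNge; apply/negP => ki; case/negP: wi; apply/eqP.
  have k0 : (0 < k)%N by have := blk_pos jb0 kb0 dso; rewrite /=; lia.
  pose v : 'cV[F]_k.-1 := \col_(j < k.-1) w (k + j)%N.
  have v0 : v = 0.
    apply: (mulmx_trig_inj (M := mxf k k.-1 (fun i j => kron1 F i j - lam * kron2 F i j))
      (h := widen_ord (leq_pred k)) (r := fun j : 'I_k.-1 => j : nat)) => [j|j r rj jr|].
    - by rewrite !mxE /kron1 /kron2 /= eqxx (ltn_eqF (ltnSn _)) mulr0 subr0 oner_eq0.
    - rewrite !mxE /kron1 /kron2 /=; move: rj; rewrite -val_eqE /= => rj.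
      rewrite eq_sym (negPf rj).
      by rewrite (_ : _ == _ = false) ?mulr0 ?subr0 //; lia.
    apply/colP => r; rewrite mxE [RHS]mxE.
    have rs : (r < blk_size (inr k : blk F))%N by have := ltn_ord r; rewrite /=; lia.
    rewrite -[RHS](eqC r rs) [blk_size _]/= (_ : (2 * k).-1 = (k + k.-1)%N); last by lia.
    transitivity (\sum_(j < k + k.-1) skew_of k k.-1 (fun i j => kron1 F i j - lam * kron2 F i j) r j * w j).
      by rewrite skew_of_sum_u //; apply: eq_bigr => j _; rewrite !mxE.
    by apply: eq_bigr => j _; rewrite /blkC /= skew_ofB.
  have io' : (i - o - k < k.-1)%N by move: lio; rewrite /=; lia.
  have /colP/(_ (Ordinal io')) := v0; rewrite !mxE /= => <-; congr w.
  by move: ki; lia.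
exfalso; have [emu|nmu] := eqVneq mu (Some lam); last first.
  (* No drop at [l = 1] means that this block of [C'] is invertible. *)
  have := @blk_syl_rank F lam (inl (mu, k)) 1 isT; cbv zeta.
  have -> : blk_drop lam (inl (mu, k)) 1 = 0%N.
    by rewrite /blk_drop; case: (mu) nmu => // mu' nmu; rewrite (negPf nmu).
  rewrite addn0 muln1 syl_rank1 => /eqP full.
  have {full} : mxf (2 * k) (2 * k) (blkC (inl (mu, k))) \in unitmx by rewrite -row_free_unit.
  move=> /mulKmx h; pose v : 'cV[F]_(2 * k) := \col_j w j.
  have v0 : v = 0.
    rewrite -[v]h (_ : _ *m v = 0) ?mulmx0 //; apply/colP => r; rewrite mxE [RHS]mxE.
    by rewrite -[RHS](eqC r (ltn_ord r)); apply: eq_bigr => j _; rewrite !mxE.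
  case/negP: wi; have /colP/(_ (Ordinal lio)) := v0.
  by rewrite !mxE /= => ->.
subst mu; have k0 : (0 < k)%N by have := blk_pos jb0 kb0 dso; rewrite /=; lia.
have km : (k <= m)%N.
  have : inl (Some lam, k) \in ds by case: dso => d1 [d2 [-> _]]; rewrite mem_cat mem_head orbT.
  rewrite mem_cat => /orP[/mapP[b bjb [eb]]|/mapP[]//].
  by have := jb_max bjb; rewrite -eb => ->.
have blkCE r j : blkC (inl (Some lam, k)) r j = skew_of k k (jordan_mx 0) r j.
  rewrite /blkC /= skew_ofB /skew_of /jordan_mx /id_mxf.
  have e p q : (if p == q then lam else if q == p.+1 then 1 else 0) - lam * (if p == q then 1 else 0)
     = (if p == q then 0 else if q == p.+1 then 1 else 0).
    by case: eqP => _; rewrite ?mulr1 ?subrr ?mulr0 ?subr0.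
  by rewrite !e.
have eqS r : (r < 2 * k)%N -> \sum_(j < k + k) skew_of k k (jordan_mx 0) r j * w j = 0.
  move=> rk; rewrite -[RHS](eqC r rk) [blk_size _]/= mul2n -addnn.
  by apply: eq_bigr => j _; rewrite blkCE.
have on := blk_at_size dso; rewrite /= in on.
have zo (j : 'I_n) : (B' *m z) j 0 = 0 -> (o <= j < o + 2 * k)%N ->
    \sum_(r < k + k) skew_of k k (@id_mxf F) (j - o) r * w r = 0.
  move=> + jo; rewrite (mulmx_bdiagf (@blkB F) z dso jo) => h; rewrite -[RHS]h.
  by rewrite [blk_size _]/= mul2n -addnn.
have oln : (o < n)%N by lia.
have ohn : (o + (k + k.-1) < n)%N by lia.
(* [echain] attains its top degree at the first position of the block, where [B' z] reads the
   coordinate [k] of [z]. *)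
have wk : w k = 0.
  have := zo (Ordinal oln) _ _; rewrite /= subnn skew_of_sum_u //.
  rewrite (@id_mxf_sum F k (fun j => w (k + j)%N) 0 k0) addn0; apply; last by lia.
  apply: (chain_coord_orth dso (echain_supp (k := k) (o := o)) (chain_echain dso km) (j0 := o)) => // j.
  rewrite /echain; case: ifP => jo; last by rewrite mulr0 coef0 (_ : _ == _ = false) //; move: jo; lia.
  by rewrite -exprD coefXn; congr (_%:R); move: jo km; rewrite /m; lia.
(* [fchain] attains its top degree at the last position, where [B' z] reads minus the coordinate
   [k - 1]. *)
have wk1 : w k.-1 = 0.
  have := zo (Ordinal ohn) _ _; rewrite /= addKn skew_of_sum_d ?id_mxf_sumT; [|lia|lia].
  move=> h; apply/eqP; rewrite -oppr_eq0; apply/eqP; apply: h; last by lia.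
  apply: (chain_coord_orth dso (fchain_supp (k := k) (o := o)) (chain_fchain dso km) (j0 := (o + (k + k.-1))%N)) => // j.
  rewrite /fchain; case: ifP => jo; last by rewrite mulr0 coef0 (_ : _ == _ = false) //; move: jo; lia.
  by rewrite -exprD coefXn; congr (_%:R); move: jo km; rewrite /m; lia.
case/negP: wi; apply/eqP; move: lio => /=.
have [ik|ki] := ltnP (i - o) k => lio.
  have [->//|ik1] := eqVneq (i - o)%N k.-1.
  have := eqS (k + (i - o).+1)%N; rewrite skew_of_sum_d ?jordan_mx0_sumT; [|lia|lia].
  by move=> h; apply/eqP; rewrite -oppr_eq0 h //; lia.
have [->//|ik1] := eqVneq (i - o)%N k.
have := eqS (i - o - k).-1; rewrite skew_of_sum_u; last by lia.
rewrite (jordan_mx0_sum k (fun j => w (k + j)%N)) ifT; last by lia.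
move=> h; rewrite -h; last by lia.
by congr w; lia.
Qed.
End Core.
End Coordinates.

(** * Kernel vectors of degree one *)

Section DegreeOne.
Variables (F : numClosedFieldType) (jb : seq (option F * nat)) (kb : seq nat).
Let ds := blks jb kb.
Let n := blks_size ds.
Hypothesis jb0 : all (fun b => 0 < b.2)%N jb.
Hypothesis kb0 : all (fun k => 0 < k)%N kb.
Hypothesis kb2 : count_mem 2%N kb = 0%N.
Hypothesis kb1 : (count_mem 1%N kb <= 1)%N.
Let A' : 'M[F]_n := mxf n n (bdiagf (@blkA F) ds).
Let B' : 'M[F]_n := mxf n n (bdiagf (@blkB F) ds).
Variables (z0 z1 : 'cV[F]_n).
Hypothesis A0 : A' *m z0 = 0.
Hypothesis AB : A' *m z1 + B' *m z0 = 0.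
Hypothesis B1 : B' *m z1 = 0.

Section Local.
Variables (d : blk F) (o : nat).
Hypothesis dso : blk_at ds d o.
Let w0 j := mxext z0 (o + j) 0.
Let w1 j := mxext z1 (o + j) 0.

Lemma local_A0 r : (r < blk_size d)%N -> \sum_(j < blk_size d) blkA d r j * w0 j = 0.
Proof. exact: (bdiagf_mulz dso A0). Qed.

Lemma local_B1 r : (r < blk_size d)%N -> \sum_(j < blk_size d) blkB d r j * w1 j = 0.
Proof. exact: (bdiagf_mulz dso B1). Qed.

Lemma local_AB r : (r < blk_size d)%N ->
  \sum_(j < blk_size d) blkA d r j * w1 j + \sum_(j < blk_size d) blkB d r j * w0 j = 0.
Proof.
move=> rd; have orn : (o + r < n)%N.
  by apply: leq_trans (blk_at_size dso); rewrite ltn_add2l.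
have /matrixP/(_ (Ordinal orn) 0) := AB; rewrite mxE.
rewrite (mulmx_bdiagf _ z1 dso) /= ?leq_addr ?ltn_add2l //.
by rewrite (mulmx_bdiagf _ z0 dso) /= ?leq_addr ?ltn_add2l // addKn mxE.
Qed.
End Local.

Lemma skew_id_inj k (w : nat -> F) :
  (forall r, (r < 2 * k)%N -> \sum_(j < 2 * k) skew_of k k (@id_mxf F) r j * w j = 0) ->
  forall j, (j < 2 * k)%N -> w j = 0.
Proof.
move=> h j jk; have {}h r : (r < k + k)%N -> \sum_(j < k + k) skew_of k k (@id_mxf F) r j * w j = 0.
  by rewrite addnn -mul2n; exact: h.
have [lt_jk|le_kj] := ltnP j k.
  have := h (k + j)%N; rewrite skew_of_sum_d // id_mxf_sumT // => e.
  by apply/eqP; rewrite -oppr_eq0 e // ltn_add2l.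
have jk' : (j - k < k)%N by lia.
have := h (j - k)%N; rewrite skew_of_sum_u //.
rewrite (@id_mxf_sum F k (fun j => w (k + j)%N) _ jk') subnKC // => -> //; lia.
Qed.

(** The hypotheses say that [A' + s B'] kills [z0 + s z1] identically in [s]. On a Jordan block [A']
    or [B'] is invertible and both vectors vanish; a nonzero polynomial kernel vector of a Kronecker
    block has degree at least [k - 1], so [k] is at most 2, and 2 is excluded. *)
Lemma degree_one_block d o i : blk_at ds d o -> (o <= i < o + blk_size d)%N ->
  mxext z0 i 0 != 0 \/ mxext z1 i 0 != 0 -> d = inr 1%N /\ i = o.
Proof.
move=> dso io nz; pose w0 j := mxext z0 (o + j) 0; pose w1 j := mxext z1 (o + j) 0.
have lio : (i - o < blk_size d)%N by move: io; lia.
have {}nz : w0 (i - o)%N != 0 \/ w1 (i - o)%N != 0.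
  by rewrite /w0 /w1 subnKC //; case/andP: io.
suff : (forall j, (j < blk_size d)%N -> w0 j = 0 /\ w1 j = 0) \/ d = inr 1%N.
  case=> [h|ed]; first by have [e0 e1] := h _ lio; case: nz; rewrite ?e0 ?e1 eqxx.
  by split=> //; move: io; rewrite ed /=; lia.
have eA0 r : (r < blk_size d)%N -> \sum_(j < blk_size d) blkA d r j * w0 j = 0.
  exact: local_A0.
have eB1 r : (r < blk_size d)%N -> \sum_(j < blk_size d) blkB d r j * w1 j = 0.
  exact: local_B1.
have eAB r : (r < blk_size d)%N ->
    \sum_(j < blk_size d) blkA d r j * w1 j + \sum_(j < blk_size d) blkB d r j * w0 j = 0.
  exact: local_AB.
case: d dso {io} lio eA0 eB1 eAB => [[[mu|] k]|k] dso lio eA0 eB1 eAB.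
- left; have h1 := @skew_id_inj k w1 eB1.
  suff h0 : forall j, (j < 2 * k)%N -> w0 j = 0 by move=> j jk; rewrite h0 ?h1.
  apply: skew_id_inj => r rk; have := eAB r rk.
  by rewrite big1 ?add0r // => j _; rewrite h1 ?mulr0.
- left; have h0 := @skew_id_inj k w0 eA0.
  suff h1 : forall j, (j < 2 * k)%N -> w1 j = 0 by move=> j jk; rewrite h0 ?h1.
  apply: skew_id_inj => r rk; have := eAB r rk.
  by rewrite [X in _ + X]big1 ?addr0 // => j _; rewrite h0 ?mulr0.
- have k0 : (0 < k)%N by have := blk_pos jb0 kb0 dso; rewrite /=; lia.
  have [k1|k1] := eqVneq k 1%N; first by right; rewrite k1.
  left; have k2 : k != 2%N.
    apply: contra_eq_neq kb2 => ek; rewrite -lt0n -has_count has_pred1 -ek.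
    have : inr k \in ds by case: dso => d1 [d2 [-> _]]; rewrite mem_cat mem_head orbT.
    by rewrite mem_cat => /orP[/mapP[]//|/mapP[k' kk [->]]].
  have k3 : (2 < k)%N by lia.
  have es : (2 * k).-1 = (k + k.-1)%N by lia.
  rewrite /= es in eA0 eB1 eAB *.
  have uA (w : nat -> F) r : (r < k.-1)%N ->
      \sum_(j < k + k.-1) skew_of k k.-1 (@kron1 F) r j * w j = w (k + r)%N.
    move=> rk; rewrite skew_of_sum_u; last by lia.
    exact: (@id_mxf_sum F k.-1 (fun j => w (k + j)%N)).
  have dA (w : nat -> F) r : (r < k.-1)%N ->
      \sum_(j < k + k.-1) skew_of k k.-1 (@kron1 F) (k + r) j * w j = - w r.
    by move=> rk; rewrite skew_of_sum_d // id_mxf_sumT //; lia.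
  have uB (w : nat -> F) r : (r < k.-1)%N ->
      \sum_(j < k + k.-1) skew_of k k.-1 (@kron2 F) r.+1 j * w j = w (k + r)%N.
    move=> rk; rewrite skew_of_sum_u; last by lia.
    exact: (@id_mxf_sum F k.-1 (fun j => w (k + j)%N)).
  have dB (w : nat -> F) r : (r < k.-1)%N ->
      \sum_(j < k + k.-1) skew_of k k.-1 (@kron2 F) (k + r) j * w j = - w r.+1.
    move=> rk; rewrite skew_of_sum_d //; congr (- _).
    rewrite -(@id_mxf_sumT F k w r.+1); last by lia.
    by apply: eq_bigr => j _.
  have lo0 r : (r < k.-1)%N -> w0 r = 0.
    move=> rk; have := eA0 (k + r)%N; rewrite dA // => e.
    by apply/eqP; rewrite -oppr_eq0 e // ltn_add2l.
  have hi0 r : (r < k.-1)%N -> w0 (k + r)%N = 0.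
    by move=> rk; rewrite -uA // eA0 //; lia.
  have lo1 r : (r < k.-1)%N -> w1 r.+1 = 0.
    move=> rk; have := eB1 (k + r)%N; rewrite dB // => e.
    by apply/eqP; rewrite -oppr_eq0 e // ltn_add2l.
  have hi1 r : (r < k.-1)%N -> w1 (k + r)%N = 0.
    by move=> rk; rewrite -uB // eB1 //; lia.
  have mid r : (r < k.-1)%N -> w1 r + w0 r.+1 = 0.
    move=> rk; have := eAB (k + r)%N; rewrite dA // dB // -opprD => e.
    by apply/eqP; rewrite -oppr_eq0 e // ltn_add2l.
  (* The end entries [w1 0] and [w0 k.-1] are tied by [mid] to [w0 1] and [w1 (k - 2)], which vanish
     because [2 < k]; for [k = 2] they would only be tied to each other. *)
  have w10 : w1 0%N = 0 by have := mid 0%N; rewrite lo0 ?addr0 => [->//|]; lia.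
  have w0k : w0 k.-1 = 0.
    have [e1 e2] : (k - 2 = (k - 3).+1 /\ (k - 2).+1 = k.-1)%N by lia.
    have := mid (k - 2)%N; rewrite e2 e1 lo1 ?add0r => [->//|]; lia.
  move=> j jk; have [lt_jk|le_kj] := ltnP j k.
    split; first by have [->//|jk1] := eqVneq j k.-1; apply: lo0; lia.
    by case: j lt_jk {jk} => // j jk; apply: lo1; lia.
  have ej : j = (k + (j - k))%N by rewrite subnKC.
  by rewrite ej hi0 ?hi1 //; lia.
Qed.

Lemma degree_one_kernel : exists j0 : nat, forall j : 'I_n,
  z0 j 0 != 0 \/ z1 j 0 != 0 -> j = j0 :> nat.
Proof.
have [[j nzj]|nz] := pselect (exists j : 'I_n, z0 j 0 != 0 \/ z1 j 0 != 0); last first.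
  by exists 0%N => j nzj; case: nz; exists j.
exists j => j' nzj'.
have pos (i : 'I_n) : z0 i 0 != 0 \/ z1 i 0 != 0 -> blk_at ds (inr 1%N) i.
  rewrite -(mxextE z0 i 0) -(mxextE z1 i 0) => nzi.
  have [d [o [dso io]]] := blk_at_cover (ltn_ord i).
  by have [ed ->] := degree_one_block dso io nzi; rewrite -ed.
apply: (count_mem_blk_at (d := inr 1%N) _ (pos _ nzj') (pos _ nzj)).
by rewrite /ds /blks count_cat !count_map (eq_count (a2 := pred0)) ?count_pred0 //.
Qed.
End DegreeOne.

(** * The bound *)

Section CorePositions.
Variable F : fieldType.

(* Positions of the upper halves of the Kronecker blocks. *)
Fixpoint core_pos (o : nat) (ds : seq (blk F)) : seq nat :=
  match ds with
  | [::] => [::]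
  | d :: ds' => (if d is inr k then iota o k else [::]) ++ core_pos (o + blk_size d) ds'
  end.

Lemma size_core_pos o jb kb : size (core_pos o (blks jb kb)) = sumn kb.
Proof.
rewrite /blks; elim: jb o => [|b jb IH] o /=; last exact: IH.
by elim: kb o => //= k kb IH o; rewrite size_cat size_iota IH.
Qed.

Lemma mem_core_pos p ds k o i : blk_at ds (inr k) o -> (o <= i < o + k)%N ->
  (p + i)%N \in core_pos p ds.
Proof.
move=> [d1 [d2 [-> ->]]]; elim: d1 p i => [|d d1 IH] p i.
  by move=> io; rewrite /= mem_cat mem_iota; move: io; rewrite /blks_size /=; lia.
rewrite /blks_size /= -/(blks_size d1) => io; rewrite mem_cat.
have -> : (p + i = p + blk_size d + (i - blk_size d))%N by move: io; lia.
by rewrite IH ?orbT //; move: io; lia.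
Qed.

Lemma rank_support (r n : nat) (pos : seq nat) (Z : 'M[F]_(r, n)) :
  (forall i j, Z i j != 0 -> (j : nat) \in pos) -> (\rank Z <= size pos)%N.
Proof.
move=> Zpos.
pose W : 'M[F]_(r, size pos) := \matrix_(i, k) mxext Z i (nth 0%N pos k).
pose E : 'M[F]_(size pos, n) := \matrix_(k, j) (index (j : nat) pos == k)%:R.
have -> : Z = W *m E.
  apply/matrixP => i j; rewrite mxE; have [jp|jp] := boolP ((j : nat) \in pos).
    have kp : (index (j : nat) pos < size pos)%N by rewrite index_mem.
    rewrite (bigD1 (Ordinal kp)) //= big1 => [|k nk].
      by rewrite !mxE /= eqxx mulr1 addr0 nth_index // mxextE.
    rewrite !mxE (_ : (_ == _) = false) ?mulr0 //.
    by apply: contra_neqF nk => /eqP e; exact: val_inj.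
  rewrite big1 => [|k _]; first by apply/eqP/negPn; apply: contra jp => /Zpos.
  by rewrite !mxE memNindex // gtn_eqF ?mulr0.
exact: leq_trans (mxrankM_maxr _ _) (rank_leq_row _).
Qed.
End CorePositions.

Lemma core_of_JK (F : numClosedFieldType) (n : nat) (c : 'I_n -> 'I_n -> 'I_n -> F)
    (x a : 'rV[F]_n) jb kb (P : 'M[F]_n) lam (xi : 'cV[F]_n) m' :
  let ds := blks jb kb in
  n = blks_size ds -> lie_structure c ->
  all (fun b => 0 < b.2)%N jb -> all (fun k => 0 < k)%N kb -> P \in unitmx ->
  P^T *m form_of c x *m P = mxf n n (bdiagf (@blkA F) ds) ->
  P^T *m form_of c a *m P = mxf n n (bdiagf (@blkB F) ds) ->
  (a *m xi) 0 0 = 1 ->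
  (forall w : 'rV[F]_n, (w *m xi) 0 0 = 0 ->
    exists2 g : {poly F}, g != 0 & forall s, g.[s] != 0 ->
      (syl_rank (form_of c (x - lam *: a) + s *: form_of c w)%R (form_of c a) m'.+1 <=
       syl_rank (form_of c (x - lam *: a)) (form_of c a) m'.+1)%N) ->
  (forall b, b \in jb -> b.1 = Some lam -> (b.2 <= m'.+1)%N) ->
  (2 <= count_mem (Some lam, m'.+1) jb)%N ->
  form_of c (x - lam *: a) *m xi = 0 /\
  forall i, (invmx P *m xi) i 0 != 0 -> (i : nat) \in core_pos 0 ds.
Proof.
move=> ds en Lie jb0 kb0 Pu PA PB axi rk jmax jtwo; subst n; split.
  exact: (core_kernel Lie jb0 kb0 Pu PA PB axi rk jtwo).
move=> i zi; have [k [o [dso io]]] := core_support Lie jb0 kb0 Pu PA PB axi rk jmax jtwo zi.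
by have := mem_core_pos 0 dso io; rewrite add0n.
Qed.

(** In the canonical basis both vectors live on at most one coordinate, that of the only 1x1 block,
    so they are proportional; [al] and [be] are their entries there. *)
Lemma degree_one_kernel_JK (F : numClosedFieldType) (n : nat) (A B : 'M[F]_n) jb kb
    (u0 u1 : 'cV[F]_n) :
  has_JK_form A B jb kb -> count_mem 2%N kb = 0%N -> (count_mem 1%N kb <= 1)%N ->
  A *m u0 = 0 -> A *m u1 + B *m u0 = 0 -> B *m u1 = 0 ->
  exists al be, [/\ be *: u0 = al *: u1 & al = 0 -> be = 0 -> u0 = 0 /\ u1 = 0].
Proof.
case=> jb0 kb0; rewrite blocksA_size blocksAE blocksBE => en [P [Pu PA PB]] kb2 kb1.
subst n => Au0 AB Bu1; set n := blks_size _ in A B u0 u1 P Pu PA PB Au0 AB Bu1 *.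
have tr (M : 'M[F]_n) u : P^T *m M *m P *m (invmx P *m u) = P^T *m (M *m u).
  by rewrite -!mulmxA mulKVmx.
have := @degree_one_kernel F jb kb jb0 kb0 kb2 kb1 (invmx P *m u0) (invmx P *m u1).
rewrite /mxf in PA PB *; rewrite -PA -PB !tr Au0 Bu1 -mulmxDr AB !mulmx0.
move=> /(_ erefl erefl erefl)[j0 hj0].
pose z0 := invmx P *m u0; pose z1 := invmx P *m u1.
have zval (z : 'cV[F]_n) (j : 'I_n) : j = j0 :> nat -> z j 0 = mxext z j0 0.
  by move=> <-; rewrite (mxextE z j 0).
have zoff (j : 'I_n) : j <> j0 :> nat -> z0 j 0 = 0 /\ z1 j 0 = 0.
  move=> nj; split; apply/eqP/negPn/negP => nz; apply: nj; apply: hj0; by [left|right].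
have [u0E u1E] : u0 = P *m z0 /\ u1 = P *m z1 by rewrite !mulKVmx.
clearbody z0 z1; exists (mxext z0 j0 0), (mxext z1 j0 0); rewrite u0E u1E.
split=> [|al0 be0].
  rewrite !scalemxAr; congr (_ *m _); apply/colP => j; rewrite !mxE.
  have [jj|/eqP/zoff[-> ->]] := eqVneq (j : nat) j0; last by rewrite !mulr0.
  by rewrite !(zval _ j jj) mulrC.
suff [-> ->] : z0 = 0 /\ z1 = 0 by rewrite !mulmx0.
by split; apply/colP => j; rewrite [RHS]mxE;
  have [jj|/eqP/zoff[e0 e1]] := eqVneq (j : nat) j0; rewrite ?(zval _ j jj).
Qed.

Section Bound.
Variables (F : numClosedFieldType) (n : nat) (c : 'I_n -> 'I_n -> 'I_n -> F).
Variables (K : seq nat) (T : seq (seq nat)) (p : {mpoly F[n + n]}).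
Hypothesis Lie : lie_structure c.
Hypothesis p0 : p != 0.
Hypothesis JKp : forall x a : 'rV[F]_n, p.@[pt x a] != 0 ->
  exists jb kb, [/\ has_JK_form (form_of c x) (form_of c a) jb kb,
                    perm_eq kb K & perm_eq (jordan_tuples jb) T].
Hypothesis K2 : count_mem 2%N K = 0%N.
Hypothesis K1 : (count_mem 1%N K <= 1)%N.

Definition um_tuples := [seq t <- T | multiple_maxima t && unique_tuple T t].

Lemma um_tuplesP t : t \in um_tuples ->
  [/\ t \in T, t != [::], multiple_maxima t & count_mem t T = 1%N].
Proof.
rewrite mem_filter => /andP[/andP[mt ut] tT]; split=> //; last exact/eqP.
by case/andP: mt; case: t {ut tT}.
Qed.

Lemma um_tuples_uniq : uniq um_tuples.
Proof.
apply: count_mem_uniq => t; have [tu|/count_memPn //] := boolP (t \in um_tuples).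
have [_ _ _ t1] := um_tuplesP tu; apply/eqP; rewrite eqn_leq; apply/andP; split.
  by rewrite count_filter; apply: leq_trans (eq_leq t1); apply: sub_count => u /andP[].
by rewrite -has_count has_pred1.
Qed.

Definition eigen_form (q : {mpoly F[n + n]}) (a : 'rV[F]_n) (t : seq nat) (xi : 'cV[F]_n) :=
  (a *m xi) 0 0 = 1 /\
  forall x, q.@[pt x a] != 0 -> p.@[pt x a] != 0 /\
    has_profile (size K) t (form_of c x) (form_of c a) ((x *m xi) 0 0).

(** The vectors of different tuples are compared at a common [a], so a single [q], a product over
    the tuples, must serve all of them. *)
Lemma eigen_forms : exists2 q : {mpoly F[n + n]}, q != 0 & forall a x0, q.@[pt x0 a] != 0 ->
  exists xi : seq nat -> 'cV[F]_n, forall t, t \in um_tuples -> eigen_form q a t (xi t).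
Proof.
suff [q q0 h] : exists2 q : {mpoly F[n + n]}, q != 0 & forall a x0, q.@[pt x0 a] != 0 ->
    forall t, t \in um_tuples -> exists xi, eigen_form q a t xi.
  exists q => // a x0 qx0.
  have /choice[xi hxi] : forall t, exists xi, t \in um_tuples -> eigen_form q a t xi.
    move=> t; have [tu|_] := boolP (t \in um_tuples); last by exists 0.
    by have [xi e] := h a x0 qx0 t tu; exists xi.
  by exists xi.
have : {subset um_tuples <= um_tuples} by [].
elim: {1 3}um_tuples => [|t s IH] sub; first by exists 1; rewrite ?oner_neq0.
have [u us|q1 q10 h1] := IH; first by apply: sub; rewrite inE us orbT.
have [tT t0 _ t1] := um_tuplesP (sub t (mem_head _ _)).
have [q2 q20 h2] := unique_tuple_linear p0 JKp tT t0 t1.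
exists (q1 * q2) => [|a x0]; first by rewrite mulf_neq0.
rewrite mevalM mulf_eq0 negb_or => /andP[q1x q2x] u.
rewrite inE => /predU1P[->|us].
  have [xi axi hx] := h2 a x0 q2x; exists xi; split=> // x.
  by rewrite mevalM mulf_eq0 negb_or => /andP[_]; exact: hx.
have [xi [axi hx]] := h1 a x0 q1x u us; exists xi; split=> // x.
by rewrite mevalM mulf_eq0 negb_or => /andP[+ _]; exact: hx.
Qed.

Section Fixed.
Variables (q : {mpoly F[n + n]}) (a x0 : 'rV[F]_n) (xi : seq nat -> 'cV[F]_n).
Hypothesis qx0 : q.@[pt x0 a] != 0.
Hypothesis xiP : forall t, t \in um_tuples -> eigen_form q a t (xi t).

Lemma um_line_neq0 x w : q.@[pt x a] != 0 -> line_mpoly x w a q != 0.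
Proof.
move=> qx; apply: contra_neq qx => e; have := line_mpolyE x w a q 0.
by rewrite e horner0 scale0r addr0.
Qed.

Lemma um_eigenvalue t x jb kb : t \in um_tuples -> q.@[pt x a] != 0 ->
  has_JK_form (form_of c x) (form_of c a) jb kb -> perm_eq kb K ->
  perm_eq (jordan_tuples jb) T ->
  sort geq [seq b.2 | b <- jb & b.1 == Some ((x *m xi t) 0 0)] = t.
Proof.
move=> tu qx JK /perm_size skb jT; have [tT _ _ _] := um_tuplesP tu.
have [_ /(_ x qx)[_ prof]] := xiP tu; rewrite -(perm_mem jT) in tT.
have [st tn] := jordan_tuples_sorted JK tT.
by apply: (profile_tuple JK st tn); rewrite skb.
Qed.

(** As [w] kills [xi t], moving [x] along [w] keeps the eigenvalue; where [q] does not vanish the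
    profile holds at both points and fixes the rank. *)
Lemma um_rank_const t x m' : t \in um_tuples -> q.@[pt x a] != 0 -> (m'.+1 <= n)%N ->
  forall w : 'rV[F]_n, (w *m xi t) 0 0 = 0 ->
  exists2 g : {poly F}, g != 0 & forall s, g.[s] != 0 ->
    (syl_rank (form_of c (x - (x *m xi t) 0 0 *: a) + s *: form_of c w)%R (form_of c a) m'.+1 <=
     syl_rank (form_of c (x - (x *m xi t) 0 0 *: a)%R) (form_of c a) m'.+1)%N.
Proof.
move=> tu qx mn w wxi; have [_ hx] := xiP tu.
exists (line_mpoly x w a q); first exact: um_line_neq0.
move=> s; rewrite line_mpolyE => qxs.
have [_ /(_ _ mn) e1] := hx _ qxs; have [_ /(_ _ mn) e2] := hx _ qx.
have lamE : ((x + s *: w) *m xi t) 0 0 = (x *m xi t) 0 0.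
  by rewrite mulmxDl -scalemxAl; move: (x *m _) (w *m _) wxi => M N e; rewrite !mxE e mulr0 addr0.
rewrite lamE form_ofD form_ofZ in e1; rewrite form_ofB form_ofZ addrAC.
by move/eqP: e1; rewrite -e2 !eqn_add2r => /eqP ->.
Qed.

Lemma um_max t : t \in um_tuples -> sorted geq t ->
  [/\ forall k, k \in t -> (k <= head 0%N t)%N & (2 <= count_mem (head 0%N t) t)%N].
Proof.
move=> tu; have [_ _ mt _] := um_tuplesP tu; case: t mt {tu} => [|k [|l t]] //=.
move=> /andP[_ /eqP /= <-] /andP[_ pt']; split; last by rewrite !eqxx.
have geq_trans : transitive geq by move=> y x z /= yx zy; exact: leq_trans zy yx.
move=> j; rewrite !inE => /or3P[/eqP->|/eqP->|jt] //.
exact: (allP (order_path_min geq_trans pt')).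
Qed.

Lemma um_core t x jb kb : t \in um_tuples -> q.@[pt x a] != 0 ->
  has_JK_form (form_of c x) (form_of c a) jb kb -> perm_eq kb K ->
  perm_eq (jordan_tuples jb) T ->
  form_of c (x - (x *m xi t) 0 0 *: a) *m xi t = 0 /\
  forall P, P \in unitmx ->
    P^T *m form_of c x *m P = \matrix_(i, j) bdiag (blocksA jb kb) i j ->
    P^T *m form_of c a *m P = \matrix_(i, j) bdiag (blocksB jb kb) i j ->
    forall i, (invmx P *m xi t) i 0 != 0 -> (i : nat) \in core_pos 0 (blks jb kb).
Proof.
move=> tu qx JK kK jT; have st := um_eigenvalue tu qx JK kK jT.
have [tT _ _ _] := um_tuplesP tu; rewrite -(perm_mem jT) in tT.
have [sot tn] := jordan_tuples_sorted JK tT; have [tmax ttwo] := um_max tu sot.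
set m := head 0%N t in tmax ttwo; set lam := (x *m xi t) 0 0 in st *.
have mt : m \in t by rewrite -has_pred1 has_count (leq_trans _ ttwo).
have /andP[m0 mn] := allP tn _ mt.
have mem_t k : (k \in t) = (k \in [seq b.2 | b <- jb & b.1 == Some lam]).
  by rewrite -{1}st mem_sort.
have jb_max b : b \in jb -> b.1 = Some lam -> (b.2 <= m.-1.+1)%N.
  move=> bjb b1; rewrite prednK //; apply: tmax; rewrite mem_t.
  by apply: map_f; rewrite mem_filter b1 eqxx.
have jb_two : (2 <= count_mem (Some lam, m.-1.+1) jb)%N.
  rewrite prednK // (leq_trans ttwo) // -{1}st (permP (permEl (perm_sort _ _))).
  rewrite count_map count_filter; apply: sub_count => -[mu k] /= /andP[/eqP -> /eqP ->].
  exact: eqxx.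
have mn' : (m.-1.+1 <= n)%N by rewrite prednK.
have rk := um_rank_const tu qx mn'.
have [axi _] := xiP tu.
case: JK => jb0 kb0; rewrite blocksA_size !blocksAE !blocksBE => en [P0 [P0u P0A P0B]].
split; first by have [] := core_of_JK en Lie jb0 kb0 P0u P0A P0B axi rk jb_max jb_two.
move=> P Pu PA PB.
by have [] := core_of_JK en Lie jb0 kb0 Pu PA PB axi rk jb_max jb_two.
Qed.

(* [xi t] is a common eigenvector of the adjoint action, with character
   [form_of c a *m xi t]. *)
Lemma um_character t z : t \in um_tuples ->
  form_of c z *m xi t = (z *m xi t) 0 0 *: (form_of c a *m xi t).
Proof.
move=> tu; have [_ hx] := xiP tu.
have core x : q.@[pt x a] != 0 ->
    form_of c x *m xi t = (x *m xi t) 0 0 *: (form_of c a *m xi t).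
  move=> qx; have [px _] := hx x qx; have [jb [kb [JK kK jT]]] := JKp px.
  have [+ _] := um_core tu qx JK kK jT.
  rewrite form_ofB form_ofZ mulmxBl -scalemxAl => /eqP.
  by rewrite subr_eq0 => /eqP.
(* The identity is known only where [q] does not vanish; being linear in [x], it follows for [z]
   from its instances at [x0] and [x0 + s z]. *)
have : line_mpoly x0 z a q * 'X != 0.
  by rewrite mulf_neq0 ?polyX_eq0 // um_line_neq0.
case/poly_nonroot => s; rewrite hornerM hornerX mulf_eq0 negb_or line_mpolyE => /andP[qs s0].
have := core _ qs; rewrite form_ofD form_ofZ !mulmxDl -!scalemxAl core //.
have -> : (x0 *m xi t + s *: (z *m xi t)) 0 0 = (x0 *m xi t) 0 0 + s * (z *m xi t) 0 0.
  by move: (x0 *m _) (z *m _) => M N; rewrite !mxE.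
by rewrite scalerDl -scalerA => /addrI/(scalerI s0).
Qed.

Lemma um_character_inj t t' : t \in um_tuples -> t' \in um_tuples ->
  form_of c a *m xi t = form_of c a *m xi t' -> t = t'.
Proof.
move=> tu tu' echi; have [axi hx] := xiP tu; have [axi' _] := xiP tu'.
have [px _] := hx x0 qx0; have [jb [kb [JK kK jT]]] := JKp px.
have st := um_eigenvalue tu qx0 JK kK jT; have st' := um_eigenvalue tu' qx0 JK kK jT.
set l := (x0 *m xi t) 0 0 in st; set l' := (x0 *m xi t') 0 0 in st'.
have [ll|nll] := eqVneq l l'; first by rewrite -st -st' ll.
(* On the line [z = x0 + s a] the two eigenvalues are [l + s] and [l' + s], so
   [xi'(z) xi - xi(z) xi'] is [u0 + s u1]. *)
exfalso; pose u0 := l' *: xi t - l *: xi t'; pose u1 := xi t - xi t'.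
have ch z := um_character z tu; have ch' z := um_character z tu'.
have kb2 : count_mem 2%N kb = 0%N by rewrite (seq.permP kK).
have kb1 : (count_mem 1%N kb <= 1)%N by rewrite (seq.permP kK).
have Au0 : form_of c x0 *m u0 = 0.
  by rewrite mulmxBr -!scalemxAr ch ch' -/l -/l' echi !scalerA mulrC subrr.
have AB : form_of c x0 *m u1 + form_of c a *m u0 = 0.
  rewrite !mulmxBr -!scalemxAr ch ch' -/l -/l' echi -!scalerBl -scalerDl.
  by rewrite addrA subrK subrr scale0r.
have Bu1 : form_of c a *m u1 = 0 by rewrite mulmxBr echi subrr.
have [al [be [ab ab0]]] := degree_one_kernel_JK JK kb2 kb1 Au0 AB Bu1.
have pair (z : 'rV[F]_n) (k k' : F) : (z *m (k *: xi t - k' *: xi t')) 0 0 =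
    k * (z *m xi t) 0 0 - k' * (z *m xi t') 0 0.
  by rewrite mulmxBr -!scalemxAr; move: (z *m _) (z *m _) => M N; rewrite !mxE.
have u1E : u1 = 1 *: xi t - 1 *: xi t' by rewrite !scale1r.
have sc (z : 'rV[F]_n) (k : F) (u : 'cV[F]_n) : (z *m (k *: u)) 0 0 = k * (z *m u) 0 0.
  by rewrite -scalemxAr; move: (z *m _) => M; rewrite !mxE.
have x0u0 : (x0 *m u0) 0 0 = 0 by rewrite pair -/l -/l' mulrC subrr.
have x0u1 : (x0 *m u1) 0 0 = l - l' by rewrite u1E pair !mul1r.
have au0 : (a *m u0) 0 0 = l' - l by rewrite pair axi axi' !mulr1.
have au1 : (a *m u1) 0 0 = 0 by rewrite u1E pair axi axi' subrr.
(* [x0] kills [u0] but not [u1], and [a] kills [u1] but not [u0]; proportionality then forces both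
   factors to vanish. *)
have al0 : al = 0.
  have := congr1 (fun u => (x0 *m u) 0 0) ab; rewrite !sc x0u0 x0u1 mulr0 => /esym/eqP.
  by rewrite mulf_eq0 subr_eq0 (negPf nll) orbF => /eqP.
have be0 : be = 0.
  have := congr1 (fun u => (a *m u) 0 0) ab; rewrite !sc au0 au1 mulr0 => /eqP.
  by rewrite mulf_eq0 subr_eq0 (eq_sym l') (negPf nll) orbF => /eqP.
have [_ u10] := ab0 al0 be0; move: x0u1; rewrite u10 mulmx0 mxE => /esym/eqP.
by rewrite subr_eq0 (negPf nll).
Qed.

Lemma um_free (s : seq (seq nat)) (k : seq nat -> F) : uniq s ->
  {subset s <= um_tuples} -> \sum_(t <- s) k t *: xi t = 0 ->
  forall t, t \in s -> k t = 0.
Proof.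
elim: s k => // t0 s IH k /= /andP[t0s us] sub.
have su : {subset s <= um_tuples} by move=> t ts; apply: sub; rewrite inE ts orbT.
have t0u := sub t0 (mem_head _ _); move=> sum0.
pose chi t := form_of c a *m xi t.
(* The adjoint action of the basis vector [i] on the relation: by [um_character], entry [i] of the
   form of the covector [j] applied to [xi t] is [chi t i] times entry [j] of [xi t]. *)
have chi0 i : \sum_(t <- t0 :: s) (k t * chi t i 0) *: xi t = 0.
  apply/matrixP => j j'; rewrite ord1 {j'} [RHS]mxE summxE.
  have := congr1 (fun u => (form_of c (delta_mx 0 j) *m u) i 0) sum0.
  rewrite mulmx0 [RHS]mxE mulmx_sumr summxE => h; rewrite -[RHS]h big_seq [RHS]big_seq.
  apply: eq_bigr => t /sub tu; rewrite -scalemxAr (um_character _ tu) -rowE.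
  by rewrite -/(chi t); move: (chi t) => M; rewrite !mxE; ring.
have ks t : t \in s -> k t = 0.
  move=> ts; have [i ci] : exists i, chi t i 0 != chi t0 i 0.
    apply/existsP; rewrite -negb_forall; apply/negP => /forallP e.
    case/negP: t0s; rewrite -(um_character_inj (su t ts) t0u) //.
    by apply/colP => i; apply/eqP.
  (* Subtracting [chi t0 i] times the relation eliminates [t0]; the index [i] is chosen where the
     characters of [t] and [t0] differ. *)
  have := IH (fun t => k t * (chi t i 0 - chi t0 i 0)) us su _ t ts.
  move=> h; apply/eqP; have : k t * (chi t i 0 - chi t0 i 0) == 0.
    apply/eqP; apply: h; have := chi0 i; have := sum0; rewrite !big_cons => e1 e2.
    transitivity (\sum_(t <- s) (k t * chi t i 0) *: xi t - chi t0 i 0 *: \sum_(t <- s) k t *: xi t).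
      rewrite scaler_sumr -sumrB; apply: eq_bigr => u _.
      by rewrite scalerA -scalerBl mulrBr [chi t0 i 0 * _]mulrC.
    have -> : \sum_(t <- s) k t *: xi t = - (k t0 *: xi t0) by apply/eqP; rewrite -addr_eq0 addrC e1.
    rewrite scalerN opprK scalerA [chi t0 i 0 * _]mulrC addrC //.
  by rewrite mulf_eq0 subr_eq0 (negPf ci) orbF.
move=> t; rewrite inE => /predU1P[->|/ks//].
move: sum0; rewrite big_cons big_seq big1 ?addr0 => [|u us']; last by rewrite ks ?scale0r.
have [axi _] := xiP t0u; move=> /(congr1 (fun u => (a *m u) 0 0)).
by rewrite -scalemxAr mulmx0 mxE axi mulr1 mxE.
Qed.

Lemma um_bound_fixed : (size um_tuples <= sumn K)%N.
Proof.
have [um0|[t0 t0u]] : um_tuples = [::] \/ exists t, t \in um_tuples.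
- by case: um_tuples => [|t s]; [left|right; exists t; rewrite mem_head].
- by rewrite um0.
have [_ hx] := xiP t0u; have [px _] := hx x0 qx0; have [jb [kb [JK kK jT]]] := JKp px.
have [jb0 kb0 en [P [Pu PA PB]]] := JK.
(* The rows are the vectors [xi t] in the canonical basis. All of them use the same [x0] and the
   same [P], hence the same [sumn K] admissible positions. *)
pose Z : 'M[F]_(size um_tuples, n) :=
  \matrix_(r, j) (invmx P *m xi (nth [::] um_tuples r)) j 0.
have Zfree : row_free Z.
  rewrite -kermx_eq0; apply/rowV0P => k /sub_kermxP kZ.
  have sum0 : \sum_(t <- um_tuples) mxext k 0 (index t um_tuples) *: xi t = 0.
    have e : P *m (k *m Z)^T = 0 by rewrite kZ trmx0 mulmx0.
    rewrite (big_nth [::]) big_mkord -[RHS]e.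
    rewrite mulmx_sum_row linear_sum mulmx_sumr; apply: eq_bigr => r _.
    rewrite index_uniq ?um_tuples_uniq // (mxextE k 0 r) linearZ -scalemxAr; congr (_ *: _).
    rewrite -[LHS](mulKVmx Pu); congr (_ *m _); apply/colP => j.
    by rewrite [RHS]mxE [RHS]mxE [RHS]mxE.
  apply/rowP => r; rewrite [RHS]mxE.
  have := um_free um_tuples_uniq (fun _ h => h) sum0 (mem_nth [::] (ltn_ord r)).
  by rewrite index_uniq ?um_tuples_uniq // (mxextE k 0 r).
rewrite -(eqP Zfree) -(perm_sumn kK) -(size_core_pos 0 jb kb).
apply: rank_support => r j; rewrite mxE.
have tu := mem_nth [::] (ltn_ord r).
by have [_ h] := um_core tu qx0 JK kK jT; apply: h.
Qed.
End Fixed.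

Lemma um_bound : (J_um T <= sumn K)%N.
Proof.
rewrite /J_um -size_filter -/um_tuples.
have [q q0 h] := eigen_forms; have [v qv] := mpoly_nonroot q0.
have [x0 [a vE]] := pt_surj v; rewrite -vE in qv.
by have [xi xiP] := h a x0 qv; exact: um_bound_fixed qv xiP.
Qed.
End Bound.

(* complex numbers = R[i] for R : realType (the real numbers) *)
Theorem theorem24 (R : realType) (n : nat) (c : 'I_n -> 'I_n -> 'I_n -> R[i])
    (K : seq nat) (T : seq (seq nat)) :
  lie_structure c ->
  JK_invariants c K T ->
  count_mem 2%N K = 0%N ->
  (count_mem 1%N K <= 1)%N ->
  (J_um T <= sumn K)%N.
Proof.
move=> Lie [p [p0 JKp]] K2 K1.
exact: (@um_bound R[i] n c K T p Lie p0 JKp K2 K1).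
Qed.
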